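(* Let $\theta\in(-1,1)$, $s\in(0,1)$ and let $m\ge0$ be an integer with $m+s>1$. There is a constant $C>0$ independent of $N$ and $u$ such that for every $u\in\mathbb{W}^{m+s}_\theta(\Omega)$, $\Omega=(-1,1)$, and all sufficiently large integers $N$ (how large depending only on $m$ and $s$), $$\|u-\mathcal I_N^Cu\|_{L^\infty(\Omega)}\le CN^{1-m-s}U_\theta^{m,s},\qquad \|u-\mathcal I_N^Cu\|_{L^2_\omega(\Omega)}\le CN^{\frac12-m-s}U_\theta^{m,s},$$ and $$|\mathcal R_N^C[u]|\le CN^{-(m+s)}U_\theta^{m,s},\qquad |\mathcal R_N^L[u]|\le CN^{-(m+s)}U_\theta^{m,s}.$$
   Context: Interpolation and quadrature. Let $x_0,\dots,x_N$ be the zeros of the Chebyshev polynomial $T_{N+1}$, $T_n(x)=\cos(n\arccos x)$. $\mathcal I_N^Cu$ is the polynomial of degree at most $N$ interpolating $u$ at these points, and $\mathcal R_N^C[u]=\int_{-1}^1u(x)(1-x^2)^{-1/2}dx-\frac{\pi}{N+1}\sum_{j=0}^Nu(x_j)$. Further, $\mathcal R_N^L[u]=\int_{-1}^1u(x)dx-\sum_{j=0}^Nu(y_j)\omega_j$, where $y_0,\dots,y_N$ are the zeros of the Legendre polynomial $P_{N+1}$ and $\omega_j$ are the corresponding Legendre–Gauss quadrature weights. $\|\cdot\|_{L^2_\omega(\Omega)}$ is the $L^2$-norm with weight $\omega(x)=(1-x^2)^{-1/2}$. Riemann–Liouville integrals and derivatives for $s\in(0,1)$: on $(-1,\theta)$,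 ${}_xI_\theta^{1-s}f(x)=\frac{1}{\Gamma(1-s)}\int_x^\theta\frac{f(y)}{(y-x)^{s}}dy$ and ${}_x^RD_\theta^{s}f=-\frac{d}{dx}\{{}_xI_\theta^{1-s}f\}$; on $(\theta,1)$, ${}_\theta I_x^{1-s}f(x)=\frac{1}{\Gamma(1-s)}\int_\theta^x\frac{f(y)}{(x-y)^{s}}dy$ and ${}_\theta^RD_x^{s}f=\frac{d}{dx}\{{}_\theta I_x^{1-s}f\}$. Space: $\mathbb{W}^{m+s}_\theta(\Omega)$ is the set of $u\in L^1(\Omega)$ such that $u,u',\dots,u^{(m-1)}$ are absolutely continuous on $[-1,1]$, ${}_xI_\theta^{1-s}u^{(m)}\in \mathrm{BV}(-1,\theta)$ and ${}_\theta I_x^{1-s}u^{(m)}\in \mathrm{BV}(\theta,1)$. Semi-norm (here $m\ge1$ since $m+s>1$): $$U_\theta^{m,s}=\int_{-1}^\theta|{}_x^RD_\theta^su^{(m)}(x)|dx+\int_\theta^1|{}_\theta^RD_x^su^{(m)}(x)|dx+\big|\{{}_xI_\theta^{1-s}u^{(m)}\}(\theta-)\big|+\big|\{{}_\theta I_x^{1-s}u^{(m)}\}(\theta+)\big|,$$ where $f(\theta\pm)$ are one-sided limits and the two integrals are understood as the total variations of ${}_xI_\theta^{1-s}u^{(m)}$ on $(-1,\theta)$ and of ${}_\theta I_x^{1-s}u^{(m)}$ on $(\theta,1)$ (ordinary Lebesgue integrals when these functions are absolutely continuous). *)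

(* Defs.v *)
From HB Require Import structures.
From mathcomp Require Import all_boot all_order all_algebra.
From mathcomp Require Import all_classical all_reals all_analysis.

Set Implicit Arguments.
Unset Strict Implicit.
Unset Printing Implicit Defensive.
Import Order.TTheory GRing.Theory Num.Theory.
Import numFieldNormedType.Exports.

Local Open Scope classical_set_scope.
Local Open Scope ring_scope.

Section Nodes.
Context {R : realType}.
Implicit Types (n N : nat) (u : R -> R).
Local Notation mu := (@lebesgue_measure R).

(* The formula is meaningful for -1 <= x <= 1 only. *)
Definition chebyshevT n (x : R) : R := cos (n%:R * acos x).

(* Rodrigues' formula *)
Definition legendreP n : {poly R} :=
  (2 ^+ n * n`!%:R)^-1 *: (('X^2 - 1) ^+ n)^`(n).

(* A polynomial of degree N + 1 has no other zeros than N + 1 distinct ones;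
   those of T_(N+1) all lie in [-1, 1]. *)
Definition chebyshev_nodes N (x : 'I_N.+1 -> R) :=
  injective x /\ forall j, -1 <= x j <= 1 /\ chebyshevT N.+1 (x j) = 0.

Definition legendre_nodes N (y : 'I_N.+1 -> R) :=
  injective y /\ forall j, root (legendreP N.+1) (y j).

Definition lagrange_basis N (x : 'I_N.+1 -> R) (j : 'I_N.+1) : {poly R} :=
  \prod_(i < N.+1 | i != j) ((x j - x i)^-1 *: ('X - (x i)%:P)).

Definition interpolant N (x : 'I_N.+1 -> R) u : {poly R} :=
  \sum_(j < N.+1) u (x j) *: lagrange_basis x j.

(* The weights of a Gauss rule are those of its interpolatory quadrature. *)
Definition legendre_gauss_weight N (y : 'I_N.+1 -> R) (j : 'I_N.+1) : R :=
  \int[mu]_(t in `]-1, 1[) (lagrange_basis y j).[t].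

Definition chebyshev_weight (x : R) : R := (Num.sqrt (1 - x ^+ 2))^-1.

Definition chebyshev_remainder N (x : 'I_N.+1 -> R) u : R :=
  \int[mu]_(t in `]-1, 1[) (u t * chebyshev_weight t)
  - pi / N.+1%:R * \sum_(j < N.+1) u (x j).

Definition legendre_remainder N (y : 'I_N.+1 -> R) u : R :=
  \int[mu]_(t in `]-1, 1[) u t
  - \sum_(j < N.+1) u (y j) * legendre_gauss_weight y j.

Lemma lagrange_basisE N (x : 'I_N.+1 -> R) (i j : 'I_N.+1) : injective x ->
  (lagrange_basis x j).[x i] = (i == j)%:R.
Proof.
move=> xI; rewrite horner_prod; have [->|ij] := eqVneq i j.
  rewrite big1// => k kj; rewrite !hornerE mulVf// subr_eq0.
  by apply: contra kj => /eqP/xI ->.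
by rewrite (bigD1 i)//= !hornerE subrr mulr0 mul0r.
Qed.

Lemma size_lagrange_basis N (x : 'I_N.+1 -> R) (j : 'I_N.+1) :
  (size (lagrange_basis x j) <= N.+1)%N.
Proof.
apply: leq_trans (size_poly_prod_leq _ _) _.
have cN : #|[pred i | i != j]| = N.
  by rewrite -[RHS]/(N.+1.-1) -[in RHS](card_ord N.+1) -(cardC1 j); apply: eq_card.
rewrite cN leq_subLR addnS ltnS.
have -> : (N + N = \sum_(i < N.+1 | i != j) 2)%N.
  by rewrite sum_nat_const cN muln2 addnn.
apply: leq_sum => i _.
by rewrite (leq_trans (size_scale_leq _ _))// size_XsubC.
Qed.

Lemma interpolantP N (x : 'I_N.+1 -> R) u (p : {poly R}) : injective x ->
  p = interpolant x u <->
  (size p <= N.+1)%N /\ forall j, p.[x j] = u (x j).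
Proof.
move=> xI.
have sI : (size (interpolant x u) <= N.+1)%N.
  rewrite (leq_trans (size_sum _ _ _))//; apply/bigmax_leqP => j _.
  exact: leq_trans (size_scale_leq _ _) (size_lagrange_basis x j).
have vI j : (interpolant x u).[x j] = u (x j).
  rewrite horner_sum (bigD1 j)//= hornerZ lagrange_basisE// eqxx mulr1.
  rewrite big1 ?addr0// => i ij.
  by rewrite hornerZ lagrange_basisE// eq_sym (negbTE ij) mulr0.
split=> [->//|[sp vp]].
apply/eqP; rewrite -subr_eq0; apply/eqP.
apply: (@roots_geq_poly_eq0 _ _ [seq x j | j <- enum 'I_N.+1]).
- by apply/allP => _ /mapP[j _ ->]; rewrite rootE !hornerE vp vI subrr.
- by rewrite map_inj_uniq ?enum_uniq.
- rewrite size_map size_enum_ord (leq_trans (size_polyD _ _))//.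
  by rewrite size_polyN geq_max sp.
Qed.

End Nodes.

Section Spaces.
Context {R : realType}.
Implicit Types (a b theta s x : R) (f u : R -> R) (m : nat).
Local Notation mu := (@lebesgue_measure R).

Definition Linf_norm f : \bar R := 'N[mu]_+oo[EFin \o (f \_ `]-1, 1[)].

Definition L2w_norm f : \bar R :=
  ((\int[mu]_(x in `](-1)%R, 1%R[) (`|f x| ^+ 2 * chebyshev_weight x)%:E)
     `^ (2^-1)%R)%E.

Definition Gamma x : R :=
  \int[mu]_(t in `]0, +oo[) (t `^ (x - 1) * expR (- t)).

(* The Riemann-Liouville integrals of order 1 - s, between x and theta and
   between theta and x. *)
Definition RL_int_left theta s f x : R :=
  (Gamma (1 - s))^-1 * \int[mu]_(y in `]x, theta[) (f y / (y - x) `^ s).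

Definition RL_int_right theta s f x : R :=
  (Gamma (1 - s))^-1 * \int[mu]_(y in `]theta, x[) (f y / (x - y) `^ s).

Definition abs_cont a b f := forall e : R, 0 < e -> exists2 d : R, 0 < d &
  forall (n : nat) (I : 'I_n -> R * R),
    (forall i, [/\ a <= (I i).1, (I i).1 <= (I i).2 & (I i).2 <= b]) ->
    trivIset [set: 'I_n] (fun i => `](I i).1, (I i).2[%classic) ->
    \sum_(i < n) ((I i).2 - (I i).1) < d ->
    \sum_(i < n) `|f (I i).2 - f (I i).1| < e.

(* Variation on the open interval ]a, b[: values at a and b, such as
   RL_int_left theta s f theta = 0, are not taken into account. *)
Definition open_total_variation a b f : \bar R :=
  ereal_sup [set total_variation p.1 p.2 f |
             p in [set p : R * R | [/\ a < p.1, p.1 <= p.2 & p.2 < b]]].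

Definition open_BV a b f := (open_total_variation a b f < +oo)%E.

(* u : R -> R stands for a function on ]-1, 1[.  Its derivatives of order less
   than m are required to exist on ]-1, 1[ and to be absolutely continuous on
   [-1, 1] once extended to the end points; derive1n m u exists almost everywhere. *)
Definition in_W theta m s u :=
  [/\ mu.-integrable `]-1, 1[ (EFin \o u),
      forall k, (k.+1 < m)%N ->
        {in `]-1, 1[, forall x, derivable (derive1n k u) x 1},
      forall k, (k < m)%N -> exists2 v : R -> R,
        abs_cont (-1) 1 v & {in `]-1, 1[, derive1n k u =1 v},
      open_BV (-1) theta (RL_int_left theta s (derive1n m u)) &
      open_BV theta 1 (RL_int_right theta s (derive1n m u))].

(* The integrals of |D^s u^(m)| are read as total variations. *)
Definition U_seminorm theta m s u : \bar R :=
  (open_total_variation (-1)%R theta (RL_int_left theta s (derive1n m u))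
   + open_total_variation theta 1%R (RL_int_right theta s (derive1n m u))
   + `|lim (RL_int_left theta s (derive1n m u) x @[x --> theta^'-])|%:E
   + `|lim (RL_int_right theta s (derive1n m u) x @[x --> theta^'+])|%:E)%E.

End Spaces.

(* Main.v *)
Require Import Defs.
From HB Require Import structures.
From mathcomp Require Import all_boot all_order all_algebra.
From mathcomp Require Import all_classical all_reals all_analysis.
From mathcomp Require Import measurable_realfun ring lra zify.
Import Order.TTheory GRing.Theory Num.Theory.
Import numFieldNormedType.Exports.
Set Implicit Arguments.
Unset Strict Implicit.
Unset Printing Implicit Defensive.
Local Open Scope classical_set_scope.
Local Open Scope ring_scope.

(** The error bounds rest on one-sided polynomial approximation.  Suppose that p <= u <= q
    on ]-1, 1[ for polynomials p, q of degree at most N, and that q - p has integral at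
    most G for the Chebyshev weight; this is [sandwiched N.+1 G u].  Both Gauss rules
    have nonnegative weights and integrate p and q exactly, hence the quadrature errors
    of u are at most G (the weight is at least 1, which covers the Legendre case).
    The Gauss-Chebyshev rule also bounds the values of q - p at the nodes by their sum, of
    order N G.  As the Lagrange polynomials at the Chebyshev nodes are bounded by 2,
    the interpolation error is of order N G uniformly and N^(1/2) G in the weighted
    L^2 norm.  It remains to find such p and q with G of order N^(- m - s) U.

    A step function admits a gap of order 1 / n, by the polynomials of Chebyshev,
    Markov and Stieltjes ([step_sandwich]).  A bounded monotone function is an average of steps up
    to a small error and has the same order ([monotone_sandwiched]).  If f has gap G, then a
    primitive F of f has gap of order G / n: F minus a primitive of p is monotone, of
    range at most G ([sandwiched_derive], and [sandwiched_convex] for convex F).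
    So it is enough to treat v = u^(m - 1) with gap of order n^(- 1 - s).  The truncated power x_+^s
    has such a gap: it is the sum of a monotone function of range n^(- s) and of
    convex or concave ones with slopes of order n^(1 - s) ([tpow_sandwiched]).  Averages of
    its translates, and their uniform limits, have such a gap too; these include
    the convolutions of (x - t)^(s - 1) with bounded monotone functions vanishing to the left
    of theta ([Abel_sandwiched]).

    Finally, v is such a convolution.  It is the integral of a density rho
    equal to u^(m) almost everywhere ([abs_cont_derive]).  To the right of theta,
    v (x) - v (theta) is a constant times the integral of (x - t)^(s - 1) g (t), where g
    is the fractional integral of order 1 - s of rho ([abel_inversion]).  By hypothesis g has bounded
    variation, and it is its limit at theta plus the difference of two monotone functions,
    all bounded by U ([BV_split]).  The left side of theta is the mirror image. *)

(** * Chebyshev polynomials and the Gauss-Chebyshev rule *)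

Section improper_FTC.
Context {R : realType}.
Implicit Types (f F : R -> R) (a b : R).
Local Notation mu := (@lebesgue_measure R).

Lemma itvoo_bigcup a b : a < b ->
  [set` `]a, b[] = \bigcup_n [set` `[a + (b - a) / n.+3%:R, b - (b - a) / n.+3%:R]].
Proof.
move=> ab; apply/seteqP; split => x /=.
  rewrite in_itv /= => /andP[ax xb].
  pose d : R := Num.min (x - a) (b - x).
  have d0 : 0 < d by rewrite lt_min !subr_gt0 ax xb.
  have [n nP] : exists n : nat, (b - a) / d < n%:R.
    exists (Num.bound ((b - a) / d)).
    by apply: archi_boundP; rewrite divr_ge0 ?subr_ge0 ?ltW.
  exists n => //=; rewrite in_itv /=.
  have : (b - a) / n.+3%:R <= d.
    rewrite ler_pdivrMr // mulrC -ler_pdivrMr //.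
    by apply/ltW/(lt_le_trans nP); rewrite ler_nat -addn3 leq_addr.
  by rewrite /d le_min; set w := (b - a) / _ => /andP[h1 h2]; apply/andP; split; lra.
move=> [n _] /=.
have : 0 < (b - a) / n.+3%:R by rewrite divr_gt0 // subr_gt0.
rewrite !in_itv /=; set w := (b - a) / _ => + /andP[h1 h2].
by move=> h; apply/andP; split; lra.
Qed.

(** The integral over ]a, b[ is the limit of those over compact subintervals, where
    f is continuous; the weight (1 - x^2)^(-1/2) is not bounded near the ends. *)
Lemma ge0_continuous_FTC_oo f F a b : a < b ->
  {in `]a, b[, forall x, 0 <= f x} ->
  {in `]a, b[, continuous f} ->
  {within `[a, b], continuous F} ->
  {in `]a, b[, forall x : R, is_derive x (1 : R) F (f x)} ->
  (\int[mu]_(x in `]a, b[) (f x)%:E = (F b - F a)%:E)%E.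
Proof.
move=> ab f0 cf cF dF.
pose e n := (b - a) / n.+3%:R : R.
have e0 n : 0 < e n by rewrite divr_gt0 // subr_gt0.
have ba0 : 0 < b - a by rewrite subr_gt0.
have e2 n : e n < (b - a) / 2%:R.
  by rewrite ltr_pM2l // ltf_pV2 ?posrE // ltr_nat.
have sub n : `[a + e n, b - e n] `<=` `]a, b[.
  by rewrite (itvoo_bigcup ab); exact: (@bigcup_sup _ _ n).
have subi n x : x \in `[a + e n, b - e n] -> x \in `]a, b[.
  by move=> h; apply: (sub n).
pose A n := [set` `[a + e n, b - e n]].
have cvg1 : (\int[mu]_(x in A n) (f x)%:E)%E @[n --> \oo]
    --> (\int[mu]_(x in `]a, b[) (f x)%:E)%E.
  rewrite (itvoo_bigcup ab).
  apply: ge0_nondecreasing_set_cvg_integral => //.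
  - apply/nondecreasing_seqP => n; rewrite subsetEset => x /=.
    have : e n.+1 <= e n.
      by rewrite /e ler_pM2l // lef_pV2 ?posrE // ler_nat.
    by rewrite /A /= !in_itv /= => h /andP[h1 h2]; apply/andP; split; lra.
  - move=> n; exact: measurable_itv.
  - move=> n; apply/measurable_EFinP.
    apply: (@measurable_funS _ _ _ _ `]a, b[) => //; first exact: sub.
    apply: open_continuous_measurable_fun; first exact: interval_open.
    by move=> x; rewrite inE => /cf.
  - by move=> n x /= /subi /f0; rewrite lee_fin.
have FTCn n : (\int[mu]_(x in A n) (f x)%:E
    = (F (b - e n) - F (a + e n))%:E)%E.
  have lt : a + e n < b - e n by have := e2 n; lra.
  have subo x : x \in `](a + e n), (b - e n)[ -> x \in `]a, b[.
    move=> h; apply: (subi n); move: h.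
    by rewrite !in_itv /= => /andP[/ltW -> /ltW ->].
  have cFn x : x \in `]a, b[ -> {for x, continuous F}.
    move=> h; have ? := dF _ h.
    by apply: differentiable_continuous; apply/derivable1_diffP.
  apply: continuous_FTC2 => //.
  - apply: continuous_in_subspaceT => x; rewrite inE => /subi; exact: cf.
  - split.
    + by move=> x /subo /dF.
    + apply: cvg_at_right_filter; apply: cFn.
      by apply: (subi n); rewrite in_itv /= lexx ltW.
    + apply: cvg_at_left_filter; apply: cFn.
      by apply: (subi n); rewrite in_itv /= lexx ltW.
  - by move=> x /subo /dF h; rewrite derive1E; exact: derive_val.
have cvge : e n @[n --> \oo] --> (0 : R).
  rewrite -[X in _ --> X](mulr0 (b - a)); apply: cvgMr.
  have h := @cvg_harmonic R.
  rewrite (_ : (fun n => _) = (fun n => harmonic (n + 2)%N)).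
    by move: h; rewrite -(cvg_shiftn 2).
  by apply/funext => n; rewrite /harmonic addn2.
have [_ cFa cFb] := (continuous_within_itvP F ab).1 cF.
have cvg2 : (F (b - e n) - F (a + e n))%:E @[n --> \oo] --> (F b - F a)%:E.
  apply: cvg_EFin; first exact: nearW.
  apply: cvgB.
    have /cvg_at_leftP := cFb; apply; split; first by move=> n; have := e0 n; lra.
    rewrite -[X in _ --> X]subr0; apply: cvgB => //; exact: cvg_cst.
  have /cvg_at_rightP := cFa; apply; split; first by move=> n; have := e0 n; lra.
  rewrite -[X in _ --> X]addr0; apply: cvgD => //; exact: cvg_cst.
move: cvg1; rewrite (funext FTCn) => cvg1.
exact: (cvg_unique _ cvg1 cvg2).
Qed.

End improper_FTC.

Section chebyshev.
Context {R : realType}.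
Implicit Types (a b x : R) (p q : {poly R}) (n k M N : nat).
Local Notation mu := (@lebesgue_measure R).
Local Notation w := (@chebyshev_weight R).

Lemma sin_natpi n : sin (n%:R * pi) = 0 :> R.
Proof.
elim: n => [|n IH]; first by rewrite mul0r sin0.
by rewrite -natr1 mulrDl mul1r sinDpi IH oppr0.
Qed.

Fixpoint Tpoly n : {poly R} :=
  match n with
  | 0 => 1
  | n1.+1 => match n1 with
             | 0 => 'X
             | n2.+1 => 2%:R *: ('X * Tpoly n1) - Tpoly n2
             end
  end.

Lemma TpolySS n : Tpoly n.+2 = 2%:R *: ('X * Tpoly n.+1) - Tpoly n.
Proof. by []. Qed.

Lemma Tpoly_cos n a : (Tpoly n).[cos a] = cos (n%:R * a).
Proof.
suff: (Tpoly n).[cos a] = cos (n%:R * a) /\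
      (Tpoly n.+1).[cos a] = cos (n.+1%:R * a) by case.
elim: n => [|n [IH1 IH2]]; first by rewrite mul0r cos0 mul1r !hornerE.
split=> //; rewrite TpolySS !hornerE IH1 IH2.
have -> : n.+2%:R * a = n.+1%:R * a + a by rewrite -natr1 mulrDl mul1r.
have -> : n%:R * a = n.+1%:R * a - a by rewrite -natr1 mulrDl mul1r addrK.
rewrite !cosD cosN sinN /=; ring.
Qed.

Lemma TpolyE n x : -1 <= x <= 1 -> (Tpoly n).[x] = chebyshevT n x.
Proof.
by move=> x1; rewrite /chebyshevT -Tpoly_cos acosK // in_itv.
Qed.

Lemma size_Tpoly n : size (Tpoly n) = n.+1.
Proof.
suff: size (Tpoly n) = n.+1 /\ size (Tpoly n.+1) = n.+2 by case.
elim: n => [|n [IH1 IH2]]; first by rewrite size_poly1 size_polyX.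
split=> //; rewrite TpolySS.
have sX : size (2%:R *: ('X * Tpoly n.+1)) = n.+3.
  by rewrite size_scale // mulrC size_mulX -?size_poly_eq0 IH2.
by rewrite size_polyDl sX // size_polyN IH1.
Qed.

Lemma Tpoly_le1 n x : -1 <= x <= 1 -> `|(Tpoly n).[x]| <= 1.
Proof. by move=> /TpolyE ->; exact: cos_max. Qed.

(** Tpoly k has degree exactly k, so the leading terms can be removed one by one. *)
Lemma Tpoly_span n p : (size p <= n)%N ->
  exists c : nat -> R, p = \sum_(k < n) c k *: Tpoly k.
Proof.
elim: n p => [|n IH] p sp.
  exists (fun=> 0); rewrite big_ord0; apply/eqP.
  by rewrite -size_poly_eq0 -leqn0.
pose d := p`_n / lead_coef (Tpoly n).
have [|c pE] := IH (p - d *: Tpoly n).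
  apply/leq_sizeP => i; rewrite leq_eqVlt => /predU1P[<-|ni].
    rewrite coefB coefZ [X in _ - d * X](_ : _ = lead_coef (Tpoly n)).
      by rewrite divfK ?subrr // lead_coef_eq0 -size_poly_eq0 size_Tpoly.
    by rewrite lead_coefE size_Tpoly.
  rewrite coefB coefZ !nth_default ?mulr0 ?subr0 ?size_Tpoly //.
  exact: leq_trans sp _.
exists (fun k => if k == n then d else c k).
rewrite big_ord_recr /= eqxx -[LHS](subrK (d *: Tpoly n)) pE; congr (_ + _).
by apply: eq_bigr => k _; rewrite ltn_eqF.
Qed.

Definition cnode M j : R := cos ((2 * j + 1)%:R * (pi / (2 * M)%:R)).

Lemma cnode_angle M j : (j < M)%N ->
  0 < (2 * j + 1)%:R * (pi / (2 * M)%:R : R) < pi.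
Proof.
move=> jM; have pi0 := @pi_gt0 R.
have M0 : 0 < (2 * M)%:R :> R by rewrite ltr0n; lia.
apply/andP; split; first by rewrite mulr_gt0 ?divr_gt0 // ltr0n addn1.
rewrite mulrA ltr_pdivrMr // mulrC ltr_pM2l // ltr_nat; lia.
Qed.

Lemma cnode_itv M j : (j < M)%N -> -1 < cnode M j < 1.
Proof.
move=> jM; have /andP[h1 h2] := cnode_angle jM.
rewrite /cnode; set a := _ * _ in h1 h2 *.
have -> : -1 = cos pi :> R by rewrite cospi.
have -> : 1 = cos 0 :> R by rewrite cos0.
by rewrite !ltr_cos ?h1 ?h2 // in_itv /= ?(ltW h1) ?(ltW h2) ?lexx ?pi_ge0.
Qed.

Lemma cnode_lt M i j : (i < j < M)%N -> cnode M j < cnode M i.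
Proof.
move=> /andP[ij jM].
have /andP[h1 h2] := cnode_angle jM.
have /andP[h3 h4] := cnode_angle (ltn_trans ij jM).
rewrite /cnode ltr_cos ?in_itv /= ?ltW // ltr_pM2r.
  by rewrite ltr_nat; lia.
by rewrite divr_gt0 ?pi_gt0 // ltr0n; lia.
Qed.

Lemma cnode_inj M i j : (i < M)%N -> (j < M)%N -> cnode M i = cnode M j -> i = j.
Proof.
move=> iM jM e; case: (ltngtP i j) => // h.
- by have := @cnode_lt M i j; rewrite h jM e ltxx => /(_ isT).
- by have := @cnode_lt M j i; rewrite h iM e ltxx => /(_ isT).
Qed.

(** With b = k pi / (2 M), the terms are cos ((2 j + 1) b); multiplied by 2 sin b
    they telescope to sin (2 M b) = sin (k pi) = 0. *)
Lemma sum_Tpoly_cnode M k : (0 < k < 2 * M)%N ->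
  \sum_(j < M) (Tpoly k).[cnode M j] = 0.
Proof.
move=> /andP[k0 kM].
have M0 : 0 < (2 * M)%:R :> R by rewrite ltr0n; lia.
pose b : R := k%:R * (pi / (2 * M)%:R).
have sb : sin b != 0.
  apply/lt0r_neq0/sin_gt0_pi; apply/andP; split.
    by rewrite mulr_gt0 ?divr_gt0 ?pi_gt0 // ltr0n.
  by rewrite /b mulrA ltr_pdivrMr // mulrC ltr_pM2l ?pi_gt0 // ltr_nat.
apply: (mulIf (x := 2 * sin b)); first by rewrite mulf_neq0.
rewrite mul0r mulr_suml.
transitivity (\sum_(j < M) (sin ((2 * j.+1)%:R * b) - sin ((2 * j)%:R * b))).
  apply: eq_bigr => j _; rewrite Tpoly_cos.
  have -> : k%:R * ((2 * j + 1)%:R * (pi / (2 * M)%:R)) = (2 * j)%:R * b + b :> R.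
    by rewrite /b natrD; ring.
  have -> : (2 * j.+1)%:R * b = (2 * j)%:R * b + b + b.
    by rewrite !natrM -natr1; ring.
  set c := (2 * j)%:R * b.
  have -> : sin c = sin (c + b - b) by rewrite addrK.
  rewrite [sin (c + b + b)]sinD sinB; ring.
rewrite -(big_mkord predT (fun j => sin ((2 * j.+1)%:R * b) - sin ((2 * j)%:R * b))).
rewrite telescope_sumr // muln0 mul0r sin0 subr0.
have -> : (2 * M)%:R * b = k%:R * pi by rewrite /b mulrC -mulrA divfK ?lt0r_neq0.
exact: sin_natpi.
Qed.

Lemma continuous_within_acos : {within `[(-1 : R), 1], continuous (@acos R)}.
Proof.
rewrite -cospi -cos0.
apply: (@segment_can_ge_continuous _ _ _ cos (@acos R)).
- exact: pi_ge0.
- by apply: continuous_subspaceT => x; exact: continuous_cos.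
- exact: cosK.
Qed.

Lemma chebyshev_weight_ge0 x : 0 <= w x.
Proof. by rewrite /chebyshev_weight invr_ge0 sqrtr_ge0. Qed.

Lemma one_subsqr_gt0 x : x \in `]-1, 1[ -> 0 < 1 - x ^+ 2.
Proof. by rewrite in_itv /= => /andP[h1 h2]; nra. Qed.

Lemma chebyshev_weight_ge1 x : x \in `]-1, 1[ -> 1 <= w x.
Proof.
move=> /one_subsqr_gt0 h; rewrite /chebyshev_weight invf_ge1 ?sqrtr_gt0 //.
by rewrite -[leRHS]sqrtr1 ler_sqrt // lerBlDr lerDl sqr_ge0.
Qed.

Lemma chebyshev_weight_continuous : {in `]-1, 1[, continuous w}.
Proof.
move=> x /one_subsqr_gt0 h; apply: cvgV; first by rewrite lt0r_neq0 // sqrtr_gt0.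
apply: (@continuous_comp _ _ _ (fun x => 1 - x ^+ 2) Num.sqrt); last exact: sqrt_continuous.
by apply: cvgB; [exact: cvg_cst | exact: exprn_continuous].
Qed.

Lemma horner_bounded p : exists M : R, forall x, -1 <= x <= 1 -> `|p.[x]| <= M.
Proof.
exists (\sum_(i < size p) `|p`_i|) => x /andP[x1 x2].
rewrite horner_coef (le_trans (ler_norm_sum _ _ _)) // ler_sum // => i _.
by rewrite normrM ler_piMr // normrX exprn_ile1 // ler_norml x1.
Qed.

Lemma chebyshev_weight_measurable : measurable_fun `](-1 : R), 1[ w.
Proof.
apply: open_continuous_measurable_fun; first exact: interval_open.
by move=> x; rewrite inE => /chebyshev_weight_continuous.
Qed.

Lemma horner_measurable p (D : set R) : measurable_fun D (horner p).
Proof.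
apply: measurable_funTS; apply: continuous_measurable_fun.
exact: continuous_horner.
Qed.

(** The summand 1 makes the integrand nonnegative, as required by the improper
    fundamental theorem; the primitive comes from x = cos a. *)
Lemma integral_Tpoly_shift k : (0 < k)%N ->
  (\int[mu]_(t in `](-1)%R, 1%R[) ((1 + (Tpoly k).[t]) * w t)%:E = pi%:E)%E.
Proof.
move=> k0.
pose F (x : R) := - (acos x + k%:R^-1 * sin (k%:R * acos x)).
have k0' : k%:R != 0 :> R by rewrite pnatr_eq0 -lt0n.
rewrite (@ge0_continuous_FTC_oo R _ F) //.
- rewrite /F acos1 acosN1 mulr0 sin0 sin_natpi !mulr0 !addr0 oppr0 sub0r opprK //.
- move=> x; rewrite in_itv /= => /andP[/ltW x1 /ltW x2].
  have /ler_normlP[h1 h2] := @Tpoly_le1 k x ltac:(by rewrite x1).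
  by rewrite mulr_ge0 ?chebyshev_weight_ge0 //; lra.
- move=> x xI; apply: cvgM; last exact: chebyshev_weight_continuous.
  by apply: cvgD; [exact: cvg_cst|exact: continuous_horner].
- have cA := continuous_within_acos.
  move=> x; apply: cvgN; apply: cvgD; first exact: cA.
  apply: cvgM; first exact: cvg_cst.
  apply: (@continuous_comp _ _ _ (acos : subspace `[-1, 1] -> R) (fun y => sin (k%:R * y))).
    exact: cA.
  have cs : continuous (fun y : R => sin (k%:R * y)).
    move=> y; apply: (@continuous_comp _ _ _ (fun y : R => k%:R * y) sin).
      exact: mulrl_continuous.
    exact: continuous_sin.
  exact: cs.
- move=> x; rewrite in_itv /= => /andP[x1 x2].
  have h := is_derive1_acos (introT andP (conj x1 x2)).
  apply: is_derive_eq.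
  rewrite TpolyE ?ltW // /chebyshevT /chebyshev_weight /GRing.scale /=.
  by set i := (Num.sqrt _)^-1; field.
Qed.

Lemma integral_chebyshev_weight :
  (\int[mu]_(t in `](-1)%R, 1%R[) (w t)%:E = pi%:E)%E.
Proof.
rewrite (@ge0_continuous_FTC_oo R _ (fun x => - acos x)) //.
- by rewrite acos1 acosN1 oppr0 sub0r opprK.
- by move=> x _; exact: chebyshev_weight_ge0.
- exact: chebyshev_weight_continuous.
- by have cA := continuous_within_acos; move=> x; apply: cvgN; exact: cA.
- move=> x; rewrite in_itv /= => /andP[x1 x2].
  have h := is_derive1_acos (introT andP (conj x1 x2)).
  by apply: is_derive_eq; rewrite opprK.
Qed.

Lemma integrable_chebyshev_weight (f : R -> R) (M : R) :
  measurable_fun `](-1 : R), 1[ f -> {in `]-1, 1[, forall t, `|f t| <= M} ->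
  mu.-integrable `]-1, 1[ (fun t => (f t * w t)%:E).
Proof.
move=> mf fM.
have iw : mu.-integrable `]-1, 1[ (fun t => (M * w t)%:E).
  apply: (@integrableZl _ _ _ mu _ _ M (EFin \o w)) => //; apply/integrableP; split.
    apply/measurable_EFinP; exact: chebyshev_weight_measurable.
  under eq_integral do rewrite gee0_abs ?lee_fin ?chebyshev_weight_ge0 //.
  by rewrite integral_chebyshev_weight ltry.
apply: le_integrable iw => //.
  apply/measurable_EFinP; apply: measurable_funM => //.
  exact: chebyshev_weight_measurable.
move=> x xI; rewrite lee_fin !normrM ler_wpM2r //.
by rewrite (le_trans (fM _ xI)) // ler_norm.
Qed.

Definition cint p : R := \int[mu]_(t in `]-1, 1[) (p.[t] * w t).

Lemma integrable_cint p : mu.-integrable `]-1, 1[ (fun t => (p.[t] * w t)%:E).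
Proof.
have [M pM] := horner_bounded p.
apply: (@integrable_chebyshev_weight (horner p) M).
  exact: horner_measurable.
by move=> t; rewrite in_itv /= => /andP[/ltW h1 /ltW h2]; rewrite pM ?h1.
Qed.

Lemma cintD p q : cint (p + q) = cint p + cint q.
Proof.
rewrite /cint -RintegralD //; try exact: integrable_cint.
by apply: eq_Rintegral => t _; rewrite hornerD mulrDl.
Qed.

Lemma cintZ c p : cint (c *: p) = c * cint p.
Proof.
rewrite /cint -RintegralZl //; last exact: integrable_cint.
by apply: eq_Rintegral => t _; rewrite hornerZ mulrA.
Qed.

Lemma cint_Tpoly k : cint (Tpoly k) = if k == 0%N then pi else 0.
Proof.
have c1 : cint 1 = pi.
  rewrite /cint /Rintegral.
  by under eq_integral do rewrite hornerC mul1r; rewrite integral_chebyshev_weight.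
case: k => [|k] //=.
have : cint (1 + Tpoly k.+1) = pi.
  rewrite /cint /Rintegral.
  by under eq_integral do rewrite hornerD hornerC; rewrite integral_Tpoly_shift.
by rewrite cintD c1 -{2}[pi]addr0 => /addrI.
Qed.

Lemma cint_sum I (r : seq I) (F : I -> {poly R}) :
  cint (\sum_(i <- r) F i) = \sum_(i <- r) cint (F i).
Proof.
elim: r => [|i r IH]; last by rewrite !big_cons cintD IH.
by rewrite !big_nil -(scale0r 1) cintZ mul0r.
Qed.

(** Gauss-Chebyshev quadrature: both sides vanish on Tpoly k for 0 < k < 2 M. *)
Lemma cint_cnode M p : (size p <= 2 * M)%N ->
  cint p = pi / M%:R * \sum_(j < M) p.[cnode M j].
Proof.
case: M => [|M].
  rewrite muln0 leqn0 size_poly_eq0 => /eqP ->.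
  by rewrite big_ord0 mulr0 -(scale0r 1) cintZ mul0r.
move=> /Tpoly_span[c ->]; rewrite cint_sum.
under [in RHS]eq_bigr do rewrite horner_sum.
rewrite exchange_big mulr_sumr; apply: eq_bigr => k _ /=.
rewrite cintZ cint_Tpoly.
under eq_bigr do rewrite hornerZ.
rewrite -mulr_sumr; case: ifPn => [/eqP ->|k0].
  under eq_bigr do rewrite hornerC.
  by rewrite sumr_const card_ord; field.
by rewrite sum_Tpoly_cnode ?mulr0 // lt0n k0 ltn_ord.
Qed.

(** Cosines are infinitely many points. *)
Lemma poly_eq_cos p q : (forall a, p.[cos a] = q.[cos a]) -> p = q.
Proof.
move=> e; apply/eqP; rewrite -subr_eq0; apply/eqP.
set M := size (p - q).
apply: (@roots_geq_poly_eq0 _ _ [seq cnode M j | j <- iota 0 M]).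
- by apply/allP => _ /mapP[j _ ->]; rewrite rootE !hornerE e subrr.
- rewrite map_inj_in_uniq ?iota_uniq // => i j; rewrite !mem_iota /= !add0n.
  exact: cnode_inj.
- by rewrite size_map size_iota.
Qed.

Lemma mul_Tpoly k l : (l <= k)%N ->
  Tpoly k * Tpoly l = 2^-1 *: (Tpoly (k + l) + Tpoly (k - l)).
Proof.
move=> lk; apply: poly_eq_cos => a.
rewrite !hornerE !Tpoly_cos natrD natrB // mulrDl mulrBl cosD cosB.
by field.
Qed.

Lemma cint_mul_Tpoly k l :
  cint (Tpoly k * Tpoly l) =
  if k == l then (if k == 0%N then pi else pi / 2) else 0.
Proof.
wlog lk : k l / (l <= k)%N.
  move=> H; case/orP: (leq_total l k) => [/H//|/H].
  by rewrite mulrC eq_sym => ->; case: eqP => // ->.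
rewrite mul_Tpoly // cintZ cintD !cint_Tpoly addn_eq0 subn_eq0.
case: (eqVneq k l) => [->|kl]; last first.
  have -> : (k <= l)%N = false by apply/negbTE; rewrite -ltnNge ltn_neqAle eq_sym kl.
  have -> : (k == 0)%N = false by apply/negbTE; apply: contra kl => /eqP k0; move: lk; rewrite k0 leqn0 eq_sym.
  by rewrite /= addr0 mulr0.
by rewrite leqnn andbb; case: ifP => _; field.
Qed.

(** By counting roots.  It reduces any enumeration of the Chebyshev nodes to cnode. *)
Lemma roots_perm_eq p (s t : seq R) : p != 0 -> (size p <= (size s).+1)%N ->
  (size p <= (size t).+1)%N ->
  all (root p) s -> all (root p) t -> uniq s -> uniq t -> perm_eq s t.
Proof.
move=> p0 ss st rs rt us ut; apply: uniq_perm => //.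
suff sub (u v : seq R) : (size p <= (size v).+1)%N -> all (root p) u ->
    all (root p) v -> uniq v -> {subset u <= v}.
  by move=> x; apply/idP/idP; apply: sub.
move=> sv ru rv uv x xu; apply/negP => /negP xv.
have := @max_poly_roots _ p (x :: v) p0.
rewrite /= (allP ru) // rv xv uv => /(_ isT isT).
by rewrite ltnNge sv.
Qed.

Lemma chebyshev_nodes_perm N (x : 'I_N.+1 -> R) : chebyshev_nodes x ->
  perm_eq [seq x j | j <- enum 'I_N.+1] [seq cnode N.+1 (val j) | j <- enum 'I_N.+1].
Proof.
move=> [xI xT].
apply: (@roots_perm_eq (Tpoly N.+1)).
- by rewrite -size_poly_eq0 size_Tpoly.
- by rewrite size_Tpoly size_map size_enum_ord.
- by rewrite size_Tpoly size_map size_enum_ord.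
- apply/allP => _ /mapP[j _ ->]; have [h1 h2] := xT j.
  by rewrite rootE TpolyE // h2.
- apply/allP => _ /mapP[j _ ->]; rewrite rootE /cnode Tpoly_cos.
  have -> : N.+1%:R * ((2 * j + 1)%:R * (pi / (2 * N.+1)%:R)) = j%:R * pi + pi / 2 :> R.
    by rewrite natrD !natrM; field.
  by rewrite cosDpihalf sin_natpi oppr0.
- by rewrite map_inj_uniq ?enum_uniq.
- rewrite map_inj_in_uniq ?enum_uniq // => i j _ _ e; apply: val_inj.
  exact: (cnode_inj (ltn_ord i) (ltn_ord j) e).
Qed.

Lemma chebyshev_nodes_sum N (x : 'I_N.+1 -> R) (f : R -> R) : chebyshev_nodes x ->
  \sum_(j < N.+1) f (x j) = \sum_(j < N.+1) f (cnode N.+1 j).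
Proof.
move=> /chebyshev_nodes_perm h.
transitivity (\sum_(y <- [seq x j | j <- enum 'I_N.+1]) f y).
  by rewrite big_map big_enum.
by rewrite (perm_big _ h) big_map big_enum.
Qed.

Lemma chebyshev_nodes_itv N (x : 'I_N.+1 -> R) j : chebyshev_nodes x ->
  x j \in `]-1, 1[.
Proof.
move=> /chebyshev_nodes_perm /perm_mem /(_ (x j)).
rewrite map_f ?mem_enum // => /esym /mapP[i _ ->].
by rewrite in_itv /= cnode_itv.
Qed.

Lemma cint_chebyshev_nodes N (x : 'I_N.+1 -> R) p : chebyshev_nodes x ->
  (size p <= 2 * N.+1)%N -> cint p = pi / N.+1%:R * \sum_(j < N.+1) p.[x j].
Proof.
by move=> xT sp; rewrite (cint_cnode sp) (chebyshev_nodes_sum (horner p) xT).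
Qed.

(** In the basis of Chebyshev polynomials, exactness of the quadrature gives the
    coefficients T_k(x_j) (2 - [k = 0]) / (N + 1), at most 2 / (N + 1) in absolute value. *)
Lemma lagrange_chebyshev_le2 N (x : 'I_N.+1 -> R) j t : chebyshev_nodes x ->
  -1 <= t <= 1 -> `|(lagrange_basis x j).[t]| <= 2.
Proof.
move=> xT t1; have [xI _] := xT.
have sl := size_lagrange_basis x j.
have [c lE] := Tpoly_span sl.
have c_le (k : 'I_N.+1) : `|c k| <= 2 / N.+1%:R.
  have e1 : cint (lagrange_basis x j * Tpoly k) = pi / N.+1%:R * (Tpoly k).[x j].
    rewrite (cint_chebyshev_nodes xT); last first.
      rewrite (leq_trans (size_polyMleq _ _)) // size_Tpoly.
      by rewrite addnS /= mul2n -addnn leq_add // ltnW.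
    rewrite (bigD1 j) //= hornerM lagrange_basisE // eqxx mul1r big1 ?addr0 //.
    by move=> i ij; rewrite hornerM lagrange_basisE // (negbTE ij) mul0r.
  have e2 : cint (lagrange_basis x j * Tpoly k) =
      c k * (if k == 0%N :> nat then pi else pi / 2).
    rewrite lE mulr_suml cint_sum (bigD1 k) //= -scalerAl cintZ cint_mul_Tpoly.
    rewrite eqxx big1 ?addr0 // => i ik.
    by rewrite -scalerAl cintZ cint_mul_Tpoly; have := negbTE ik; rewrite -val_eqE /= => ->; rewrite mulr0.
  have [xj1 _] := xT.2 j.
  have Tle := @Tpoly_le1 k (x j) xj1.
  have p0 := @pi_gt0 R.
  have n0 : 0 < N.+1%:R^-1 :> R by rewrite invr_gt0.
  have e3 : `|c k| * (if k == 0%N :> nat then pi else pi / 2) <= pi / N.+1%:R.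
    rewrite -[X in _ * X]ger0_norm; last by case: ifP => _; lra.
    have pN : 0 <= pi / N.+1%:R :> R by rewrite divr_ge0 // ltW.
    by rewrite -normrM -e2 e1 normrM ger0_norm // ler_piMr.
  have e4 : `|c k| * (pi / 2) <= pi / N.+1%:R.
    by apply: le_trans e3; rewrite ler_wpM2l //; case: ifP => _ //; lra.
  rewrite -(@ler_pM2r _ (pi / 2)) ?divr_gt0 // (le_trans e4) //.
  have -> : 2 / N.+1%:R * (pi / 2) = pi / N.+1%:R :> R by field.
  exact: lexx.
rewrite lE horner_sum (le_trans (ler_norm_sum _ _ _)) //.
apply: (@le_trans _ _ (\sum_(k < N.+1) 2 / N.+1%:R)).
  apply: ler_sum => k _; rewrite hornerZ normrM.
  by rewrite (le_trans _ (c_le k)) // ler_piMr // Tpoly_le1.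
by rewrite sumr_const card_ord -[X in X <= _]mulr_natr divfK.
Qed.

End chebyshev.

(** * One-sided approximation of steps and of monotone functions *)

Section onesided_step.
Context {R : realType}.
Implicit Types (Y Z s : seq R) (r x c : R) (M : nat) (p q : {poly R}).

(** The sign of the Bezout coefficients of two polynomials whose roots are
    separated.  They are built by removing one root y or z at a time, from
    (z - y) = (X - y) - (X - z); this recursion keeps the signs visible. *)
Lemma bezout_separated Y Z : {in Y & Z, forall y z, y < z} -> Y ++ Z != [::] ->
  exists a b : {poly R},
  [/\ (\prod_(y <- Y) ('X - y%:P)) * a + (\prod_(z <- Z) ('X - z%:P)) * b = 1,
      (size a <= size Z)%N, (size b <= size Y)%N,
      forall x, {in Z, forall z, x <= z} -> 0 <= a.[x] &
      forall x, {in Y, forall y, y <= x} -> 0 <= (-1) ^+ size Z * b.[x]].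
Proof.
elim: Y Z => [|y Y IHY].
  move=> Z _ Z0; exists 1, 0; rewrite big_nil mul1r mulr0 addr0; split=> //.
  - by rewrite size_poly1 lt0n size_eq0.
  - by rewrite size_poly0.
  - by move=> x _; rewrite hornerE.
  - by move=> x _; rewrite horner0 mulr0.
elim=> [|z Z IHZ] YZ _.
  exists 0, 1; rewrite big_nil mul1r mulr0 add0r; split=> //.
  - by rewrite size_poly0.
  - by rewrite size_poly1.
  - by move=> x _; rewrite horner0.
  - by move=> x _; rewrite expr0 mul1r hornerE.
have [||a1 [b1 [e1 sa1 sb1 pa1 pb1]]] := IHY (z :: Z).
- by move=> u v uY vZ; apply: YZ => //; rewrite inE uY orbT.
- by case: (Y).
have [||a2 [b2 [e2 sa2 sb2 pa2 pb2]]] := IHZ.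
- by move=> u v uY vZ; apply: YZ => //; rewrite inE vZ orbT.
- by [].
have yz : y < z by apply: YZ; rewrite inE eqxx.
have zy0 : 0 < (z - y)^-1 by rewrite invr_gt0 subr_gt0.
exists ((z - y)^-1 *: (a1 - ('X - z%:P) * a2)).
exists ((z - y)^-1 *: (('X - y%:P) * b1 - b2)).
move: e1 e2; rewrite !big_cons.
set W := \prod_(_ <- Y) _; set V := \prod_(_ <- Z) _ => e1 e2.
split.
- rewrite -!scalerAr -scalerDr.
  have -> : ('X - y%:P) * W * (a1 - ('X - z%:P) * a2) +
            ('X - z%:P) * V * (('X - y%:P) * b1 - b2) =
     ('X - y%:P) * (W * a1 + ('X - z%:P) * V * b1) -
     ('X - z%:P) * (('X - y%:P) * W * a2 + V * b2) by ring.
  rewrite e1 e2 !mulr1 (_ : _ - _ = (z - y)%:P); last by rewrite polyCB; ring.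
  by rewrite -mul_polyC -polyCM mulVf // subr_eq0 gt_eqF.
- rewrite (leq_trans (size_scale_leq _ _)) // (leq_trans (size_polyD _ _)) //.
  rewrite geq_max sa1 size_polyN (leq_trans (size_polyMleq _ _)) //.
  by rewrite size_XsubC.
- rewrite (leq_trans (size_scale_leq _ _)) // (leq_trans (size_polyD _ _)) //.
  rewrite geq_max size_polyN sb2 andbT (leq_trans (size_polyMleq _ _)) //.
  by rewrite size_XsubC.
- move=> x xZ; rewrite !hornerE mulr_ge0 ?(ltW zy0) //.
  rewrite -mulNr opprB addr_ge0 ?pa1 // mulr_ge0 ?pa2 //.
    by rewrite subr_ge0 xZ // inE eqxx.
  by move=> v vZ; rewrite xZ // inE vZ orbT.
- move=> x xY; rewrite hornerZ mulrCA mulr_ge0 ?(ltW zy0) //.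
  rewrite hornerD hornerN hornerM hornerXsubC.
  rewrite mulrBr mulrCA addr_ge0 //.
    rewrite mulr_ge0 ?pb1 //; first by rewrite subr_ge0 xY // inE eqxx.
    by move=> u uY; rewrite xY // inE uY orbT.
  by rewrite exprS mulN1r mulNr opprK pb2.
Qed.

Let prodXX (s : seq R) : \prod_(y <- s ++ s) ('X - y%:P) =
  (\prod_(y <- s) ('X - y%:P)) ^+ 2 :> {poly R}.
Proof. by rewrite big_cat expr2. Qed.

Let size_prod_mul Y (a : {poly R}) n : (size a <= n)%N -> (0 < n)%N ->
  (size ((\prod_(y <- Y) ('X - y%:P)) * a)%R <= size Y + n)%N.
Proof.
move=> an n0; rewrite (leq_trans (size_polyMleq _ _)) // size_prod_XsubC addSn.
by rewrite leq_add2l.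
Qed.

Let size_split s c : uniq s -> c \in s ->
  (size [seq z <- s | (z < c)%R] + size [seq z <- s | (c < z)%R]).+1 = size s.
Proof.
move=> us cs; rewrite !size_filter -addn1.
have -> : 1%N = count_mem c s by rewrite count_uniq_mem // cs.
elim: s {us cs} => //= z s <-; case: (ltgtP z c) => _ /=; lia.
Qed.

Lemma prod_XsubC_root s x : x \in s -> (\prod_(y <- s) ('X - y%:P)).[x] = 0.
Proof.
by move=> xs; apply/eqP; have := root_prod_XsubC s x; rewrite xs => /idP; rewrite rootE.
Qed.

(** The Chebyshev-Markov-Stieltjes majorant: the polynomial W^2 a is a square
    times a factor that is nonnegative up to the node c, and 1 minus it is nonpositive
    from c on.  All nodes except c count twice, whence the degree. *)
Lemma step_majorant s c : uniq s -> c \in s -> exists p,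
  [/\ (size p <= 2 * size s)%N, forall x, (c <= x)%R%:R <= p.[x] &
      {in s, forall z, p.[z] = (c <= z)%R%:R}].
Proof.
move=> us cs; pose lo := [seq z <- s | z < c]; pose hi := [seq z <- s | c < z].
have [||a [b [e sa sb pa pb]]] := @bezout_separated (lo ++ lo) (c :: hi ++ hi).
- move=> y z; rewrite mem_cat orbb inE mem_cat orbb !mem_filter.
  move=> /andP[yc _] /predU1P[->//|/andP[cz _]]; exact: lt_trans yc cz.
- by case: (lo).
move: e; rewrite big_cons !prodXX.
set W := \prod_(_ <- lo) _; set V := \prod_(_ <- hi) _ => e.
exists (W ^+ 2 * a).
have eV x : (W ^+ 2 * a).[x] = 1 - ((x - c) * V.[x] ^+ 2) * b.[x].
  have /(congr1 (fun p => p.[x])) := e.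
  by rewrite !hornerE => <-; rewrite addrK.
have eW x : (W ^+ 2 * a).[x] = W.[x] ^+ 2 * a.[x] by rewrite !hornerE.
have p1 x : c <= x -> 1 <= (W ^+ 2 * a).[x].
  move=> cx; rewrite eV lerDl oppr_ge0 mulr_ge0_le0 //.
    by rewrite mulr_ge0 ?sqr_ge0 // subr_ge0.
  have := pb x; rewrite /= exprS size_cat addnn -mul2n exprM sqrrN expr1n expr1n.
  rewrite mulr1 mulN1r oppr_ge0; apply => y; rewrite mem_cat orbb mem_filter.
  by move=> /andP[/ltW yc _]; exact: le_trans yc cx.
split.
- rewrite -prodXX.
  have := @size_prod_mul (lo ++ lo) a _ sa isT; move=> /leq_trans; apply.
  move: (size_split us cs); rewrite -/lo -/hi => <-.
  rewrite /= !size_cat; set u := size lo; set v := size hi; lia.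
- move=> x; case: (leP c x) => [|/ltW xc]; first exact: p1.
  rewrite eW mulr_ge0 ?sqr_ge0 // pa // => z; rewrite inE mem_cat orbb mem_filter.
  by move=> /predU1P[->//|/andP[/ltW cz _]]; exact: le_trans xc cz.
- move=> z zs; case: (ltgtP c z) => cz.
  + by rewrite eV [V.[z]]prod_XsubC_root ?mem_filter ?cz // expr0n mulr0 mul0r subr0.
  + by rewrite eW [W.[z]]prod_XsubC_root ?mem_filter ?cz // expr0n mul0r.
  + by rewrite eV cz subrr !mul0r subr0.
Qed.

Lemma seq_max s : s != [::] -> exists2 c, c \in s & {in s, forall z, z <= c}.
Proof.
elim: s => // x s IH _; have [->|/IH[c cs cm]] := eqVneq s [::].
  by exists x => [|z]; rewrite inE // => /eqP ->.
have [xc|cx] := leP x c.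
  exists c; first by rewrite inE cs orbT.
  by move=> z; rewrite inE => /predU1P[->//|/cm].
exists x; first by rewrite inE eqxx.
by move=> z; rewrite inE => /predU1P[->//|/cm zc]; exact: le_trans zc (ltW cx).
Qed.

(** The majorant of the step at the last node c before r exceeds the step at r
    by 1 at c, and by nothing at the other nodes. *)
Lemma step_majorant_sum s r : uniq s -> (0 < size s)%N -> exists p,
  [/\ (size p <= 2 * size s)%N, forall x, (r <= x)%R%:R <= p.[x] &
      \sum_(z <- s) p.[z] <= 1 + \sum_(z <- s) (r <= z)%R%:R].
Proof.
move=> us s0; have [A0|A0] := eqVneq [seq z <- s | z < r] [::].
  exists 1; split.
  - by rewrite size_poly1; lia.
  - by move=> x; rewrite hornerE lern1 leq_b1.
  - rewrite -[leLHS]add0r lerD // [leLHS]big_seq [leRHS]big_seq ler_sum // => z zs; rewrite hornerE.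
    suff -> : r <= z by [].
    rewrite leNgt; apply/negP => zr.
    have : z \in [seq z <- s | z < r] by rewrite mem_filter zr.
    by rewrite A0.
have [c] := seq_max A0; rewrite mem_filter => /andP[cr cs] cm.
have [p [sp p1 ps]] := step_majorant us cs.
exists p; split=> // [x|].
  apply: le_trans (p1 x); rewrite ler_nat.
  by case: (leP r x) => // rx; rewrite (le_trans (ltW cr) rx).
have e1 : \sum_(z <- s) (z == c)%:R = 1 :> R.
  rewrite -natr_sum -big_mkcond sum1_count (@eq_count _ _ (pred1 c)) //.
  by rewrite count_uniq_mem // cs.
rewrite -[X in X + _]e1 -big_split [leLHS]big_seq [leRHS]big_seq ler_sum // => z zs /=.
rewrite ps // -natrD ler_nat; case: (leP c z) => //.
rewrite le_eqVlt => /predU1P[<-|cz]; first by rewrite eqxx.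
have -> : r <= z; last by rewrite leq_addl.
rewrite leNgt; apply/negP => zr.
have := cm z; rewrite mem_filter zr zs => /(_ isT).
by rewrite leNgt cz.
Qed.

(** The reflection x -> - x exchanges majorants and minorants. *)
Lemma step_minorant_sum s r : uniq s -> (0 < size s)%N -> exists q,
  [/\ (size q <= 2 * size s)%N, forall x, q.[x] <= (r < x)%R%:R &
      \sum_(z <- s) (r < z)%R%:R - 1 <= \sum_(z <- s) q.[z]].
Proof.
move=> us s0; have [||p [sp p1 ps]] := @step_majorant_sum [seq - z | z <- s] (- r).
- by rewrite map_inj_uniq //; exact: oppr_inj.
- by rewrite size_map.
have q1 x : (1 - (p \Po (- 'X))).[x] = 1 - p.[- x].
  by rewrite hornerD hornerN horner_comp !hornerE.
have lt1 x : (r < x)%R%:R = 1 - (- r <= - x)%R%:R :> R.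
  by rewrite lerN2 leNgt; case: (r < x); rewrite ?subrr ?subr0.
exists (1 - (p \Po (- 'X))); split.
- rewrite (leq_trans (size_polyD _ _)) // geq_max size_polyN size_poly1.
  rewrite size_comp_poly2 ?size_polyN ?size_polyX // -(size_map -%R s) sp andbT.
  by rewrite size_map muln_gt0 s0.
- by move=> x; rewrite q1 lt1 lerB.
- under eq_bigr do rewrite lt1; under [leRHS]eq_bigr do rewrite q1.
  move: ps; rewrite !big_map !sumrB; lra.
Qed.

End onesided_step.

Section sandwiched.
Context {R : realType}.
Implicit Types (f g F : R -> R) (n M : nat) (G V r : R) (p q P Q : {poly R}).
Local Notation mu := (@lebesgue_measure R).

(** The quadrature at M nodes integrates p - q exactly.  The majorant, the
    minorant and a node equal to r contribute one weight pi / M each. *)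
Lemma step_sandwich M r : (0 < M)%N -> exists q p : {poly R},
  [/\ (size q <= 2 * M)%N, (size p <= 2 * M)%N,
      forall x, q.[x] <= (r < x)%R%:R /\ (r <= x)%R%:R <= p.[x] &
      cint (p - q) <= 3 * pi / M%:R].
Proof.
move=> M0; pose s := [seq cnode M j : R | j <- iota 0 M].
have ss : size s = M by rewrite size_map size_iota.
have us : uniq s.
  rewrite map_inj_in_uniq ?iota_uniq // => i j; rewrite !mem_iota !add0n /=.
  exact: cnode_inj.
have [|p [sp p1 ps]] := @step_majorant_sum _ s r us; first by rewrite ss.
have [|q [sq q1 qs]] := @step_minorant_sum _ s r us; first by rewrite ss.
exists q, p; rewrite -{1}ss -{1}ss; split=> //.
rewrite (@cint_cnode _ M); last first.
  by rewrite (leq_trans (size_polyD _ _)) // size_polyN geq_max -ss sp.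
have -> : \sum_(j < M) (p - q).[cnode M j] = \sum_(z <- s) (p.[z] - q.[z]).
  rewrite big_map.
  transitivity (\sum_(0 <= j < M) (p.[cnode M j] - q.[cnode M j])).
    by rewrite big_mkord; apply: eq_bigr => j _; rewrite hornerD hornerN.
  by rewrite /index_iota subn0.
rewrite sumrB mulrAC ler_pM2r ?invr_gt0 ?ltr0n // mulrC ler_pM2r ?pi_gt0 //.
have : \sum_(z <- s) (r <= z)%R%:R <= 1 + \sum_(z <- s) (r < z)%R%:R :> R.
  have e1 : \sum_(z <- s) (z == r)%:R <= 1 :> R.
    rewrite -natr_sum lern1 -big_mkcond sum1_count.
    by rewrite (@eq_count _ _ (pred1 r)) // count_uniq_mem // leq_b1.
  apply: le_trans (lerD e1 (lexx _)); rewrite -big_split ler_sum // => z _ /=.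
  by rewrite -natrD ler_nat; case: ltgtP.
move: ps qs; lra.
Qed.

(** One-sided approximation with respect to the Chebyshev weight; G is the size
    of the gap between the two polynomials. *)
Definition sandwiched n G f := exists p q : {poly R},
  [/\ (size p <= n)%N, (size q <= n)%N,
      {in `]-1, 1[, forall x : R, p.[x] <= f x <= q.[x]} & cint (q - p) <= G].

Lemma cintN p : cint (- p) = - cint p.
Proof. by rewrite -scaleN1r cintZ mulN1r. Qed.

Lemma cintC r : cint r%:P = r * pi.
Proof. by rewrite -[r%:P]mulr1 mul_polyC cintZ -/(Tpoly 0) (cint_Tpoly 0). Qed.

Lemma sandwichedW n n' G G' f : (n <= n')%N -> G <= G' ->
  sandwiched n G f -> sandwiched n' G' f.
Proof.
move=> nn GG [p [q [sp sq pq c]]]; exists p, q; split=> //.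
- exact: leq_trans sp nn.
- exact: leq_trans sq nn.
- exact: le_trans c GG.
Qed.

Lemma eq_sandwiched n G f g : {in `]-1, 1[, f =1 g} ->
  sandwiched n G f -> sandwiched n G g.
Proof.
move=> fg [p [q [sp sq pq c]]]; exists p, q; split=> // x xI.
by rewrite -fg // pq.
Qed.

Lemma sandwiched_poly n p : (size p <= n)%N -> sandwiched n 0 (horner p).
Proof.
move=> sp; exists p, p; split=> //; first by move=> x _; rewrite lexx.
by rewrite subrr -(scale0r 1) cintZ mul0r.
Qed.

Lemma sandwichedD n G G' f g : sandwiched n G f -> sandwiched n G' g ->
  sandwiched n (G + G') (fun x => f x + g x).
Proof.
move=> [p [q [sp sq pq c]]] [p' [q' [sp' sq' pq' c']]].
exists (p + p'), (q + q'); split.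
- by rewrite (leq_trans (size_polyD _ _)) // geq_max sp.
- by rewrite (leq_trans (size_polyD _ _)) // geq_max sq.
- move=> x xI; have /andP[h1 h2] := pq x xI; have /andP[h3 h4] := pq' x xI.
  by rewrite !hornerD !lerD.
- have -> : q + q' - (p + p') = (q - p) + (q' - p') by ring.
  by rewrite cintD lerD.
Qed.

Lemma sandwichedN n G f : sandwiched n G f -> sandwiched n G (fun x => - f x).
Proof.
move=> [p [q [sp sq pq c]]]; exists (- q), (- p); rewrite !size_polyN; split=> //.
  by move=> x xI; have /andP[h1 h2] := pq x xI; rewrite !hornerN !lerN2 h1 h2.
by have -> : - p - - q = q - p by ring.
Qed.

Lemma sandwichedZ n G f r : 0 <= r -> sandwiched n G f ->
  sandwiched n (r * G) (fun x => r * f x).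
Proof.
move=> r0 [p [q [sp sq pq c]]]; exists (r *: p), (r *: q); split.
- exact: leq_trans (size_scale_leq _ _) sp.
- exact: leq_trans (size_scale_leq _ _) sq.
- by move=> x xI; have /andP[h1 h2] := pq x xI; rewrite !hornerZ !ler_wpM2l.
- by rewrite -scalerBr cintZ ler_wpM2l.
Qed.

Lemma sandwiched_sum n (I : Type) (s : seq I) (G : I -> R) (f : I -> R -> R) :
  (forall i, sandwiched n (G i) (f i)) ->
  sandwiched n (\sum_(i <- s) G i) (fun x => \sum_(i <- s) f i x).
Proof.
move=> H; elim: s => [|i s IH].
  rewrite big_nil; apply: (@eq_sandwiched _ _ (horner 0)) => [x _|].
    by rewrite big_nil horner0.
  by apply: sandwiched_poly; rewrite size_poly0.
rewrite big_cons.
apply: (@eq_sandwiched _ _ (fun x => f i x + \sum_(i <- s) f i x)) => [x _|].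
  by rewrite big_cons.
exact: sandwichedD.
Qed.

Lemma sandwiched_close n G f g (e1 e2 : R) : (0 < n)%N ->
  {in `]-1, 1[, forall x, - e1 <= g x - f x <= e2} ->
  sandwiched n G f -> sandwiched n (G + pi * (e1 + e2)) g.
Proof.
move=> n0 fg [p [q [sp sq pq c]]].
exists (p - e1%:P), (q + e2%:P); split.
- rewrite (leq_trans (size_polyD _ _)) // geq_max sp size_polyN.
  exact: leq_trans (size_polyC_leq1 _) n0.
- rewrite (leq_trans (size_polyD _ _)) // geq_max sq.
  exact: leq_trans (size_polyC_leq1 _) n0.
- move=> x xI; have /andP[h1 h2] := pq x xI; have /andP[h3 h4] := fg x xI.
  by rewrite !hornerE; apply/andP; split; lra.
- have -> : q + e2%:P - (p - e1%:P) = (q - p) + (e1 + e2)%:P by rewrite polyCD; ring.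
  by rewrite cintD cintC mulrC lerD2r.
Qed.

Lemma half_ge_third n : (1 < n)%N -> (n <= 3 * n./2)%N.
Proof. lia. Qed.

(** An up-set is a half-line, open or closed at its infimum r, and the two steps
    at r have a common approximation.  The constant 9 absorbs the rounding of n / 2. *)
Lemma upset_sandwiched n (U : set R) : (1 < n)%N ->
  (forall x y, x <= y -> U x -> U y) ->
  sandwiched n (9 * pi / n%:R) (fun x => `[< U x >]%:R).
Proof.
move=> n1 Uup; have n0 : (0 < n)%N := ltnW n1.
pose E := [set x | (x \in `](-1 : R), 1[) /\ U x].
have G0 : 0 <= 9 * pi / n%:R :> R by rewrite divr_ge0 // mulr_ge0 // pi_ge0.
have [E0|/set0P E0] := eqVneq E set0.
  apply: (sandwichedW (leqnn _) G0).
  apply: (@eq_sandwiched _ _ (horner 0)); last first.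
    by apply: sandwiched_poly; rewrite size_poly0.
  move=> x xI; rewrite horner0; case: asboolP => // Ux.
  by have : E x by []; rewrite E0.
have lE : has_lbound E.
  by exists (-1) => x [+ _]; rewrite in_itv /= => /andP[/ltW].
pose r := inf E.
have M0 : (0 < n./2)%N by lia.
have [q [p [sq sp pq c]]] := step_sandwich r M0.
have s2 : (2 * n./2 <= n)%N by lia.
exists q, p; split.
- exact: leq_trans sq s2.
- exact: leq_trans sp s2.
- move=> x xI; have [h1 h2] := pq x; apply/andP; split.
    apply: le_trans h1 _; rewrite ler_nat; case: (ltP r x) => // rx.
    have [y [_ Uy] yx] := inf_lt E0 rx.
    by have -> : `[< U x >] by apply/asboolP; exact: Uup (ltW yx) Uy.
  apply: le_trans _ h2; rewrite ler_nat; case: asboolP => // Ux.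
  by have -> : r <= x by apply: ge_inf.
- apply: le_trans c _.
  rewrite ler_pdivrMr ?ltr0n // mulrAC ler_pdivlMr ?ltr0n //.
  have : n%:R <= 3 * n./2%:R :> R by rewrite -natrM ler_nat half_ge_third.
  have := @pi_gt0 R; nra.
Qed.

(** Up to the cut-off at n, the sum is the integer part of y. *)
Lemma count_levels (y : R) n : 0 <= y ->
  \sum_(k < n) (k.+1%:R <= y)%R%:R <= y /\
  (y <= n%:R -> y - 1 <= \sum_(k < n) (k.+1%:R <= y)%R%:R).
Proof.
move=> y0; elim: n => [|n [IH1 IH2]]; first by rewrite big_ord0; split=> //; lra.
rewrite big_ord_recr /=; split.
  case: (leP n.+1%:R y) => h; last by rewrite addr0.
  apply: le_trans h; rewrite -natr1 lerD2r.
  rewrite -[leRHS](_ : \sum_(k < n) 1 = _); last by rewrite sumr_const card_ord.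
  by apply: ler_sum => k _; rewrite lern1 leq_b1.
move=> yn; have [/IH2 h|ny] := leP y n%:R.
  by rewrite (le_trans h) // lerDl.
apply: (@le_trans _ _ n%:R); first by rewrite lerBlDr natr1.
rewrite -[leLHS]addr0 lerD //.
rewrite -[leLHS](_ : \sum_(k < n) 1 = _); last by rewrite sumr_const card_ord.
apply: ler_sum => k _; rewrite (_ : (_ <= y) = true) //.
by apply/ltW/(le_lt_trans _ ny); rewrite ler_nat.
Qed.

(** A function with values in [0, V] is, up to V / K, the average of the
    indicators of its level sets, which are half-lines when the function is monotone.
    The factor [0 < V] gives the empty sum when V = 0, where all levels coincide. *)
Lemma monotone_levels (f : R -> R) V K x : (0 < K)%N -> 0 <= f x <= V ->
  0 <= f x - V / K%:R * \sum_(k < K) (V * k.+1%:R / K%:R <= f x)%R%:R * (0 < V)%R%:R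
    <= V / K%:R.
Proof.
move=> K0 /andP[f0 fV]; have K0' : 0 < K%:R :> R by rewrite ltr0n.
have [V0|V0] := ltP 0 V; last first.
  have -> : V = 0 by lra.
  by rewrite !mul0r subr0 f0 /=; lra.
under eq_bigr do rewrite mulr1.
have [|h1 h2] := @count_levels (f x * K%:R / V) K.
  by rewrite divr_ge0 ?mulr_ge0 // ltW.
set S := \sum_(k < K) _ in h1 h2.
rewrite (_ : \sum_(k < K) _ = S); last first.
  apply: eq_bigr => k _; congr (nat_of_bool _)%:R.
  by rewrite ler_pdivrMr // ler_pdivlMr // [V * _]mulrC.
have e : f x = V / K%:R * (f x * K%:R / V) by field; rewrite !gt_eqF.
rewrite [X in X - _]e -mulrBr.
have VK : 0 < V / K%:R by rewrite divr_gt0.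
apply/andP; split; first by rewrite mulr_ge0 ?(ltW VK) // subr_ge0.
rewrite ler_piMr ?(ltW VK) // lerBlDr -lerBlDl h2 //.
by rewrite ler_pdivrMr // [leRHS]mulrC ler_pM2r.
Qed.

(** Averaging the one-sided approximations of n level sets. *)
Lemma monotone_sandwiched n f A V : (1 < n)%N ->
  {in `]-1, 1[ &, {homo f : x y / x <= y}} ->
  {in `]-1, 1[, forall x, A <= f x <= A + V} ->
  sandwiched n (10 * pi * V / n%:R) f.
Proof.
move=> n1 fnd fAV; have n0 : (0 < n)%N := ltnW n1.
have V0 : 0 <= V.
  have : (0 : R) \in `](-1 : R), 1[ by rewrite in_itv /= ltrN10 ltr01.
  by move=> /fAV; lra.
(* The level sets in ]-1, 1[, made closed upwards in the whole line. *)
pose U k := [set x | exists y, [/\ y \in `](-1 : R), 1[, y <= x &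
    (V * k.+1%:R / n%:R <= f y - A)%R && (0 < V)%R]].
have Uup k x y : x <= y -> U k x -> U k y.
  by move=> xy [z [zI zx h]]; exists z; split=> //; exact: le_trans zx xy.
have H := sandwichedD (sandwiched_poly (p := A%:P) (leq_trans (size_polyC_leq1 _) n0))
  (sandwichedZ (divr_ge0 V0 (ler0n _ n))
   (sandwiched_sum (index_enum 'I_n) (fun k : 'I_n => upset_sandwiched n1 (Uup k)))).
have {}H := @sandwiched_close _ _ _ f 0 (V / n%:R) n0 _ H.
apply: (sandwichedW (leqnn _) _ (H _)).
  rewrite sumr_const card_ord !add0r -[X in V / _ * X]mulr_natr.
  have -> : V / n%:R * (9 * pi / n%:R * n%:R) + pi * (V / n%:R) = 10 * pi * V / n%:R.
    by field; rewrite pnatr_eq0 -lt0n.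
  exact: lexx.
move=> x xI; rewrite hornerC oppr0 opprD addrA.
have /andP[h1 h2] := fAV x xI.
have := @monotone_levels (fun x => f x - A) V n x n0.
rewrite subr_ge0 h1 lerBlDl h2 => /(_ isT).
rewrite (_ : \sum_(k < n) _ = \sum_(k < n) `[< U k x >]%:R) //.
apply: eq_bigr => k _; rewrite -natrM mulnb; congr (nat_of_bool _)%:R.
apply/idP/asboolP => [h|[y [yI yx /andP[h V0']]]]; first by exists x; split.
rewrite V0' andbT (le_trans h) // lerD2r fnd //.
Qed.

End sandwiched.

(** * One-sided approximation of primitives *)

Section primitives.
Context {R : realType}.
Implicit Types (f g F : R -> R) (n M : nat) (G V r : R) (p q P Q : {poly R}).
Local Notation mu := (@lebesgue_measure R).

Lemma poly_primitive p : exists2 P, P^`() = p & (size P <= (size p).+1)%N.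
Proof.
exists (\poly_(i < (size p).+1) (p`_i.-1 / i%:R)); last exact: size_poly.
apply/polyP => i; rewrite coef_deriv coef_poly ltnS /=.
case: ltnP => [ip|pi]; last by rewrite mul0rn nth_default.
by rewrite -[_ *+ i.+1]mulr_natr divfK // pnatr_eq0.
Qed.

Lemma horner_nondecreasing P : {in `]-1, 1[, forall x : R, 0 <= P^`().[x]} ->
  {in `[-1, 1] &, {homo horner P : x y / x <= y}}.
Proof.
move=> P0; apply: (@ger0_derive1_le_cc _ (horner P)).
- by move=> x _; exact: derivable_horner.
- by move=> x xI; rewrite -derivE P0.
- by apply: continuous_subspaceT => x; exact: continuous_horner.
Qed.

(** The Chebyshev weight is at least 1. *)
Lemma primitive_le_cint P : {in `]-1, 1[, forall x : R, 0 <= P^`().[x]} ->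
  P.[1] - P.[-1] <= cint P^`().
Proof.
move=> P0; have N11 : -1 < 1 :> R by rewrite (lt_trans (ltrN10 _)) ?ltr01.
have e : (\int[mu]_(x in `](-1)%R, 1%R[) (P^`().[x])%:E = (P.[1] - P.[-1])%:E)%E.
  apply: (@ge0_continuous_FTC_oo R _ (horner P)) => //.
  - by move=> x _; exact: continuous_horner.
  - by apply: continuous_subspaceT => x; exact: continuous_horner.
  - by move=> x _; exact: is_derive_poly.
rewrite -lee_fin -e /cint /Rintegral fineK; last first.
  by apply: integrable_fin_num => //; exact: integrable_cint.
apply: ge0_le_integral => //.
- by apply/measurable_EFinP; exact: horner_measurable.
- by have /integrableP[] := integrable_cint P^`().
- by move=> x xI; rewrite lee_fin ler_peMr ?P0 // chebyshev_weight_ge1.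
Qed.

(** The difference H = F - P increases, and by at most D = Q - P does; it is thus
    a bounded monotone function, of range at most the integral of D'. *)
Lemma sandwiched_primitive n F P Q : (0 < n)%N ->
  (size P <= n.+1)%N -> (size Q <= n.+1)%N ->
  {in `]-1, 1[ &, {homo (fun x => F x - P.[x]) : x y / x <= y}} ->
  {in `]-1, 1[ &, {homo (fun x => Q.[x] - F x) : x y / x <= y}} ->
  {in `]-1, 1[, forall x : R, 0 <= (Q - P)^`().[x]} ->
  sandwiched n.+1 (10 * pi * cint (Q - P)^`() / n.+1%:R) F.
Proof.
move=> n0 sP sQ FP QF QP0.
pose H x := F x - P.[x]; pose D := Q - P.
have Dnd := horner_nondecreasing QP0.
have sub (x : R) : x \in `]-1, 1[ -> x \in `[-1, 1].
  by rewrite !in_itv /= => /andP[/ltW -> /ltW ->].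
have I1 : (1 : R) \in `[-1, 1] by rewrite in_itv /= lexx andbT; lra.
have IN1 : (-1 : R) \in `[-1, 1] by rewrite in_itv /= lexx /=; lra.
have D1 (x : R) : x \in `]-1, 1[ -> D.[-1] <= D.[x] <= D.[1].
  move=> xI; have := sub _ xI; rewrite in_itv /= => /andP[h1 h2].
  by rewrite !Dnd // sub.
set V := cint D^`().
have VD : D.[1] - D.[-1] <= V by exact: primitive_le_cint.
have Hinc (x y : R) : x \in `]-1, 1[ -> y \in `]-1, 1[ -> H x - V <= H y.
  move=> xI yI; have V0 : 0 <= V.
    by apply: le_trans VD; rewrite subr_ge0 Dnd //; lra.
  have [xy|/ltW yx] := leP x y.
    by rewrite (le_trans _ (FP x y xI yI xy)) // lerBlDr lerDl.
  have := QF y x yI xI yx.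
  have /andP[d1 d2] := D1 _ xI; have /andP[d3 d4] := D1 _ yI.
  move: d1 d2 d3 d4 VD; rewrite /D /H !hornerE; lra.
have I0 : (0 : R) \in `](-1), 1[ by rewrite in_itv /= ltrN10 ltr01.
pose E := [set H x | x in [set` `](-1 : R), 1[]].
have E0 : E !=set0 by exists (H 0), 0.
have lE : has_lbound E by exists (H 0 - V) => _ [y yI <-]; exact: Hinc.
have SH : sandwiched n.+1 (10 * pi * V / n.+1%:R) H.
  apply: (@monotone_sandwiched _ n.+1 H (inf E)) => // x xI.
  apply/andP; split; first by apply: ge_inf => //; exists x.
  rewrite -lerBlDr; apply: lb_le_inf => // _ [y yI <-]; exact: Hinc.
apply: (@eq_sandwiched _ _ _ (fun x => H x + P.[x])).
  by move=> x _; rewrite /H subrK.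
by rewrite -[X in sandwiched _ X _]addr0; apply: sandwichedD SH (sandwiched_poly sP).
Qed.

(** A quadratic defect disappears under subdivision. *)
Lemma le_incr_nondecreasing (H : R -> R) (a b L : R) :
  (forall x y : R, a < x -> x <= y -> y < b -> - (L * (y - x) ^+ 2) <= H y - H x) ->
  {in `]a, b[ &, {homo H : x y / x <= y}}.
Proof.
move=> HL x y; rewrite !in_itv /= => /andP[ax xb] /andP[ay yb] xy.
have L0 : 0 <= `|L| by [].
pose l := `|L| * (y - x) ^+ 2.
have l0 : 0 <= l by rewrite mulr_ge0 // sqr_ge0.
(* Over k equal pieces the defects add up to l / k only. *)
suff key k : (0 < k)%N -> - (l / k%:R) <= H y - H x.
  rewrite -subr_ge0 leNgt; apply/negP => lt0.
  pose k := (Num.bound (l / - (H y - H x))).+1.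
  have := key k isT; rewrite leNgt => /negP; apply.
  rewrite ltrNr ltr_pdivrMr ?ltr0n // -ltr_pdivrMl ?oppr_gt0 // mulrC.
  apply: lt_trans (archi_boundP _) _; last by rewrite ltr_nat.
  by rewrite divr_ge0 // oppr_ge0 ltW.
move=> k0; have k0' : 0 < k%:R :> R by rewrite ltr0n.
pose t i : R := x + (y - x) * (i%:R / k%:R).
have yx0 : 0 <= y - x by rewrite subr_ge0.
have tm i : t i <= t i.+1.
  by rewrite lerD2l ler_wpM2l // ler_pM2r ?invr_gt0 // ler_nat.
have ta i : a < t i.
  by rewrite (lt_le_trans ax) // lerDl mulr_ge0 // divr_ge0 ?ler0n.
have tb i : (i <= k)%N -> t i < b.
  move=> ik; apply: le_lt_trans yb; rewrite -lerBrDl ler_piMr //.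
  by rewrite ler_pdivrMr // mul1r ler_nat.
have tS i : t i.+1 - t i = (y - x) / k%:R.
  by rewrite /t -natr1; field; rewrite gt_eqF.
have step (j : nat) : (j <= k)%N -> - (j%:R * (l / k%:R ^+ 2)) <= H (t j) - H x.
  elim: j => [|j IH] jk.
    by rewrite mul0r oppr0 /t mul0r mulr0 addr0 subrr.
  have h1 := IH (ltnW jk).
  have h2 := HL (t j) (t j.+1) (ta _) (tm _) (tb _ jk).
  have h3 : L * (t j.+1 - t j) ^+ 2 <= l / k%:R ^+ 2.
    by rewrite tS expr_div_n mulrA ler_pM2r ?invr_gt0 ?exprn_gt0 // ler_wpM2r ?sqr_ge0 // ler_norm.
  rewrite -natr1 mulrDl mul1r; lra.
have := step k (leqnn _).
have -> : t k = y by rewrite /t divff ?gt_eqF // mulr1 addrC subrK.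
by have -> : k%:R * (l / k%:R ^+ 2) = l / k%:R :> R by field; rewrite gt_eqF.
Qed.

(** The primitives of the polynomials around f enclose the increments of F, and
    one power of n is gained. *)
Lemma sandwiched_derive n G F f : (0 < n)%N ->
  {in `]-1, 1[, forall x : R, is_derive x (1 : R) F (f x)} ->
  sandwiched n G f -> sandwiched n.+1 (10 * pi * G / n.+1%:R) F.
Proof.
move=> n0 dF [p [q [sp sq pq c]]].
have [P dP sP] := poly_primitive p; have [Q dQ sQ] := poly_primitive q.
have {}sP : (size P <= n.+1)%N by exact: leq_trans sP _.
have {}sQ : (size Q <= n.+1)%N by exact: leq_trans sQ _.
have dD : (Q - P)^`() = q - p by rewrite derivB dP dQ.
have mono (K : R -> R) (k : R -> R) : {in `]-1, 1[, forall x : R, is_derive x (1 : R) K (k x)} ->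
    {in `]-1, 1[, forall x, 0 <= k x} -> {in `]-1, 1[ &, {homo K : x y / x <= y}}.
  move=> dK k0; apply: (@ger0_derive1_le_oo _ K).
  - by move=> x /dK ?.
  - by move=> x xI; have ? := dK _ xI; rewrite derive1E derive_val k0.
  - move=> x; rewrite inE => xI; have ? := dK _ xI.
    by apply: differentiable_continuous; apply/derivable1_diffP.
apply: sandwichedW (leqnn _) _ (@sandwiched_primitive n F P Q n0 sP sQ _ _ _).
- by rewrite ler_pM2r ?invr_gt0 // ler_wpM2l ?mulr_ge0 ?pi_ge0 // dD.
- apply: (mono _ (fun x => f x - p.[x])) => x xI.
    have ? := dF _ xI; apply: is_derive_eq; first by rewrite dP.
  by have /andP[h _] := pq _ xI; rewrite subr_ge0.
- apply: (mono _ (fun x => q.[x] - f x)) => x xI.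
    have ? := dF _ xI; apply: is_derive_eq; first by rewrite dQ.
  by have /andP[_ h] := pq _ xI; rewrite subr_ge0.
- move=> x xI; rewrite dD !hornerE subr_ge0.
  by have /andP[h1 h2] := pq _ xI; exact: le_trans h1 h2.
Qed.

Lemma horner_lipschitz p : exists2 L : R, 0 <= L & forall x y : R, -1 < x -> x <= y -> y < 1 ->
  `|p.[y] - p.[x]| <= L * (y - x).
Proof.
have [L pL] := horner_bounded p^`(); exists L => [|x y x1 xy y1].
  by rewrite (le_trans _ (pL 0 _)) // ?normr_ge0 // lerN10 ler01.
have cp : {within `[x, y], continuous (horner p)}.
  by apply: continuous_subspaceT => z; exact: continuous_horner.
have [c cI ->] := @MVT_segment R (horner p) (horner p^`()) x y xy _ cp.
rewrite normrM [X in _ * X]ger0_norm ?subr_ge0 // ler_wpM2r ?subr_ge0 // pL //.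
by move: cI; rewrite in_itv /= => /andP[h1 h2]; apply/andP; split; lra.
Qed.

(** Here F is convex and f selects subgradients.  The increments of F are compared
    with those of the primitives up to the oscillation of p and q on [x, y], a quadratic
    defect since polynomials are Lipschitz. *)
Lemma sandwiched_convex n G F f : (0 < n)%N ->
  (forall x y : R, -1 < x -> x <= y -> y < 1 ->
     f x * (y - x) <= F y - F x <= f y * (y - x)) ->
  sandwiched n G f -> sandwiched n.+1 (10 * pi * G / n.+1%:R) F.
Proof.
move=> n0 Ff [p [q [sp sq pq c]]].
have [P dP sP] := poly_primitive p; have [Q dQ sQ] := poly_primitive q.
have {}sP : (size P <= n.+1)%N by exact: leq_trans sP _.
have {}sQ : (size Q <= n.+1)%N by exact: leq_trans sQ _.
have dD : (Q - P)^`() = q - p by rewrite derivB dP dQ.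
have prim (U : {poly R}) (x y : R) : -1 < x -> x <= y -> y < 1 ->
    exists2 z, x <= z <= y & U.[y] - U.[x] = U^`().[z] * (y - x).
  move=> x1 xy y1.
  have cU : {within `[x, y], continuous (horner U)}.
    by apply: continuous_subspaceT => z; exact: continuous_horner.
  have [z zI e] := @MVT_segment R (horner U) (horner U^`()) x y xy _ cU.
  by exists z => //; move: zI; rewrite in_itv.
have itv (x y : R) : -1 < x -> x <= y -> y < 1 ->
    (x \in `]-1, 1[) /\ (y \in `]-1, 1[).
  by move=> h1 h2 h3; rewrite !in_itv /= h1 h3 (le_lt_trans h2 h3) (lt_le_trans h1 h2).
apply: sandwichedW (leqnn _) _ (@sandwiched_primitive n F P Q n0 sP sQ _ _ _).
- by rewrite ler_pM2r ?invr_gt0 // ler_wpM2l ?mulr_ge0 ?pi_ge0 // dD.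
- have [L L0 pL] := horner_lipschitz p.
  apply: (@le_incr_nondecreasing _ _ _ L) => x y x1 xy y1.
  have [z /andP[xz zy] e] := prim P x y x1 xy y1.
  have /andP[h1 _] := Ff x y x1 xy y1.
  have [xI yI] := itv x y x1 xy y1.
  have /andP[h2 _] := pq _ xI.
  have := pL x z x1 xz (le_lt_trans zy y1); rewrite ler_norml => /andP[_ h3].
  rewrite dP in e; have yx : 0 <= y - x by rewrite subr_ge0.
  have h4 : p.[z] <= p.[x] + L * (y - x).
    have : L * (z - x) <= L * (y - x) by rewrite ler_wpM2l // lerD2r.
    lra.
  have h5 := ler_wpM2r yx h2; have h6 := ler_wpM2r yx h4.
  rewrite expr2; lra.
- have [L L0 qL] := horner_lipschitz q.
  apply: (@le_incr_nondecreasing _ _ _ L) => x y x1 xy y1.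
  have [z /andP[xz zy] e] := prim Q x y x1 xy y1.
  have /andP[_ h1] := Ff x y x1 xy y1.
  have [xI yI] := itv x y x1 xy y1.
  have /andP[_ h2] := pq _ yI.
  have := qL z y (lt_le_trans x1 xz) zy y1; rewrite ler_norml => /andP[_ h3].
  rewrite dQ in e; have yx : 0 <= y - x by rewrite subr_ge0.
  have h4 : q.[y] - L * (y - x) <= q.[z].
    have : L * (y - z) <= L * (y - x) by rewrite ler_wpM2l // lerB.
    lra.
  have h5 := ler_wpM2r yx h2; have h6 := ler_wpM2r yx h4.
  rewrite expr2; lra.
- move=> x xI; rewrite dD !hornerE subr_ge0.
  by have /andP[h1 h2] := pq _ xI; exact: le_trans h1 h2.
Qed.

End primitives.

(** * The Gauss-Legendre rule *)

Section lebesgue_poly.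
Context {R : realType}.
Implicit Types (p q P Q W : {poly R}) (n k N : nat).
Local Notation mu := (@lebesgue_measure R).

Definition lint p : R := \int[mu]_(t in `]-1, 1[) p.[t].

Lemma bounded_integrable (f : R -> R) (M : R) :
  measurable_fun `](-1 : R), 1[ f -> {in `]-1, 1[, forall t, `|f t| <= M} ->
  mu.-integrable `]-1, 1[ (EFin \o f).
Proof.
move=> mf fM; apply: measurable_bounded_integrable => //.
  by rewrite /= lebesgue_measure_itv /= lte_fin; case: ifP => // _; rewrite -EFinD ltry.
exists M; split; first exact: num_real.
by move=> A MA x xI; apply: le_trans (ltW MA); apply: fM.
Qed.

Lemma integrable_lint p : mu.-integrable `]-1, 1[ (fun t => p.[t]%:E).
Proof.
have [M pM] := horner_bounded p.
apply: (@bounded_integrable (horner p) M); first exact: horner_measurable.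
by move=> t; rewrite in_itv /= => /andP[/ltW h1 /ltW h2]; rewrite pM ?h1.
Qed.

Lemma lintD p q : lint (p + q) = lint p + lint q.
Proof.
rewrite /lint -RintegralD //; try exact: integrable_lint.
by apply: eq_Rintegral => t _; rewrite hornerD.
Qed.

Lemma lintZ c p : lint (c *: p) = c * lint p.
Proof.
rewrite /lint -RintegralZl //; last exact: integrable_lint.
by apply: eq_Rintegral => t _; rewrite hornerZ.
Qed.

Lemma lint_sum I (r : seq I) (F : I -> {poly R}) :
  lint (\sum_(i <- r) F i) = \sum_(i <- r) lint (F i).
Proof.
elim: r => [|i r IH]; last by rewrite !big_cons lintD IH.
by rewrite !big_nil -(scale0r 1) lintZ mul0r.
Qed.

Lemma lint_ge0 p : {in `]-1, 1[, forall x : R, 0 <= p.[x]} -> 0 <= lint p.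
Proof. by move=> p0; apply: Rintegral_ge0 => x xI; exact: p0. Qed.

Lemma lint_deriv P : lint P^`() = P.[1] - P.[-1].
Proof.
have N11 : -1 < 1 :> R by rewrite (lt_trans (ltrN10 _)) ?ltr01.
suff : (\int[mu]_(x in `[(-1)%R, 1%R]) (P^`().[x])%:E = (P.[1] - P.[-1])%:E)%E.
  rewrite /lint /Rintegral -(@integral_itv_bndoo _ _ _ _ true false) => [->//|].
  by apply/measurable_EFinP; exact: horner_measurable.
rewrite (@continuous_FTC2 R (horner P^`()) (horner P)) //.
- by apply: continuous_subspaceT => x; exact: continuous_horner.
- split; first by move=> x _; exact: derivable_horner.
  + by apply: cvg_at_right_filter; exact: continuous_horner.
  + by apply: cvg_at_left_filter; exact: continuous_horner.
- by move=> x _; rewrite derivE.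
Qed.

Lemma lint_by_parts p q : (p * q).[1] = 0 -> (p * q).[-1] = 0 ->
  lint (p^`() * q) = - lint (p * q^`()).
Proof.
move=> e1 e2; apply/eqP; rewrite -subr_eq0 opprK -lintD -derivM lint_deriv.
by rewrite e1 e2 subrr.
Qed.

(** A primitive of p is nondecreasing with equal values at the ends. *)
Lemma lint_eq0 p : {in `]-1, 1[, forall x : R, 0 <= p.[x]} -> lint p = 0 -> p = 0.
Proof.
move=> p0; have [P dP _] := poly_primitive p.
rewrite -dP lint_deriv => /eqP; rewrite subr_eq0 => /eqP e.
have Pnd : {in `[-1, 1] &, {homo horner P : x y / x <= y}}.
  by apply: horner_nondecreasing; rewrite dP.
suff -> : P = P.[1]%:P by rewrite derivC.
apply: poly_eq_cos => a; rewrite hornerC; apply/eqP; rewrite eq_le.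
have aI : cos a \in `[-1, 1] by rewrite in_itv /= cos_geN1 cos_le1.
have I1 : (1 : R) \in `[-1, 1] by rewrite in_itv /= lexx andbT; lra.
have IN1 : (-1 : R) \in `[-1, 1] by rewrite in_itv /= lexx /=; lra.
rewrite Pnd ?cos_le1 //= e Pnd ?cos_geN1 //.
Qed.

Let W n : {poly R} := ('X ^+ 2 - 1) ^+ n.

Lemma derivn_rodrigues n k : (k <= n)%N ->
  exists q, (W n)^`(k) = ('X ^+ 2 - 1) ^+ (n - k) * q.
Proof.
elim: k => [|k IH] kn; first by exists 1; rewrite subn0 mulr1 derivn0.
have [q e] := IH (ltnW kn).
have nk : (n - k = (n - k.+1).+1)%N by lia.
exists (('X ^+ 2 - 1)^`() *+ (n - k) * q + ('X ^+ 2 - 1) * q^`()).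
rewrite derivnS e derivM deriv_exp nk /= exprS.
set j := (n - k.+1)%N; set X := 'X ^+ 2 - 1.
set D := X^`(); set q' := q^`().
by rewrite !mulrnAl mulrDr mulrnAr exprS; congr (_ *+ _ + _); ring.
Qed.

Lemma derivn_rodrigues_pm1 n k (x : R) : (k < n)%N -> x ^+ 2 = 1 -> (W n)^`(k).[x] = 0.
Proof.
move=> kn x1; have [q ->] := derivn_rodrigues (ltnW kn).
by rewrite hornerM horner_exp hornerD hornerN hornerXn hornerC x1 subrr expr0n subn_eq0 leqNgt kn mul0r.
Qed.

(** Integration by parts; the derivatives of (X^2 - 1)^n of order less than n
    vanish at both ends. *)
Lemma rodrigues_orthogonal n k q : (k <= n)%N -> (size q <= k)%N ->
  lint ((W n)^`(k) * q) = 0.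
Proof.
elim: k q => [|k IH] q kn sq.
  move: sq; rewrite leqn0 size_poly_eq0 => /eqP ->.
  by rewrite mulr0 -(scale0r 1) lintZ mul0r.
rewrite derivnS lint_by_parts.
- rewrite IH ?oppr0 ?(ltnW kn) //.
  have [->|q0] := eqVneq q 0; first by rewrite deriv0 size_poly0.
  by rewrite -ltnS (leq_trans (lt_size_deriv q0)).
- by rewrite hornerM derivn_rodrigues_pm1 ?expr1n ?mul0r.
- by rewrite hornerM derivn_rodrigues_pm1 ?sqrrN ?expr1n ?mul0r.
Qed.

Let size_X21 : size ('X ^+ 2 - 1 : {poly R}) = 3%N.
Proof. by rewrite -[1]/(1%:P) size_XnsubC. Qed.

Let X21_monic : 'X ^+ 2 - 1 \is @monic R.
Proof. by rewrite -[1]/(1%:P) monicXnsubC. Qed.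

Lemma size_rodrigues n : size (W n) = (2 * n).+1.
Proof.
have W0 : W n != 0 by apply: monic_neq0; exact: monic_exp X21_monic.
have := size_exp ('X ^+ 2 - 1 : {poly R}) n; rewrite size_X21 -/(W n) /= => <-.
by rewrite prednK // lt0n size_poly_eq0.
Qed.

Lemma legendreP_neq0 n : legendreP n != 0 :> {poly R}.
Proof.
rewrite /legendreP scaler_eq0 negb_or invr_eq0 mulf_neq0 ?expf_neq0 ?pnatr_eq0 -?lt0n ?fact_gt0 //=.
rewrite -size_poly_eq0 -lt0n.
suff : ((W n)^`(n))`_n != 0.
  by apply: contraNltn; rewrite leqn0 size_poly_eq0 => /eqP ->; rewrite coef0.
rewrite coef_derivn (_ : (W n)`_(n + n) = 1); last first.
  have : lead_coef (W n) = 1 by apply/eqP; exact: monic_exp X21_monic.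
  by rewrite lead_coefE size_rodrigues /= addnn mul2n.
by rewrite pnatr_eq0 -lt0n ffact_gt0 leq_addr.
Qed.

Lemma size_legendreP n : (size (legendreP n : {poly R}) <= n.+1)%N.
Proof.
rewrite (leq_trans (size_scale_leq _ _)) // -/(W n).
apply/leq_sizeP => i ni; rewrite coef_derivn nth_default ?mul0rn //.
by rewrite size_rodrigues; lia.
Qed.

Section gauss.
Variables (N : nat) (y : 'I_N.+1 -> R).
Hypothesis yL : legendre_nodes y.

Let yI : injective y := yL.1.

Let nodal : {poly R} := \prod_(j < N.+1) ('X - (y j)%:P).

Let size_nodal : size nodal = N.+2.
Proof. by rewrite /nodal -big_enum /= size_prod_XsubC -cardE card_ord. Qed.

Lemma legendreP_nodal : exists2 c : R, c != 0 & legendreP N.+1 = c *: nodal.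
Proof.
have r : all (root (legendreP N.+1)) [seq y j | j <- enum 'I_N.+1].
  by apply/allP => _ /mapP[j _ ->]; exact: yL.2.
have u : uniq_roots [seq y j | j <- enum 'I_N.+1].
  by rewrite uniq_rootsE map_inj_uniq ?enum_uniq.
have s : size (legendreP N.+1 : {poly R}) = (size [seq y j | j <- enum 'I_N.+1]).+1.
  apply/eqP; rewrite eqn_leq; apply/andP; split.
    by rewrite size_map size_enum_ord size_legendreP.
  rewrite ltnNge; apply/negP => h; have := legendreP_neq0 N.+1; apply/negP.
  rewrite negbK; apply/eqP; apply: (roots_geq_poly_eq0 r) => //.
  by rewrite -uniq_rootsE.
exists (lead_coef (legendreP N.+1)); first by rewrite lead_coef_eq0 legendreP_neq0.
by rewrite {1}(all_roots_prod_XsubC s r u) big_map big_enum.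
Qed.

Lemma nodal_orthogonal q : (size q <= N.+1)%N -> lint (nodal * q) = 0.
Proof.
move=> sq; have [c c0 e] := legendreP_nodal.
have : lint (legendreP N.+1 * q) = 0.
  by rewrite /legendreP -scalerAl lintZ rodrigues_orthogonal ?mulr0.
by rewrite e -scalerAl lintZ => /eqP; rewrite mulf_eq0 (negbTE c0) => /eqP.
Qed.

(** Division by the nodal polynomial, which is orthogonal to the quotient. *)
Lemma gauss_exact p : (size p <= 2 * N.+1)%N ->
  lint p = \sum_(j < N.+1) p.[y j] * legendre_gauss_weight y j.
Proof.
move=> sp; pose q := p %/ nodal; pose r := p %% nodal.
have e : p = nodal * q + r by rewrite mulrC; exact: divp_eq.
have n0 : nodal != 0 by rewrite -size_poly_eq0 size_nodal.
have sr : (size r <= N.+1)%N by rewrite -ltnS -size_nodal ltn_modp.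
have sq : (size q <= N.+1)%N.
  by rewrite size_divp // size_nodal /= leq_subLR (leq_trans sp) //; lia.
have pr j : p.[y j] = r.[y j].
  rewrite e hornerD hornerM (_ : nodal.[y j] = 0) ?mul0r ?add0r //.
  by rewrite horner_prod (bigD1 j) //= !hornerE subrr mul0r.
rewrite {1}e lintD nodal_orthogonal // add0r.
rewrite (_ : r = interpolant y (horner r)); last by apply/(interpolantP _ _ yI).
by rewrite lint_sum; apply: eq_bigr => j _; rewrite lintZ pr.
Qed.

(** The rule is exact on the squares of the Lagrange polynomials. *)
Lemma gauss_weight_ge0 j : 0 <= legendre_gauss_weight y j.
Proof.
have : 0 <= lint (lagrange_basis y j ^+ 2).
  by apply: lint_ge0 => x _; rewrite horner_exp sqr_ge0.
rewrite gauss_exact.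
  rewrite (bigD1 j) //= horner_exp lagrange_basisE // eqxx expr1n mul1r.
  rewrite big1 ?addr0 // => i ij.
  by rewrite horner_exp lagrange_basisE // (negbTE ij) expr0n mul0r.
have sl := size_lagrange_basis y j.
rewrite expr2 (leq_trans (size_polyMleq _ _)) //; lia.
Qed.

(** If some node were outside ]-1, 1[, the product Q of the factors with roots
    inside would have degree at most N, and the nodal polynomial times Q would have
    constant sign while being of integral 0. *)
Lemma legendre_nodes_itv j : y j \in `]-1, 1[.
Proof.
apply/negPn/negP => yj.
pose inI i := y i \in `](-1 : R), 1[.
pose Q : {poly R} := \prod_(i | inI i) ('X - (y i)%:P).
pose E : {poly R} := \prod_(i | ~~ inI i) ('X - (y i)%:P).
have nQE : nodal = Q * E by rewrite /nodal (bigID inI).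
have [s s2 sE] : exists2 s : R, s != 0 & forall x, x \in `](-1 : R), 1[ -> 0 <= s * E.[x].
  exists (\prod_(i | ~~ inI i) (if y i <= -1 then 1 else -1)).
    by apply/prodf_neq0 => i _; case: ifP => _; rewrite ?oner_eq0 // oppr_eq0 oner_eq0.
  move=> x; rewrite in_itv /= => /andP[x1 x2].
  rewrite horner_prod -big_split prodr_ge0 // => i /=.
  rewrite /inI in_itv /= negb_and -!leNgt !hornerE => /orP[h|h].
    by rewrite h mul1r subr_ge0 (le_trans h) // ltW.
  by case: ifP => h'; rewrite ?mul1r ?mulN1r ?oppr_ge0 ?subr_ge0 ?subr_le0; lra.
have E0 : E != 0.
  by apply/prodf_neq0 => i _; rewrite polyXsubC_eq0.
have Q0 : Q != 0.
  by apply/prodf_neq0 => i _; rewrite polyXsubC_eq0.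
have rE : root E (y j) by rewrite rootE horner_prod (bigD1 j) //= !hornerE subrr mul0r.
have sQ : (size Q <= N.+1)%N.
  have := size_nodal; rewrite nQE size_mul //.
  move: (root_size_gt1 E0 rE); set a := size Q; set b := size E; lia.
have e : lint (s *: (nodal * Q)) = 0.
  by rewrite lintZ nodal_orthogonal ?mulr0.
have /lint_eq0 : {in `]-1, 1[, forall x : R, 0 <= (s *: (nodal * Q)).[x]}.
  move=> x xI; rewrite nQE hornerZ !hornerM.
  have -> : s * (Q.[x] * E.[x] * Q.[x]) = (s * E.[x]) * Q.[x] ^+ 2 by ring.
  by rewrite mulr_ge0 ?sE // sqr_ge0.
move=> /(_ e)/eqP; rewrite scaler_eq0 (negbTE s2) /= nQE !mulf_eq0.
by rewrite (negbTE Q0) (negbTE E0).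
Qed.

End gauss.
End lebesgue_poly.

(** * Errors of interpolation and quadrature *)

Section sandwiched_errors.
Context {R : realType}.
Implicit Types (u : R -> R) (G : R) (N : nat).
Local Notation mu := (@lebesgue_measure R).
Local Notation w := (@chebyshev_weight R).

Variables (N : nat) (G : R) (u : R -> R).
Hypothesis N0 : (0 < N)%N.
Hypothesis mu_u : measurable_fun `](-1 : R), 1[ u.
Hypothesis su : sandwiched N.+1 G u.

Lemma le_cint_cint (p q : {poly R}) : {in `]-1, 1[, forall x : R, p.[x] <= q.[x]} ->
  cint p <= cint q.
Proof.
move=> pq; apply: le_Rintegral; try exact: integrable_cint; first by [].
by move=> x xI; rewrite ler_wpM2r ?chebyshev_weight_ge0 // pq.
Qed.

Lemma lint_le_cint (p : {poly R}) : {in `]-1, 1[, forall x : R, 0 <= p.[x]} ->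
  lint p <= cint p.
Proof.
move=> p0; apply: le_Rintegral; [by []|exact: integrable_lint|exact: integrable_cint|].
by move=> x xI; rewrite ler_peMr ?p0 // chebyshev_weight_ge1.
Qed.

Lemma sandwiched_bounded : exists M : R, {in `]-1, 1[, forall x, `|u x| <= M}.
Proof.
have [p [q [sp sq pq c]]] := su.
have [M1 h1] := horner_bounded p; have [M2 h2] := horner_bounded q.
exists (M1 + M2) => x xI; have /andP[hp hq] := pq _ xI.
move: xI; rewrite in_itv /= => /andP[/ltW x1 /ltW x2].
have x12 : -1 <= x <= 1 by rewrite x1.
have := h1 x x12; have := h2 x x12; rewrite !ler_norml => /andP[a1 a2] /andP[a3 a4].
have : 0 <= M1 by apply: le_trans (h1 x x12).
have : 0 <= M2 by apply: le_trans (h2 x x12).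
by move=> m1 m2; apply/andP; split; lra.
Qed.

Lemma integrable_sandwiched : mu.-integrable `]-1, 1[ (EFin \o u).
Proof. by have [M uM] := sandwiched_bounded; exact: bounded_integrable uM. Qed.

Lemma integrable_sandwiched_weight :
  mu.-integrable `]-1, 1[ (fun t => (u t * w t)%:E).
Proof.
by have [M uM] := sandwiched_bounded; exact: integrable_chebyshev_weight uM.
Qed.

(** The integral and the quadrature sum of u both lie between those of p and q,
    on which the rule is exact. *)
Lemma chebyshev_remainder_le (x : 'I_N.+1 -> R) : chebyshev_nodes x ->
  `|chebyshev_remainder x u| <= G.
Proof.
move=> xT; have [p [q [sp sq pq c]]] := su.
have s2 (r : {poly R}) : (size r <= N.+1)%N -> (size r <= 2 * N.+1)%N by lia.
have cqp : cint q - cint p <= G by rewrite -cintN -cintD.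
have k0 : 0 <= pi / N.+1%:R :> R by rewrite divr_ge0 ?pi_ge0.
have a1 : pi / N.+1%:R * \sum_(j < N.+1) u (x j) <= cint q.
  rewrite (cint_chebyshev_nodes xT (s2 _ sq)) ler_wpM2l // ler_sum // => j _.
  by have /andP[] := pq _ (chebyshev_nodes_itv j xT).
have a2 : cint p <= pi / N.+1%:R * \sum_(j < N.+1) u (x j).
  rewrite (cint_chebyshev_nodes xT (s2 _ sp)) ler_wpM2l // ler_sum // => j _.
  by have /andP[] := pq _ (chebyshev_nodes_itv j xT).
rewrite /chebyshev_remainder; set S := _ * \sum_(j < _) _ in a1 a2 *; set J := \int[mu]_(t in _) _.
have a3 : J <= cint q.
  apply: le_Rintegral; [by []|exact: integrable_sandwiched_weight|exact: integrable_cint|].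
  move=> t tI; rewrite ler_wpM2r ?chebyshev_weight_ge0 //.
  by have /andP[] := pq _ tI.
have a4 : cint p <= J.
  apply: le_Rintegral; [by []|exact: integrable_cint|exact: integrable_sandwiched_weight|].
  move=> t tI; rewrite ler_wpM2r ?chebyshev_weight_ge0 //.
  by have /andP[] := pq _ tI.
rewrite ler_norml; apply/andP; split; lra.
Qed.

Lemma legendre_remainder_le (y : 'I_N.+1 -> R) : legendre_nodes y ->
  `|legendre_remainder y u| <= G.
Proof.
move=> yL; have [p [q [sp sq pq c]]] := su.
have s2 (r : {poly R}) : (size r <= N.+1)%N -> (size r <= 2 * N.+1)%N by lia.
have lqp : lint q - lint p <= G.
  rewrite (_ : lint q - lint p = lint (q - p)); last first.
    by rewrite lintD -[- p]scaleN1r lintZ mulN1r.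
  apply: le_trans (lint_le_cint _) c => t tI; rewrite hornerD hornerN subr_ge0.
  by have /andP[h1 h2] := pq _ tI; exact: le_trans h1 h2.
have a1 : \sum_(j < N.+1) u (y j) * legendre_gauss_weight y j <= lint q.
  rewrite (gauss_exact yL (s2 _ sq)) ler_sum // => j _.
  rewrite ler_wpM2r ?gauss_weight_ge0 //.
  by have /andP[] := pq _ (legendre_nodes_itv yL j).
have a2 : lint p <= \sum_(j < N.+1) u (y j) * legendre_gauss_weight y j.
  rewrite (gauss_exact yL (s2 _ sp)) ler_sum // => j _.
  rewrite ler_wpM2r ?gauss_weight_ge0 //.
  by have /andP[] := pq _ (legendre_nodes_itv yL j).
rewrite /legendre_remainder; set S := \sum_(j < _) _ in a1 a2 *; set J := \int[mu]_(t in _) _.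
have a3 : J <= lint q.
  apply: le_Rintegral; [by []|exact: integrable_sandwiched|exact: integrable_lint|].
  by move=> t tI; have /andP[] := pq _ tI.
have a4 : lint p <= J.
  apply: le_Rintegral; [by []|exact: integrable_lint|exact: integrable_sandwiched|].
  by move=> t tI; have /andP[] := pq _ tI.
rewrite ler_norml; apply/andP; split; lra.
Qed.

Section interpolation.
Variable x : 'I_N.+1 -> R.
Hypothesis xT : chebyshev_nodes x.

Lemma interpolant_le2 (v : R -> R) (t : R) : t \in `]-1, 1[ ->
  `|(interpolant x v).[t]| <= 2 * \sum_(j < N.+1) `|v (x j)|.
Proof.
rewrite in_itv /= => /andP[/ltW t1 /ltW t2].
rewrite horner_sum (le_trans (ler_norm_sum _ _ _)) // mulr_sumr ler_sum // => j _.
rewrite hornerZ normrM mulrC ler_wpM2r //.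
by apply: lagrange_chebyshev_le2 => //; rewrite t1.
Qed.

(** The quadrature sum of q - p is at most G, and q - p is its own interpolant. *)
Lemma sandwiched_nodes (p q : {poly R}) :
  (size p <= N.+1)%N -> (size q <= N.+1)%N ->
  {in `]-1, 1[, forall x : R, p.[x] <= u x <= q.[x]} -> cint (q - p) <= G ->
  \sum_(j < N.+1) (q - p).[x j] <= 2 * N%:R / pi * G /\
  {in `]-1, 1[, forall t : R, (q - p).[t] <= 4 * N%:R / pi * G}.
Proof.
move=> sp sq pq c.
have e0 (t : R) : t \in `]-1, 1[ -> 0 <= (q - p).[t].
  move=> tI; rewrite hornerD hornerN subr_ge0.
  by have /andP[h1 h2] := pq _ tI; exact: le_trans h1 h2.
have se : (size (q - p)%R <= N.+1)%N.
  by rewrite (leq_trans (size_polyD _ _)) // size_polyN geq_max sq.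
have S1 : \sum_(j < N.+1) (q - p).[x j] <= 2 * N%:R / pi * G.
  have := c; rewrite (cint_chebyshev_nodes xT); last by lia.
  set S := \sum_(j < _) _ => h.
  have S0 : 0 <= S by apply: sumr_ge0 => j _; apply/e0/chebyshev_nodes_itv.
  have G0 : 0 <= G by apply: le_trans h; rewrite mulr_ge0 // divr_ge0 ?pi_ge0.
  have {}h : S <= N.+1%:R / pi * G.
    rewrite mulrAC ler_pdivlMr ?pi_gt0 // mulrC -ler_pdivrMl ?ltr0n // mulrA.
    by rewrite [_^-1 * _]mulrC.
  apply: (le_trans h); rewrite ler_wpM2r // ler_pM2r ?invr_gt0 ?pi_gt0 //.
  by rewrite -natrM ler_nat; lia.
split=> // t tI.
have <- : interpolant x (horner (q - p)) = q - p.
  by apply/esym/(interpolantP _ _ xT.1); split.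
rewrite (le_trans (ler_norm _)) // (le_trans (interpolant_le2 _ tI)) //.
rewrite (eq_bigr (fun j => (q - p).[x j])) => [|j _]; last first.
  by rewrite ger0_norm // e0 // chebyshev_nodes_itv.
have -> : 4 * N%:R / pi * G = 2 * (2 * N%:R / pi * G) by ring.
by rewrite ler_wpM2l.
Qed.

Lemma interpolantB (v : R -> R) (p : {poly R}) : (size p <= N.+1)%N ->
  interpolant x v - p = interpolant x (fun t => v t - p.[t]).
Proof.
move=> sp; rewrite -[p in LHS](_ : interpolant x (horner p) = p); last first.
  by apply/esym/(interpolantP _ _ xT.1); split.
by rewrite -sumrB; apply: eq_bigr => j _; rewrite -scalerBl.
Qed.

(** Interpolation reproduces p, so that the error is u - p minus the interpolant
    of u - p, and 0 <= u - p <= q - p. *)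
Lemma Linf_interpolant_le :
  (Linf_norm (fun t => (u t - (interpolant x u).[t])%R) <= (4 * N%:R * G)%:E)%E.
Proof.
have [p [q [sp sq pq c]]] := su.
have [S1 S2] := sandwiched_nodes sp sq pq c.
have e0 (t : R) : t \in `]-1, 1[ -> 0 <= (q - p).[t].
  move=> tI; rewrite hornerD hornerN subr_ge0.
  by have /andP[h1 h2] := pq _ tI; exact: le_trans h1 h2.
have G0 : 0 <= G.
  apply: le_trans c; rewrite -[leLHS](mul0r pi) -cintC.
  by apply: le_cint_cint => t /e0; rewrite hornerC.
have uB (t : R) : t \in `]-1, 1[ -> `|u t - (interpolant x u).[t]| <= 4 * N%:R * G.
  move=> tI.
  have -> : u t - (interpolant x u).[t] = (u t - p.[t]) - (interpolant x u - p).[t].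
    by rewrite hornerD hornerN; ring.
  rewrite interpolantB // (le_trans (ler_normB _ _)) //.
  have h1 : `|u t - p.[t]| <= 4 * N%:R / pi * G.
    have /andP[a1 a2] := pq _ tI; rewrite ger0_norm ?subr_ge0 //.
    by apply: le_trans (S2 t tI); rewrite hornerD hornerN lerD2r.
  have h2 := interpolant_le2 (fun t => u t - p.[t]) tI.
  have h3 : \sum_(j < N.+1) `|u (x j) - p.[x j]| <= 2 * N%:R / pi * G.
    apply: le_trans S1; apply: ler_sum => j _.
    have /andP[a1 a2] := pq _ (chebyshev_nodes_itv j xT).
    by rewrite ger0_norm ?subr_ge0 // hornerD hornerN lerD2r.
  have h4 : pi^-1 <= 2^-1 :> R by rewrite lef_pV2 ?posrE ?pi_gt0 // pi_ge2.
  have h5 : 0 <= N%:R * G by rewrite mulr_ge0.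
  have h6 : N%:R / pi * G <= N%:R * G * 2^-1.
    by rewrite mulrAC ler_wpM2l.
  have h7 : 4 * N%:R / pi * G = 4 * (N%:R / pi * G) by ring.
  have h8 : 2 * N%:R / pi * G = 2 * (N%:R / pi * G) by ring.
  lra.
rewrite /Linf_norm unlock; case: ifP => // _; last first.
  by rewrite lee_fin mulr_ge0 // mulr_ge0.
apply: ereal_inf_lbound => /=; apply: nearW => t /=.
rewrite patchE; case: ifPn => tI.
  by rewrite lee_fin uB // -inE.
by rewrite normr0 lee_fin mulr_ge0 // mulr_ge0.
Qed.

(** The square of the polynomial b, the interpolant of u - p, is integrated
    exactly by the rule; at the nodes it is below (q - p)^2, whose weighted integral is at most the
    maximum of q - p times G. *)
Lemma L2w_interpolant_le :
  (L2w_norm (fun t => (u t - (interpolant x u).[t])%R) <= (3 * N%:R `^ 2^-1 * G)%:E)%E.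
Proof.
have [p [q [sp sq pq c]]] := su.
have [S1 S2] := sandwiched_nodes sp sq pq c.
pose e := q - p; pose b := interpolant x u - p.
have e0 (t : R) : t \in `]-1, 1[ -> 0 <= e.[t].
  move=> tI; rewrite hornerD hornerN subr_ge0.
  by have /andP[h1 h2] := pq _ tI; exact: le_trans h1 h2.
have ce : 0 <= cint e.
  by rewrite -(mul0r pi) -cintC; apply: le_cint_cint => t /e0; rewrite hornerC.
have G0 : 0 <= G by apply: le_trans c.
have [sI vI] := (interpolantP u (interpolant x u) xT.1).1 erefl.
have se : (size e <= N.+1)%N.
  by rewrite (leq_trans (size_polyD _ _)) // size_polyN geq_max sq.
have sb : (size b <= N.+1)%N.
  by rewrite (leq_trans (size_polyD _ _)) // size_polyN geq_max sI.
have s2 (r : {poly R}) : (size r <= N.+1)%N -> (size (r ^+ 2) <= 2 * N.+1)%N.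
  by move=> sr; rewrite expr2 (leq_trans (size_polyMleq _ _)) //; lia.
have k0 : 0 <= pi / N.+1%:R :> R by rewrite divr_ge0 ?pi_ge0.
have cb : cint (b ^+ 2) <= cint (e ^+ 2).
  rewrite !(cint_chebyshev_nodes xT) ?s2 // ler_wpM2l // ler_sum // => j _.
  rewrite !horner_exp ler_sqr ?nnegrE ?e0 ?chebyshev_nodes_itv //.
    have /andP[a1 a2] := pq _ (chebyshev_nodes_itv j xT).
    by rewrite /b /e !hornerD !hornerN vI lerD2r.
  have /andP[a1 a2] := pq _ (chebyshev_nodes_itv j xT).
  by rewrite /b hornerD hornerN vI subr_ge0.
pose B := 4 * N%:R / pi * G.
have B0 : 0 <= B by rewrite mulr_ge0 // divr_ge0 ?pi_ge0 ?mulr_ge0.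
have ce2 : cint (e ^+ 2) <= B * G.
  apply: (@le_trans _ _ (cint (B *: e))); last by rewrite cintZ ler_wpM2l.
  apply: le_cint_cint => t tI; rewrite horner_exp hornerZ expr2.
  by rewrite ler_wpM2r ?e0 // S2.
pose P := 2%:R *: (e ^+ 2) + 2%:R *: (b ^+ 2).
have cP : cint P <= 9 * N%:R * G ^+ 2.
  rewrite cintD !cintZ.
  have h4 : pi^-1 <= 2^-1 :> R by rewrite lef_pV2 ?posrE ?pi_gt0 // pi_ge2.
  have h5 : 0 <= N%:R * G ^+ 2 by rewrite mulr_ge0 // sqr_ge0.
  have h6 : B * G = 4 * (N%:R * G ^+ 2 * pi^-1).
    by rewrite /B; ring.
  have h7 : N%:R * G ^+ 2 * pi^-1 <= N%:R * G ^+ 2 * 2^-1 by rewrite ler_wpM2l.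
  lra.
have Pge (t : R) : t \in `]-1, 1[ -> `|u t - (interpolant x u).[t]| ^+ 2 <= P.[t].
  move=> tI; rewrite real_normK ?num_real //.
  have /andP[a1 a2] := pq _ tI.
  have h1 : (u t - p.[t]) ^+ 2 <= e.[t] ^+ 2.
    by rewrite ler_sqr ?nnegrE ?e0 ?subr_ge0 // hornerD hornerN lerD2r.
  have -> : u t - (interpolant x u).[t] = (u t - p.[t]) - b.[t].
    by rewrite hornerD hornerN; ring.
  have -> : P.[t] = 2 * e.[t] ^+ 2 + 2 * b.[t] ^+ 2.
    by rewrite hornerD !hornerZ !horner_exp.
  set A := u t - p.[t] in h1 *; set d := b.[t].
  have -> : (A - d) ^+ 2 = 2 * A ^+ 2 + 2 * d ^+ 2 - (A + d) ^+ 2 by ring.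
  have := sqr_ge0 (A + d); lra.
rewrite /L2w_norm.
have le1 : (\int[mu]_(x0 in `](-1)%R, 1%R[)
   (`|u x0 - (interpolant x u).[x0]| ^+ 2 * chebyshev_weight x0)%:E <= (9 * N%:R * G ^+ 2)%:E)%E.
  apply: (@le_trans _ _ (cint P)%:E); last by rewrite lee_fin.
  rewrite /cint /Rintegral fineK; last first.
    by apply: integrable_fin_num => //; exact: integrable_cint.
  apply: ge0_le_integral => //.
  - move=> t tI; rewrite lee_fin mulr_ge0 ?chebyshev_weight_ge0 // sqr_ge0.
  - apply/measurable_EFinP; apply: measurable_funM; last exact: chebyshev_weight_measurable.
    apply: measurable_funX; apply: measurableT_comp => //.
    by apply: measurable_funB => //; exact: horner_measurable.
  - by have /integrableP[] := integrable_cint P.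
  - by move=> t tI; rewrite lee_fin ler_wpM2r ?chebyshev_weight_ge0 // Pge.
apply: (@le_trans _ _ ((9 * N%:R * G ^+ 2)%:E `^ 2^-1)%E).
  apply: gt0_ler_poweR => //; rewrite ?in_itv /= ?andbT ?leey //.
    rewrite andbT; apply: integral_ge0 => t tI.
    by rewrite lee_fin mulr_ge0 ?chebyshev_weight_ge0 // sqr_ge0.
  by rewrite andbT lee_fin mulr_ge0 ?sqr_ge0 // mulr_ge0.
rewrite poweR_EFin lee_fin.
have -> : 9 * N%:R * G ^+ 2 = (3 * G) ^+ 2 * N%:R by ring.
rewrite powRM ?sqr_ge0 // -powR_mulrn ?mulr_ge0 // -powRrM divff ?pnatr_eq0 //.
by rewrite powRr1 ?mulr_ge0 // mulrAC.
Qed.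

End interpolation.
End sandwiched_errors.

(** * Truncated powers and Abel convolutions *)

Section truncated_powers.
Context {R : realType}.
Implicit Types (s x y z r d theta V : R) (n K : nat) (h : R -> R).
Local Notation mu := (@lebesgue_measure R).

(** Young's inequality for the product of t^s and 1. *)
Lemma powR_le1D s t : 0 < s < 1 -> 0 <= t -> t `^ s <= 1 + s * (t - 1).
Proof.
move=> /andP[s0 s1] t0.
have q0 : 0 < (1 - s)^-1 by rewrite invr_gt0 subr_gt0.
have := @conjugate_powR _ (t `^ s) 1 s^-1 (1 - s)^-1 (powR_ge0 _ _) ler01.
rewrite invr_gt0 s0 q0 !invrK subrKC => /(_ isT isT erefl).
rewrite mulr1 powR1 mul1r -powRrM divff ?gt_eqF // powRr1 //.
by move/le_trans; apply; lra.
Qed.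

(** Concavity of the power s. *)
Lemma powR_tangent s y z : 0 < s < 1 -> 0 < z -> 0 <= y ->
  y `^ s <= z `^ s + s * z `^ (s - 1) * (y - z).
Proof.
move=> s01 z0 y0.
have -> : y `^ s = z `^ s * (y / z) `^ s.
  by rewrite -powRM ?(ltW z0) ?divr_ge0 ?(ltW z0) // mulrCA divff ?gt_eqF // mulr1.
have -> : z `^ s + s * z `^ (s - 1) * (y - z) = z `^ s * (1 + s * (y / z - 1)).
  have /andP[s0 _] := s01.
  by rewrite -[z `^ s](mulr_powRB1 (ltW z0) s0); field; rewrite gt_eqF.
rewrite ler_wpM2l ?powR_ge0 // powR_le1D // divr_ge0 // ltW //.
Qed.

Lemma powR_le_neg s x y : s <= 0 -> 0 < x -> x <= y -> y `^ s <= x `^ s.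
Proof.
move=> s0 x0 xy; rewrite -[s]opprK !(powRN _ (- s)) lef_pV2 ?posrE ?powR_gt0 //.
  by rewrite ge0_ler_powR // ?nnegrE ?oppr_ge0 // ltW // (lt_le_trans x0).
exact: lt_le_trans x0 xy.
Qed.

(** The truncated power (x - r)_+^s. *)
Definition tpow s r x := Num.max (x - r) 0 `^ s.

Definition tpow_cst : R := 10 * pi + 200 * pi ^+ 2.

Lemma tpow_cst_ge0 : 0 <= tpow_cst.
Proof. by rewrite addr_ge0 // mulr_ge0 // ?pi_ge0 // sqr_ge0. Qed.

(** With d = 1 / n, the part of x_+^s below d has range d^s; above d, its slopes
    are at most c = s d^(s - 1).  This splits x_+^s into a monotone function of range d^s,
    approximated with gap d^s / n, the convex function c x_+ and a concave one with slopes between - c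
    and 0, both approximated with gap c / n^2, which is of the same order. *)
Lemma tpow_sandwiched s r n : 0 < s < 1 -> (1 < n)%N ->
  sandwiched n.+1 (tpow_cst * (n%:R^-1 * n%:R^-1 `^ s)) (tpow s r).
Proof.
move=> s01 n1; have /andP[s0 s1] := s01.
have n0 : 0 < n%:R :> R by rewrite ltr0n; lia.
set d : R := n%:R^-1; have d0 : 0 < d by rewrite invr_gt0.
pose c := s * d `^ (s - 1).
have c0 : 0 < c by rewrite mulr_gt0 // powR_gt0.
pose y x := Num.max (x - r) 0.
pose m x := Num.max (x - r) d.
have mx x : d <= m x /\ x - r <= m x by rewrite !le_max lexx orbT lexx.
have m0 x : 0 < m x by exact: lt_le_trans d0 (mx x).1.
have mono x1 x2 : x1 <= x2 -> m x1 <= m x2 /\ m x2 - m x1 <= x2 - x1.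
  move=> h; rewrite /m; case: (leP (x1 - r) d) => h1; case: (leP (x2 - r) d) => h2; lra.
have ymono x1 x2 : x1 <= x2 -> y x1 <= y x2.
  move=> h; rewrite /y; case: (leP (x1 - r) 0) => h1; case: (leP (x2 - r) 0) => h2; lra.
have y0 x : 0 <= y x by rewrite le_max lexx orbT.
pose H x := c * (m x - d) - (m x `^ s - d `^ s).
pose hH x := c - s * m x `^ (s - 1).
pose F1 x := y x `^ s - c * y x + H x.
have yE x : y x = (r < x)%R%:R * (x - r).
  by rewrite /y; case: (ltP r x) => h; case: leP => h'; rewrite ?mul1r ?mul0r //=; lra.
have dec x : tpow s r x = F1 x + (c * y x + - H x) by rewrite /F1 /tpow -/(y x); ring.
(* Beyond d the three terms of F1 cancel: F1 is a function of min (y, d). *)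
have F1E x : F1 x = Num.min (y x) d `^ s - c * Num.min (y x) d.
  rewrite /F1 /H /y /m; case: (leP (x - r) 0) => h1.
    rewrite min_l ?(ltW d0) // max_r; last by lra.
    by rewrite !subrr mulr0 !subr0 addr0.
  case: (leP (x - r) d) => h2.
    by rewrite !subrr mulr0 subr0 addr0.
  ring.
have zd x : 0 <= Num.min (y x) d <= d by rewrite le_min y0 (ltW d0) ge_min lexx orbT.
have F1nd x1 x2 : x1 <= x2 -> F1 x1 <= F1 x2.
  move=> x12; rewrite !F1E.
  have : Num.min (y x1) d <= Num.min (y x2) d.
    by rewrite le_min !ge_min (ymono _ _ x12) lexx orbT.
  have /andP[a1 a2] := zd x1; have /andP[b1 b2] := zd x2.
  set z1 := Num.min _ _ in a1 a2 *; set z2 := Num.min _ _ in b1 b2 *.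
  rewrite le_eqVlt => /predU1P[->//|z12].
  have z20 : 0 < z2 by exact: le_lt_trans a1 z12.
  have t := powR_tangent s01 z20 a1.
  have cz : c <= s * z2 `^ (s - 1) by rewrite ler_pM2l // powR_le_neg //; lra.
  have : c * (z2 - z1) <= s * z2 `^ (s - 1) * (z2 - z1) by rewrite ler_wpM2r // subr_ge0 ltW.
  lra.
have F1B x : 0 <= F1 x <= 0 + d `^ s.
  rewrite add0r; apply/andP; split.
    have -> : 0 = F1 (Num.min x r).
      rewrite F1E /y [Num.max _ 0]max_r ?subr_le0 ?ge_min ?lexx ?orbT //.
      by rewrite min_l ?(ltW d0) // powR0 ?gt_eqF // mulr0 subr0.
    by apply: F1nd; rewrite ge_min lexx.
  rewrite F1E; have /andP[a1 a2] := zd x.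
  rewrite lerBlDr; apply: (@le_trans _ _ (d `^ s)).
    by rewrite ge0_ler_powR // ?nnegrE ?(ltW s0) // ltW.
  by rewrite lerDl mulr_ge0 // ltW.
have S1 : sandwiched n.+1 (10 * pi * d `^ s / n.+1%:R) F1.
  apply: (@monotone_sandwiched _ n.+1 F1 0 (d `^ s)); first exact: ltnW.
      by move=> x1 x2 _ _; exact: F1nd.
    by move=> x _; exact: F1B.
have S2 : sandwiched n.+1 (10 * pi * (10 * pi * 1 / n%:R) / n.+1%:R) y.
  apply: (@sandwiched_convex _ n _ y (fun x => (r < x)%R%:R)); first by lia.
    move=> x1 x2 _ x12 _; rewrite !yE.
    by case: (ltP r x1) => h1; case: (ltP r x2) => h2; rewrite ?mul1r ?mul0r; apply/andP; split; lra.
  apply: (@monotone_sandwiched _ n _ 0 1) => //.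
    move=> x1 x2 _ _ x12; rewrite ler_nat; case: (ltP r x1) => // h.
    by rewrite (lt_le_trans h x12).
  by move=> x _; rewrite add0r ler0n lern1 leq_b1.
have S3 : sandwiched n.+1 (10 * pi * (10 * pi * c / n%:R) / n.+1%:R) H.
  apply: (@sandwiched_convex _ n _ H hH); first by lia.
    move=> x1 x2 _ x12 _; rewrite /H /hH.
    have [m12 md] := mono _ _ x12.
    have t1 := powR_tangent s01 (m0 x1) (ltW (m0 x2)).
    have t2 := powR_tangent s01 (m0 x2) (ltW (m0 x1)).
    have g2 : s * m x2 `^ (s - 1) <= c.
      by rewrite ler_pM2l // powR_le_neg ?(mx x2).1 //; lra.
    apply/andP; split.
      have [h|h] := leP (x1 - r) d.
        have e1 : m x1 = d by rewrite /m max_r.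
        by rewrite e1 -/c subrr mul0r in t1 *; lra.
      have e1 : m x1 = x1 - r by rewrite /m max_l // ltW.
      have e2 : m x2 = x2 - r by rewrite /m max_l // ltW; lra.
      have -> : x2 - x1 = m x2 - m x1 by rewrite e1 e2; ring.
      by move: t1; set p := s * _; lra.
    apply: (@le_trans _ _ ((c - s * m x2 `^ (s - 1)) * (m x2 - m x1))).
      by move: t2; set p := s * _; lra.
    by rewrite ler_wpM2l // subr_ge0.
  apply: (@monotone_sandwiched _ n _ 0 c) => //.
    move=> x1 x2 _ _ x12; rewrite /hH lerB // ler_pM2l //.
    by rewrite powR_le_neg ?m0 //; [lra|exact: (mono _ _ x12).1].
  move=> x _; rewrite add0r /hH; apply/andP; split.
    by rewrite subr_ge0 ler_pM2l // powR_le_neg ?(mx x).1 //; lra.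
  by rewrite gerBl mulr_ge0 ?powR_ge0 // ltW.
apply: (@eq_sandwiched _ _ _ (fun x => F1 x + (c * y x + - H x))).
  by move=> x _; rewrite dec.
apply: sandwichedW (leqnn _) _ (sandwichedD S1 (sandwichedD (sandwichedZ (ltW c0) S2) (sandwichedN S3))).
have n1d : n.+1%:R^-1 <= d by rewrite lef_pV2 ?posrE // ler_nat.
have cd : c * d <= d `^ s.
  rewrite -[d `^ s](mulr_powRB1 (ltW d0) s0) /c -mulrA [_ * d]mulrC.
  by rewrite ler_piMl ?(ltW s1) // mulr_ge0 ?powR_ge0 // ltW.
have p0 := @pi_gt0 R; have i0 : 0 <= n.+1%:R^-1 :> R by rewrite invr_ge0.
have ds := powR_ge0 d s.
apply: (@le_trans _ _ ((10 * pi + 200 * pi ^+ 2) * d `^ s * n.+1%:R^-1)).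
  have -> : 10 * pi * d `^ s / n.+1%:R +
   (c * (10 * pi * (10 * pi * 1 / n%:R) / n.+1%:R) + 10 * pi * (10 * pi * c / n%:R) / n.+1%:R)
   = (10 * pi * d `^ s + 200 * pi ^+ 2 * (c * d)) * n.+1%:R^-1 by rewrite -/d; ring.
  apply: ler_wpM2r => //; rewrite [leRHS]mulrDl lerD2l; apply: ler_wpM2l => //.
  by rewrite mulr_ge0 // sqr_ge0.
rewrite /tpow_cst -mulrA ler_wpM2l //; last by rewrite mulrC ler_wpM2r.
exact: tpow_cst_ge0.
Qed.

Lemma powR_continuous s y : 0 < s -> 0 <= y -> (fun x => Num.max x 0 `^ s) x @[x --> y] --> y `^ s.
Proof.
move=> s0; rewrite le_eqVlt => /predU1P[<-|y0]; last first.
  have h : {for y, continuous (fun x : R => x `^ s)}.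
    by apply: differentiable_continuous; apply/derivable1_diffP; apply: derivable_powR; rewrite in_itv /= y0.
  apply: cvg_trans h; apply: near_eq_cvg; near=> x.
  by rewrite max_l // ltW //; near: x; apply: lt_nbhsr.
rewrite powR0 ?gt_eqF //; apply/cvgrPdist_le => e e0.
near=> x; rewrite sub0r normrN ger0_norm ?powR_ge0 //.
rewrite -[e](powRr1 (ltW e0)) (_ : e `^ 1 = (e `^ s^-1) `^ s); last first.
  by rewrite -powRrM mulVf ?gt_eqF.
rewrite ge0_ler_powR // ?nnegrE ?powR_ge0 ?(ltW s0) ?le_max ?lexx ?orbT //.
rewrite ge_max powR_ge0 andbT; near: x.
apply: (@filterS _ (nbhs (0 : R)) _ [set z | z < e `^ s^-1]); first by move=> z /ltW.
by apply: lt_nbhsl; exact: powR_gt0.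
Unshelve. all: by end_near. Qed.

Lemma integral_tpow s r x : 0 < s -> r < x ->
  (\int[mu]_(t in `]r, x[) ((x - t) `^ (s - 1))%:E = ((x - r) `^ s / s)%:E)%E.
Proof.
move=> s0 rx.
rewrite (@ge0_continuous_FTC_oo R _ (fun t => - (Num.max (x - t) 0 `^ s / s)) r x) //.
- by rewrite subrr max_l // powR0 ?gt_eqF // mul0r oppr0 add0r opprK max_l ?subr_ge0 ?ltW.
- by move=> t _; exact: powR_ge0.
- move=> t; rewrite in_itv /= => /andP[_ tx].
  apply: (@continuous_comp _ _ _ (fun t => x - t) (fun x : R => x `^ (s - 1))).
    by apply: cvgB; [exact: cvg_cst|exact: cvg_id].
  apply: differentiable_continuous; apply/derivable1_diffP; apply: derivable_powR.
  by rewrite in_itv /= subr_gt0 tx.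
- apply: continuous_in_subspaceT => t; rewrite inE /= in_itv /= => /andP[_ tx].
  apply: cvgN; apply: cvgMl.
  have h := @powR_continuous s (x - t) s0; rewrite subr_ge0 tx in h.
  rewrite max_l ?subr_ge0 //; apply: (cvg_comp _ _ _ (h isT)).
  by apply: cvgB; [exact: cvg_cst|exact: cvg_id].
- move=> t; rewrite in_itv /= => /andP[_ tx].
  have xt : 0 < x - t by rewrite subr_gt0.
  apply: (@near_eq_is_derive _ _ _ (fun t => - ((x - t) `^ s / s))).
    near=> u; rewrite max_l // subr_ge0; apply: ltW; near: u; exact: lt_nbhsl.
  have h := is_derive1_powR s xt.
  have h2 : is_derive t (1 : R) (fun u => x - u) (-1).
    by rewrite -[-1]sub0r; exact: (is_deriveB (is_derive_cst _ _ _) (is_derive_id _ _)).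
  have h3 : is_derive t (1 : R) (fun u => (x - u) `^ s) (- (s * (x - t) `^ (s - 1))).
    have := @is_derive1_comp _ (fun x : R => x `^ s) (fun u => x - u) t _ _ h h2.
    by rewrite mulrN1.
  by apply: is_derive_eq; rewrite /GRing.scale /=; field; rewrite gt_eqF.
Unshelve. all: by end_near. Qed.

Lemma powR_kernel_measurable s x (A : set R) :
  measurable_fun A (fun t : R => (x - t) `^ (s - 1)).
Proof.
apply: measurable_funTS.
apply: (@measurableT_comp _ _ _ _ _ _ (fun x : R => x `^ (s - 1)) _ (fun t : R => x - t)).
  exact: measurable_powR.
by apply: measurable_funB.
Qed.

Lemma integrable_kernel s theta x (f : R -> R) M : 0 < s ->
  measurable_fun `]theta, x[ f ->
  {in `]theta, x[, forall t, `|f t| <= M} ->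
  mu.-integrable `]theta, x[ (fun t => ((x - t) `^ (s - 1) * f t)%:E).
Proof.
move=> s0 mf fM.
have ik : mu.-integrable `]theta, x[ (fun t => (M * (x - t) `^ (s - 1))%:E).
  apply: (@integrableZl _ _ _ mu _ _ M (fun t => ((x - t) `^ (s - 1))%:E)) => //.
  apply/integrableP; split.
    by apply/measurable_EFinP; exact: powR_kernel_measurable.
  under eq_integral do rewrite gee0_abs ?lee_fin ?powR_ge0 //.
  have [tx|xt] := ltP theta x; first by rewrite integral_tpow // ltry.
  by rewrite set_itv_ge ?integral_set0 ?ltry // bnd_simp -leNgt.
apply: le_integrable ik => //.
  apply/measurable_EFinP; apply: measurable_funM => //.
  exact: powR_kernel_measurable.
move=> t tI; rewrite lee_fin !normrM mulrC ler_wpM2r //.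
by rewrite (le_trans (fM _ tI)) // ler_norm.
Qed.

(** On ]-1, 1[ the set U is the half-line from r, up to its end point. *)
Lemma Rintegral_tpow_upset s theta (U : set R) : 0 < s -> -1 < theta < 1 ->
  (forall x y, x <= y -> U x -> U y) -> (forall t, U t -> theta < t) ->
  exists r, {in `]-1, 1[, forall x,
    \int[mu]_(t in `]theta, x[) ((x - t) `^ (s - 1) * `[< U t >]%:R) = tpow s r x / s}.
Proof.
move=> s0 th1 Uup Uth.
(* Adding [1, +oo[ makes the infimum exist, with U empty as well. *)
pose E := U `|` [set t | 1 <= t].
have E1 : E 1 by right; rewrite /= lexx.
have Eth t : E t -> theta <= t.
  by move=> [/Uth/ltW//|/= t1]; have /andP[_ /ltW h] := th1; exact: le_trans h t1.
have lE : has_lbound E by exists theta => t /Eth.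
pose r := inf E; exists r => x; rewrite in_itv /= => /andP[x1 x2].
have thr : theta <= r by apply: lb_le_inf; [exists 1|move=> t /Eth].
have Ur t : t < x -> U t -> r <= t by move=> tx Ut; apply: ge_inf => //; left.
have rU t : t < x -> r < t -> U t.
  move=> tx rt; have [|u Eu ut] := @inf_lt _ E t _ rt; first by exists 1.
  case: Eu => [Uu|/= u1]; first exact: Uup (ltW ut) Uu.
  by have := lt_trans ut (lt_trans tx x2); rewrite ltNge u1.
have [xr|rx] := leP x r.
  rewrite /tpow max_r ?subr_le0 // powR0 ?gt_eqF // mul0r.
  rewrite /Rintegral (eq_integral (fun=> 0%E)) ?integral0 // => t.
  rewrite inE /= in_itv /= => /andP[_ tx]; case: asboolP => [Ut|_]; last by rewrite mulr0.
  by have := Ur _ tx Ut; rewrite leNgt (lt_le_trans tx xr).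
rewrite /tpow max_l ?subr_ge0 ?(ltW rx) //.
rewrite /Rintegral.
pose k t := ((x - t) `^ (s - 1))%:E; pose P := `]r, +oo[%classic.
have DP : `]r, x[%classic = `]theta, x[%classic `&` P.
  apply/seteqP; split=> t; rewrite /P /= !in_itv /= ?andbT.
    by move=> /andP[rt ->]; rewrite rt (le_lt_trans thr rt).
  by move=> [/andP[_ ->] ->].
have mkP : measurable_fun setT (k \_ P).
  apply/(measurable_restrictT _ (measurable_itv _)).
  by apply/measurable_EFinP; exact: powR_kernel_measurable.
have E1k : {in `]theta, x[%classic `\ r,
    (fun t => ((x - t) `^ (s - 1) * `[< U t >]%:R)%:E) =1 k \_ P}.
  move=> t; rewrite inE /= in_itv /= => -[/andP[_ tx] tr].
  rewrite patchE mem_setE /P in_itv /= andbT.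
  case: (ltP r t) => rt; case: asboolP => Ut; rewrite ?mulr1 ?mulr0 //.
    by case: Ut; exact: rU.
  by case: tr; apply/eqP; rewrite eq_le rt Ur.
have mD : measurable (`]theta, x[%classic `\ r).
  by apply: measurableD => //; exact: measurable_set1.
have -> : (\int[mu]_(t in `]theta, x[) ((x - t) `^ (s - 1) * `[< U t >]%:R)%:E
    = \int[mu]_(t in `]theta, x[) (k \_ P) t)%E.
  transitivity (\int[mu]_(t in `]theta, x[ `\ r) (k \_ P) t)%E; last first.
    by apply: integral_setD1 => //; exact: measurable_funTS.
  rewrite -(@integral_setD1 _ _ r) //.
    by apply: eq_integral => t /E1k.
  apply: (eq_measurable_fun (k \_ P)); first by move=> t /E1k.
  exact: measurable_funTS.
by rewrite -integral_mkcondr -DP integral_tpow.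
Qed.

Lemma RintegralZ_sum (D : set R) K (a : R) (f : nat -> R -> R) : measurable D ->
  (forall k, mu.-integrable D (EFin \o f k)) ->
  mu.-integrable D (EFin \o (fun t => a * \sum_(k < K) f k t)) /\
  \int[mu]_(t in D) (a * \sum_(k < K) f k t)
    = a * \sum_(k < K) \int[mu]_(t in D) f k t.
Proof.
move=> mD fi.
have si n : mu.-integrable D (EFin \o (fun t => \sum_(k < n) f k t)).
  rewrite (_ : EFin \o _ = fun t => (\sum_(k < n) (f k t)%:E)%E); last first.
    by apply/funext => t /=; rewrite sumEFin.
  by apply: integrable_sum => // k _; exact: fi.
split; first by apply: (@integrableZl _ _ _ mu _ mD a (EFin \o (fun t => \sum_(k < K) f k t))).
rewrite RintegralZl //; congr (_ * _).
elim: K => [|K ih].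
  rewrite big_ord0; under eq_Rintegral do rewrite big_ord0.
  by rewrite Rintegral_cst // mul0r.
under eq_Rintegral do rewrite big_ord_recr /=.
by rewrite (@RintegralD _ _ _ mu _ _ _ mD (si K) (fi K)) ih big_ord_recr.
Qed.

(** Uniformly in x, the convolution of (x - t)^(s - 1) with h is close to the average of its
    convolutions with the indicators of the level sets of h, which are truncated powers.
    The error decreases with the number K of levels, chosen such that it is below the gap. *)
Lemma Abel_sandwiched s theta h V n : 0 < s < 1 -> -1 < theta < 1 -> (1 < n)%N ->
  {homo h : x y / x <= y} -> (forall t, t <= theta -> h t = 0) ->
  (forall t, 0 <= h t <= V) ->
  sandwiched n.+1 (2 / s * tpow_cst * V * (n%:R^-1 * n%:R^-1 `^ s))
    (fun x => \int[mu]_(t in `]theta, x[) ((x - t) `^ (s - 1) * h t)).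
Proof.
move=> s01 th1 n1 hnd h0 hV; have /andP[s0 s1] := s01.
have n0 : 0 < n%:R :> R by rewrite ltr0n; lia.
set d : R := n%:R^-1; have d0 : 0 < d by rewrite invr_gt0.
pose G := tpow_cst * (d * d `^ s).
have p0 := @pi_gt0 R.
have G0 : 0 < G.
  by rewrite !mulr_gt0 ?powR_gt0 // addr_gt0 // mulr_gt0 // exprn_gt0.
have V0 : 0 <= V by have /andP[a b] := hV 0; exact: le_trans a b.
pose K := (Num.truncn (2 * pi / G)).+1.
have K0 : 0 < K%:R :> R by rewrite ltr0n.
have KG : 2 * pi / K%:R <= G.
  have : 2 * pi / G < K%:R by exact: truncnS_gt.
  by rewrite ltr_pdivrMr // ler_pdivrMr // [_ * G]mulrC => /ltW.
pose U k := [set t : R | theta < t /\ V * k.+1%:R / K%:R <= h t].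
have /choice[r rP] : forall k, exists r, {in `]-1, 1[, forall x,
    \int[mu]_(t in `]theta, x[) ((x - t) `^ (s - 1) * `[< U k t >]%:R)
      = tpow s r x / s}.
  move=> k; apply: Rintegral_tpow_upset => // [x y xy [tx Vx]|t []//].
  by split; [exact: lt_le_trans xy|exact: le_trans (hnd _ _ xy)].
pose v : R := (0 < V)%R%:R.
have v01 : 0 <= v <= 1 by rewrite ler0n lern1 leq_b1.
pose g x := V / K%:R * (\sum_(k < K) v / s * tpow s (r k) x).
pose ker x t := (x - t) `^ (s - 1).
have mU x k : measurable_fun `]theta, x[ (fun t : R => `[< U k t >]%:R : R).
  apply: nondecreasing_measurable => // t u tu; rewrite ler_nat.
  case: asboolP => // -[tt Vt]; case: asboolP => // -[].
  by split; [exact: lt_le_trans tu|exact: le_trans (hnd _ _ tu)].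
have iU x k : mu.-integrable `]theta, x[ (EFin \o (fun t => ker x t * (v * `[< U k t >]%:R))).
  apply: (@integrable_kernel _ _ _ _ 1) => //; last first.
    by move=> t _; rewrite /v ger0_norm; case: ltP => _; case: asboolP => _; rewrite ?mulr1 ?mulr0 // ler01.
  by apply: measurable_funM => //; exact: mU.
have ih x : mu.-integrable `]theta, x[ (EFin \o (fun t => ker x t * h t)).
  apply: (@integrable_kernel _ _ _ _ V) => //; first exact: nondecreasing_measurable.
  by move=> t _; have /andP[a b] := hV t; rewrite ger0_norm.
have close : {in `]-1, 1[, forall x, - 0 <=
    \int[mu]_(t in `]theta, x[) (ker x t * h t) - g x <= V / K%:R * (2 / s)}.
  move=> x xI; have [I1 I2] := @RintegralZ_sum `]theta, x[ K (V / K%:R) _ (measurable_itv _) (iU x).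
  have gE : g x = \int[mu]_(t in `]theta, x[)
      (V / K%:R * \sum_(k < K) ker x t * (v * `[< U k t >]%:R)).
    rewrite I2 /g; congr (_ * _); apply: eq_bigr => k _.
    have i1 : mu.-integrable `]theta, x[ (EFin \o (fun t => ker x t * (`[< U k t >]%:R : R))).
      apply: (@integrable_kernel s theta x (fun t => `[< U k t >]%:R) 1 s0 (mU x k)).
      by move=> t _; case: asboolP => _; rewrite ?normr0 ?normr1.
    rewrite mulrAC -mulrA -(rP k x xI) -RintegralZl //.
    by apply: eq_Rintegral => t _; rewrite mulrCA.
  rewrite gE -RintegralB // oppr0.
  have lev t : t \in `]theta, x[%classic -> ker x t * h t
      - V / K%:R * \sum_(k < K) ker x t * (v * `[< U k t >]%:R)
    = ker x t * (h t - V / K%:R * \sum_(k < K) (V * k.+1%:R / K%:R <= h t)%R%:R * (0 < V)%R%:R).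
    rewrite inE /= in_itv /= => /andP[tt _].
    rewrite -mulr_sumr mulrBr [V / _ * (_ * _)]mulrCA; congr (_ - _ * (_ * _)).
    apply: eq_bigr => k _; rewrite mulrC -/v; congr (_%:R * _).
    case: asboolP => [[_ ->]//|h1].
    by case: leP => // h2; case: h1.
  have lv t := @monotone_levels _ h V K t isT (hV t).
  have i2 := @integrableB _ _ _ mu _ (measurable_itv `]theta, x[) _ _ (ih x) I1.
  apply/andP; split.
    apply: Rintegral_ge0 => t tI; rewrite lev ?inE // mulr_ge0 ?powR_ge0 //.
    by have /andP[] := lv t.
  have VK : 0 <= V / K%:R by rewrite divr_ge0 // ltW.
  have ik : mu.-integrable `]theta, x[ (EFin \o (fun t => ker x t * (V / K%:R))).
    apply: (@integrable_kernel _ _ _ _ (V / K%:R)) => //.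
    by move=> t _; rewrite ger0_norm.
  apply: (@le_trans _ _ (\int[mu]_(t in `]theta, x[) (ker x t * (V / K%:R)))).
    apply: le_Rintegral => // t tI; rewrite lev ?inE // ler_wpM2l ?powR_ge0 //.
    by have /andP[] := lv t.
  rewrite (_ : \int[mu]_(t in _) _ = (V / K%:R) * \int[mu]_(t in `]theta, x[) ker x t); last first.
    rewrite -RintegralZl //; first by apply: eq_Rintegral => t _; rewrite mulrC.
    rewrite (_ : _ \o _ = EFin \o (fun t => ker x t * 1)); last first.
      by apply/funext => t /=; rewrite mulr1.
    by apply: (@integrable_kernel _ _ _ (fun=> 1) 1) => // t _; rewrite normr1.
  rewrite ler_wpM2l //.
  have [xt|tx] := leP x theta.
    rewrite set_itv_ge; last by rewrite bnd_simp -leNgt.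
    by rewrite Rintegral_set0 divr_ge0 // ltW.
  rewrite /Rintegral integral_tpow //= ler_wpM2r ?invr_ge0 ?(ltW s0) //.
  rewrite (@le_trans _ _ (2 `^ s)) //.
    move: xI th1; rewrite in_itv /= => /andP[_ x1] /andP[t1 _].
    by rewrite ge0_ler_powR // ?nnegrE ?subr_ge0 ?(ltW s0) ?(ltW tx) //; lra.
  rewrite (le_trans (powR_le1D s01 _)) //; lra.
have Sg : sandwiched n.+1 (V / K%:R * (\sum_(k < K) v / s * G)) g.
  apply: sandwichedZ; first by rewrite divr_ge0 // ltW.
  apply: sandwiched_sum => k; apply: sandwichedZ; last exact: tpow_sandwiched.
  by rewrite divr_ge0 ?(andP v01).1 // ltW.
apply: sandwichedW (leqnn _) _ (sandwiched_close _ close Sg) => //.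
rewrite sumr_const card_ord -[v / s * G *+ K]mulr_natr add0r.
have -> : V / K%:R * (v / s * G * K%:R) + pi * (V / K%:R * (2 / s))
  = V / s * (v * G + 2 * pi / K%:R) by field; rewrite !gt_eqF.
rewrite (_ : 2 / s * _ * V * _ = V / s * (G + G)); last by rewrite /G; ring.
by rewrite ler_wpM2l ?divr_ge0 ?(ltW s0) // lerD // ler_piMl ?(andP v01).2 // ltW.
Qed.

End truncated_powers.

(** * Absolutely continuous functions are indefinite integrals *)

Section interval_families.
Context {R : realType}.
Implicit Types (a b c d e x y : R) (f : R -> R) (I J : R * R) (s t : seq (R * R)).
Implicit Types (h : R * R -> R).

Definition separated I J := (I.2 <= J.1) || (J.2 <= I.1).

(** Non-overlapping intervals of [a, b], in any order, as in the definition of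
    absolute continuity; lists can be refined and merged by induction. *)
Definition family a b s :=
  all (fun I => [&& a <= I.1, I.1 <= I.2 & I.2 <= b]) s && pairwise separated s.

Definition total_length s := \sum_(I <- s) (I.2 - I.1).

(** The condition of absolute continuity for a function of intervals. *)
Definition small_on a b h := forall e, 0 < e -> exists2 d, 0 < d &
  forall s, family a b s -> total_length s < d -> \sum_(I <- s) h I <= e.

Lemma abs_cont_small a b f : abs_cont a b f ->
  small_on a b (fun I => `|f I.2 - f I.1|).
Proof.
move=> fac e e0; have [d d0 H] := fac e e0; exists d => // s /andP[sab sep] sd.
have nthE (h : R * R -> R) : \sum_(I <- s) h I = \sum_(i < size s) h (nth (0, 0) s i).
  by rewrite (big_nth (0, 0)) big_mkord.
rewrite nthE ltW //; apply: (H (size s) (fun i => nth (0, 0) s i)).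
- move=> i; have := allP sab (nth (0, 0) s i) (mem_nth _ (ltn_ord i)).
  by move=> /and3P[].
- move=> i j _ _ [x []] /=; rewrite !in_itv /= => /andP[h1 h2] /andP[h3 h4].
  have sepij (k l : 'I_(size s)) : (k < l)%N -> separated (nth (0, 0) s k) (nth (0, 0) s l).
    by move=> kl; apply: (pairwiseP (0, 0) sep) => //; rewrite inE ltn_ord.
  apply/eqP; rewrite -val_eqE /=; apply/negPn/negP => ij.
  have [ij'|ji'] : (i < j)%N \/ (j < i)%N by move: ij; lia.
    by case/orP: (sepij i j ij') => h; lra.
  by case/orP: (sepij j i ji') => h; lra.
- by rewrite -(nthE (fun I => I.2 - I.1)).
Qed.

Lemma family_cat a b s t : family a b (s ++ t) =
  [&& family a b s, family a b t & allrel separated s t].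
Proof.
rewrite /family all_cat pairwise_cat.
set A := all _ s; set B := all _ t; set C := allrel _ _ _.
set D := pairwise _ s; set E := pairwise _ t.
by case: A; case: B; case: C; case: D; case: E.
Qed.

Lemma separatedC I J : separated I J = separated J I.
Proof. by rewrite /separated orbC. Qed.

(** The intervals of a partition given by its points, starting from x. *)
Definition pieces x (s : seq R) : seq (R * R) :=
  [seq (z.2, z.1) | z <- zip s (x :: s)].

Lemma pieces_family x (s : seq R) : path <%R x s -> family x (last x s) (pieces x s).
Proof.
elim: s x => [|y s IH] x //= /andP[xy ys].
have /andP[A P] := IH y ys.
have yl : y <= last y s.
  have := allP A; move: ys; case: (s) => //= z s' /andP[yz _] H.
  have := H (y, z); rewrite inE eqxx /= => /(_ isT)/andP[_ /andP[_]].
  exact: le_trans (ltW yz).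
rewrite /family /= lexx (ltW xy) yl /=; apply/and3P; split.
- by apply/allP => J /(allP A)/and3P[h1 h2 h3]; rewrite h2 h3 (le_trans (ltW xy)).
- by apply/allP => J /(allP A)/and3P[h1 h2 h3]; rewrite /separated /= h1.
- exact: P.
Qed.

Lemma total_length_pieces x (s : seq R) : total_length (pieces x s) = last x s - x.
Proof.
elim: s x => [|y s IH] x; first by rewrite /total_length big_nil subrr.
rewrite /total_length /pieces /= big_cons /= -/(pieces y s) -/(total_length _) IH.
by rewrite addrC addrA subrK.
Qed.

Lemma sum_pieces_variation a b f (s : seq R) : itv_partition a b s ->
  \sum_(I <- pieces a s) `|f I.2 - f I.1| = variation a b f s.
Proof. by move=> abs; rewrite variation_zip // big_map. Qed.

(** The intervals are replaced one at a time by the pieces of a partition of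
    nearly maximal variation, which are again short in total. *)
Lemma small_total_variation a b f :
  {in `[a, b] &, forall x y, x <= y -> total_variation x y f \is a fin_num} ->
  small_on a b (fun I => `|f I.2 - f I.1|) ->
  small_on a b (fun I => fine (total_variation I.1 I.2 f)).
Proof.
move=> fin fs e e0; have [d d0 H] := fs e e0; exists d => //.
suff key s t : family a b (s ++ t) -> total_length (s ++ t) < d ->
    \sum_(I <- s) fine (total_variation I.1 I.2 f) +
    \sum_(I <- t) `|f I.2 - f I.1| <= e.
  by move=> s fs' ls; have := key s [::]; rewrite cats0 big_nil addr0; apply.
elim: s t => [|I s IH] t ft lt; first by rewrite big_nil add0r H.
have := ft; rewrite cat_cons -cat1s family_cat => /and3P[fI fst sepI].
move: fI; rewrite /family /= !andbT => /and3P[aI I12 Ib].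
rewrite big_cons -addrA addrC -lerBrDl.
have finI : total_variation I.1 I.2 f \is a fin_num.
  by apply: fin => //; rewrite in_itv /=; apply/andP; split => //; lra.
rewrite -lee_fin fineK //; apply: ge_ereal_sup => _ [_ [p pI <-] <-].
rewrite lee_fin -sum_pieces_variation //.
suff : \sum_(j <- s) fine (total_variation j.1 j.2 f) +
    \sum_(J <- pieces I.1 p ++ t) `|f J.2 - f J.1| <= e by rewrite big_cat /=; lra.
have [pp /eqP lp] := pI.
have pf : family I.1 I.2 (pieces I.1 p) by rewrite -{1}lp; exact: pieces_family.
have pin J : J \in pieces I.1 p -> [&& I.1 <= J.1, J.1 <= J.2 & J.2 <= I.2].
  by move: pf => /andP[/allP A _]; exact: A.
have sepP J : J \in pieces I.1 p -> {in s ++ t, forall K, separated J K}.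
  move=> /pin/and3P[h1 h2 h3] K Kst.
  have : separated I K by move: sepI; rewrite allrel1l => /allP; apply.
  rewrite /separated => /orP[h|h].
    by rewrite (le_trans h3 h).
  by rewrite (le_trans h h1) orbT.
apply: IH.
- move: fst; rewrite !family_cat => /and3P[fs1 ft1 st].
  rewrite fs1 ft1 allrel_catr st /= andbT; apply/andP; split; first apply/andP; first split.
  + have /andP[A P] := pf; rewrite /family P andbT.
    apply/allP => J /(allP A)/and3P[h1 h2 h3].
    by rewrite h2 (le_trans aI h1) (le_trans h3 Ib).
  + by apply/allrelP => J K Jp Kt; apply: sepP => //; rewrite mem_cat Kt orbT.
  + apply/allrelP => J K Js Kp; rewrite separatedC; apply: sepP => //.
    by rewrite mem_cat Js.
- move: lt; rewrite /total_length cat_cons big_cons !big_cat /=.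
  by have := total_length_pieces I.1 p; rewrite /total_length lp; lra.
Qed.

(** By additivity of the variation, which is at most 1 on intervals shorter than d. *)
Lemma small_total_variation_fin a b f : a <= b ->
  small_on a b (fun I => `|f I.2 - f I.1|) ->
  {in `[a, b] &, forall x y, x <= y -> total_variation x y f \is a fin_num}.
Proof.
move=> ab fs; have [d d0 H] := fs 1 ltr01.
have short x y : a <= x -> x <= y -> y <= b -> y - x < d ->
    (total_variation x y f <= 1%:E)%E.
  move=> ax xy yb yx; apply: ge_ereal_sup => _ [_ [p pI <-] <-].
  have [pp /eqP lp] := pI.
  rewrite lee_fin -sum_pieces_variation //; apply: H; last first.
    by rewrite total_length_pieces lp.
  have /andP[A P] := pieces_family pp; rewrite /family P andbT.
  apply/allP => J /(allP A)/and3P[h1 h2 h3]; rewrite lp in h3.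
  by rewrite h2 (le_trans ax h1) (le_trans h3 yb).
have step (n : nat) x y : a <= x -> x <= y -> y <= b -> y - x < n%:R * (d / 2) ->
    (total_variation x y f <= n%:R%:E)%E.
  elim: n x => [|n IH] x ax xy yb yx; first by exfalso; rewrite mul0r in yx; lra.
  have [ys|ys] := leP y (x + d / 2).
    rewrite (le_trans (short x y ax xy yb _)); first by [].
      by lra.
    by rewrite lee_fin ler1n.
  have xz : x <= x + d / 2 by lra.
  rewrite (total_variationD _ xz (ltW ys)) -[n.+1]addn1 natrD EFinD addeC leeD //.
    apply: IH => //; [lra|lra|].
    by move: yx; rewrite -natr1 mulrDl mul1r; lra.
  by apply: short => //; lra.
move=> x y; rewrite !in_itv /= => /andP[ax xb] /andP[ay yb] xy.
rewrite ge0_fin_numE ?total_variation_ge0 //.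
pose n := (Num.bound ((y - x) / (d / 2))).
apply: (@le_lt_trans _ _ n%:R%:E); last by rewrite ltry.
apply: step => //; rewrite -ltr_pdivrMr; last by lra.
by apply: archi_boundP; rewrite divr_ge0 //; lra.
Qed.

(** If I meets some J of the family, J is removed and the hull of I and J inserted
    instead. *)
Lemma insert_interval s I : pairwise separated s -> all (fun I => I.1 <= I.2) s ->
  I.1 <= I.2 -> exists t,
  [/\ pairwise separated t, all (fun I => I.1 <= I.2) t,
      total_length t <= total_length s + (I.2 - I.1) &
      {in I :: s, forall J, exists2 K, K \in t & (K.1 <= J.1) && (J.2 <= K.2)}].
Proof.
move En: (size s) => n; elim: n s I En => [|n IH] s I sn sep ok okI.
  move: sn => /size0nil ->; exists [:: I]; split=> //=.
  - by rewrite okI.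
  - by rewrite /total_length big_seq1 big_nil add0r.
  - by move=> J; rewrite inE => /eqP ->; exists I; rewrite ?inE // !lexx.
have [sepI|/allPn[J Js nsep]] := boolP (all (separated I) s).
  exists (I :: s); split=> //=.
  - by rewrite sepI.
  - by rewrite okI.
  - by rewrite /total_length big_cons addrC.
  - by move=> J Js; exists J; rewrite ?lexx.
have okJ := allP ok _ Js.
move: nsep; rewrite /separated negb_or -!ltNge => /andP[JI IJ].
pose H := (Num.min I.1 J.1, Num.max I.2 J.2).
have p := perm_to_rem Js.
have sub : subseq (rem J s) s := rem_subseq _ _.
have [||||t [sept okt lt cov]] := IH (rem J s) H.
- by rewrite size_rem // sn.
- exact: subseq_pairwise sub sep.
- by apply/allP => K /mem_rem; exact: (allP ok).
- by rewrite /H /= ge_min !le_max okI.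
exists t; split=> //.
- apply: le_trans lt _; rewrite {2}/total_length (perm_big _ p) big_cons /=.
  rewrite /total_length /H /=; set S := \sum_(_ <- _) _.
  by case: (leP I.2 J.2) => h1; case: (leP I.1 J.1) => h2; lra.
- move=> K; rewrite inE => /predU1P[->|].
    have [L Lt /andP[h1 h2]] := cov H (mem_head _ _); exists L => //.
    by rewrite (le_trans h1) ?(le_trans _ h2) //= ?ge_min ?le_max lexx.
  rewrite (perm_mem p) inE => /predU1P[->|Ks].
    have [L Lt /andP[h1 h2]] := cov H (mem_head _ _); exists L => //.
    by rewrite (le_trans h1) ?(le_trans _ h2) //= ?ge_min ?le_max lexx ?orbT.
  by apply: cov; rewrite inE Ks orbT.
Qed.

Lemma merge_intervals s : all (fun I => I.1 <= I.2) s -> exists t,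
  [/\ pairwise separated t, all (fun I => I.1 <= I.2) t,
      total_length t <= total_length s &
      {in s, forall J, exists2 K, K \in t & (K.1 <= J.1) && (J.2 <= K.2)}].
Proof.
elim: s => [|I s IH] /=; first by exists [::].
move=> /andP[okI /IH[t [sept okt lt cov]]].
have [t' [sept' okt' lt' cov']] := insert_interval sept okt okI.
exists t'; split=> //.
- by rewrite (le_trans lt') // {2}/total_length big_cons addrC lerD2l.
- move=> J; rewrite inE => /predU1P[->|/cov[K Kt /andP[h1 h2]]].
    by apply: cov'; rewrite mem_head.
  have [|L Lt /andP[h3 h4]] := cov' K; first by rewrite inE Kt orbT.
  by exists L => //; rewrite (le_trans h3 h1) (le_trans h2 h4).
Qed.

End interval_families.

Section absolutely_continuous_measure.
Context {R : realType}.
Implicit Types (a b c d e x y : R) (f g : R -> R) (s t : seq (R * R)).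
Local Notation mu := (@lebesgue_measure R).

(** Composing with clamp extends a function from [a, b] to the line by
    constants. *)
Definition clamp a b x := Num.max a (Num.min x b).

Lemma clamp_itv a b x : a <= b -> a <= clamp a b x <= b.
Proof. by move=> ab; rewrite /clamp le_max lexx /= ge_max ab ge_min lexx orbT. Qed.

Lemma clamp_id a b x : a <= x <= b -> clamp a b x = x.
Proof. by move=> /andP[ax xb]; rewrite /clamp min_l // max_r. Qed.

Lemma clamp_le a b x y : x <= y -> clamp a b x <= clamp a b y.
Proof.
move=> xy; rewrite /clamp ge_max !le_max lexx /=; apply/orP; right.
by rewrite le_min !ge_min xy lexx !orbT.
Qed.

Lemma clamp_dist a b x y : a <= b -> x <= y -> clamp a b y - clamp a b x <= y - x.
Proof.
move=> ab xy; rewrite lerBlDr /clamp ge_max; apply/andP; split.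
  by rewrite ler_wpDl ?subr_ge0 // le_max lexx.
apply: (@le_trans _ _ (y - x + Num.min x b)); last by rewrite lerD2l le_max lexx orbT.
by rewrite addr_minr subrK le_min !ge_min lexx /= lerDr subr_ge0 xy orbT.
Qed.

Variables (a b : R) (g : R -> R).
Hypothesis ab : a < b.
Hypothesis gnd : {in `[a, b] &, {homo g : x y / x <= y}}.
Hypothesis gs : small_on a b (fun I => g I.2 - g I.1).

Let G x := g (clamp a b x).

Let clampI x : clamp a b x \in `[a, b].
Proof. by rewrite in_itv /= clamp_itv // ltW. Qed.

Let Gnd : nondecreasing G.
Proof. by move=> x y xy; rewrite gnd // clamp_le. Qed.

Let Gcont : continuous G.
Proof.
have gc e : 0 < e -> exists2 d, 0 < d & forall x y, x <= y -> y - x < d -> G y - G x <= e.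
  move=> e0; have [d d0 H] := gs e0; exists d => // x y xy xyd.
  have := H [:: (clamp a b x, clamp a b y)].
  rewrite /total_length !big_seq1 /=; apply.
    rewrite /family /= !andbT; have := clampI x; have := clampI y.
    rewrite !in_itv /= => /andP[_ ->] /andP[-> _] /=.
    by rewrite clamp_le.
  exact: le_lt_trans (clamp_dist (ltW ab) xy) xyd.
move=> x; apply/cvgrPdist_le => e e0.
have [d d0 H] := gc e e0.
near=> y.
have xyd : `|x - y| < d by near: y; apply: cvgr_dist_lt.
have [xy|/ltW yx] := leP x y.
  rewrite ler0_norm ?subr_le0 ?Gnd // opprB H //.
  by apply: le_lt_trans xyd; rewrite distrC ler_norm.
rewrite ger0_norm ?subr_ge0 ?Gnd // H //.
by apply: le_lt_trans xyd; rewrite ler_norm.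
Unshelve. all: by end_near. Qed.

HB.instance Definition _ :=
  isCumulative.Build R _ R G Gnd (right_continuousW Gcont).

Let Gc : cumulative R R := G.

Let nu : {measure set (g_sigma_algebraType R.-ocitv.-measurable) -> \bar R} :=
  lebesgue_stieltjes_measure Gc.

Let nu_itv x y : x <= y -> nu `]x, y]%classic = (G y - G x)%:E.
Proof.
move=> xy; rewrite /nu /= /lebesgue_stieltjes_measure /= /measure_extension /=.
rewrite measurable_mu_extE /=; last exact: is_ocitv.
by rewrite wlength_itv_bnd.
Qed.

(** The intervals may overlap and leave [a, b]: they are merged first and then
    clamped, which does not increase their lengths. *)
Let nu_cover_le e d s : 0 < e ->
  (forall s, family a b s -> total_length s < d -> \sum_(I <- s) (g I.2 - g I.1) <= e) ->
  all (fun I => I.1 <= I.2) s -> total_length s < d ->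
  (nu (\big[setU/set0]_(I <- s) `]I.1, I.2]%classic) <= e%:E)%E.
Proof.
move=> e0 H ok ls; have [t [sept okt lt cov]] := merge_intervals ok.
pose F I : set (g_sigma_algebraType R.-ocitv.-measurable) := `]I.1, I.2]%classic.
have sub : \big[setU/set0]_(I <- s) F I `<=` \big[setU/set0]_(I <- t) F I.
  move=> x; rewrite -!bigcup_seq => -[J /= Js]; rewrite /F /= in_itv /= => /andP[h1 h2].
  have [K Kt /andP[h3 h4]] := cov J Js; exists K => //=.
  by rewrite in_itv /= (le_lt_trans h3 h1) (le_trans h2 h4).
have mF I : measurable (F I) by exact: measurable_itv.
have mFU (u : seq (R * R)) : measurable (\big[setU/set0]_(I <- u) F I).
  by apply: bigsetU_measurable => I _; exact: mF.
apply: (@le_trans _ _ (nu (\big[setU/set0]_(I <- t) F I))).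
  apply: (le_measure nu) sub; rewrite inE; exact: mFU.
apply: (@le_trans _ _ (\sum_(I <- t) nu (F I))%E).
  elim: (t) => [|I u IH]; first by rewrite !big_nil measure0.
  by rewrite !big_cons (le_trans (measureU2 nu (mF I) (mFU u))) // leeD2l.
rewrite (eq_big_seq (fun I => (G I.2 - G I.1)%:E)); last first.
  by move=> I It; rewrite nu_itv //; exact: (allP okt).
rewrite sumEFin lee_fin.
pose t' := [seq (clamp a b K.1, clamp a b K.2) | K <- t].
have := H t'; rewrite {3}/t' big_map /=; apply.
  apply/andP; split.
    apply/allP => _ /mapP[I It ->] /=; rewrite clamp_le ?(allP okt) //=.
    by have := clampI I.1; have := clampI I.2; rewrite !in_itv /= => /andP[_ ->] /andP[-> _].
  rewrite pairwise_map; apply: sub_pairwise sept => I J.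
  by rewrite /separated /= => /orP[h|h]; rewrite (clamp_le a b h) ?orbT.
apply: le_lt_trans (le_lt_trans lt ls).
rewrite /total_length /t' big_map [leLHS]big_seq [leRHS]big_seq ler_sum // => I It.
by rewrite clamp_dist ?(ltW ab) //; exact: (allP okt).
Qed.

(** A Lebesgue-null set has countable covers by intervals of total length less
    than d; their finite subfamilies have small measure, hence also their union. *)
Let nu_dominated : nu `<< mu.
Proof.
apply/null_content_dominatesP => A mA muA0.
apply/eqP; rewrite eq_le measure_ge0 andbT; apply/lee_addgt0Pr => e e0.
rewrite add0e.
have [d d0 H] := gs e0.
have : (mu A < d%:E)%E by rewrite muA0 lte_fin.
rewrite /lebesgue_measure /lebesgue_stieltjes_measure /measure_extension /=.
move=> /ereal_inf_lt[_ [F [mF AF] <-] Fd].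
have Fitv k : exists I : R * R, I.1 <= I.2 /\ F k = `]I.1, I.2]%classic.
  have /ocitvP[->|[I I12 ->]] := mF k.
    by exists (0, 0); rewrite lexx set_itvoc0.
  by exists I; rewrite ltW.
have [J JP] := choice Fitv.
have mF' k : measurable (F k : set (measurableTypeR R)).
  by have [_ ->] := JP k; exact: measurable_itv.
have FE n : \big[setU/set0]_(k < n) F k =
    \big[setU/set0]_(I <- [seq J k | k <- iota 0 n]) `]I.1, I.2]%classic.
  rewrite big_map.
  transitivity (\big[setU/set0]_(0 <= k < n) `](J k).1, (J k).2]%classic).
    by rewrite big_mkord; apply: eq_bigr => k _; have [_ ->] := JP k.
  by rewrite /index_iota subn0.
have le_e n : (nu (\big[setU/set0]_(k < n) F k) <= e%:E)%E.
  rewrite FE; apply: nu_cover_le H _ _ => //.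
    by apply/allP => _ /mapP[k _ ->]; have [] := JP k.
  rewrite -lte_fin; apply: le_lt_trans Fd.
  apply: le_trans (nneseries_lim_ge n _); last first.
    by move=> k _ _; exact: wlength_ge0.
  rewrite /total_length big_map /index_iota subn0 -sumEFin.
  rewrite le_eqVlt; apply/orP; left; apply/eqP.
  apply: eq_bigr => k _; have [I12 ->] := JP k.
  by rewrite wlength_itv_bnd.
have cv : nu (\big[setU/set0]_(k < n.+1) F k) @[n --> \oo] --> nu (\bigcup_k F k).
  have := @nondecreasing_cvg_mu _ _ _ nu (fun n => \big[setU/set0]_(k < n.+1) F k).
  rewrite bigcup_bigsetU_bigcup; apply.
  - by move=> n; apply: bigsetU_measurable.
  - by apply: bigcupT_measurable.
  - by move=> m n mn; apply/subsetPset; exact: subset_bigsetU.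
apply: (@le_trans _ _ (nu (\bigcup_k F k))).
  by apply: (le_measure nu) => //; rewrite inE //; exact: bigcupT_measurable.
rewrite -(cvg_lim _ cv) //; apply: lime_le.
  by apply/cvg_ex; eexists; exact: cv.
exact: nearW.
Qed.

(** The Lebesgue-Stieltjes measure of g is absolutely continuous, and the
    Radon-Nikodym theorem gives the density. *)
Lemma small_on_density : exists2 rho : R -> R,
  mu.-integrable setT (EFin \o rho) &
  forall x, a <= x <= b -> g x - g a = \int[mu]_(t in `]a, x]) rho t.
Proof.
have moo : (nu `]a, b]%classic < +oo)%E by rewrite nu_itv ?(ltW ab) // ltry.
have mab : measurable (`]a, b]%classic : set (g_sigma_algebraType R.-ocitv.-measurable)).
  exact: measurable_itv.
have dom : mfrestr mab moo `<< mu.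
  apply/null_content_dominatesP => A mA A0; rewrite /mfrestr /mrestr /=.
  have /null_content_dominatesP H := nu_dominated.
  apply: H; first exact: measurableI.
  by apply: (@subset_measure0 _ _ _ mu _ A) => //; exact: measurableI.
have [r [r0 rfin ri rE]] := @radon_nikodym_sigma_finite _ _ R mu (mfrestr mab moo) dom.
have rEq : (EFin \o (fine \o r)) = r by apply/funext => x /=; rewrite fineK.
exists (fine \o r); first by rewrite rEq.
move=> x /andP[ax xb]; rewrite /Rintegral.
rewrite (_ : (\int[mu]_(t in `]a, x]) ((fine \o r) t)%:E = \int[mu]_(t in `]a, x]) r t)%E); last first.
  by apply: eq_integral => t _; rewrite -[in RHS]rEq.
rewrite -rE; last exact: measurable_itv.
have eA : `]a, x]%classic `&` `]a, b]%classic = `]a, x]%classic :> set R.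
  apply: setIidl => t /=.
  by rewrite !in_itv /= => /andP[-> h] /=; exact: le_trans h xb.
transitivity (fine (nu `]a, x]%classic)).
  by rewrite nu_itv //= /G !clamp_id ?ax ?lexx ?xb ?(ltW ab).
by rewrite /mfrestr /mrestr; congr (fine (nu _)); exact: esym eA.
Qed.

End absolutely_continuous_measure.

Section abs_cont_FTC.
Context {R : realType}.
Local Notation mu := (@lebesgue_measure R).

(** The variation T of f and T - f are nondecreasing and inherit absolute
    continuity from f. *)
Lemma abs_cont_density (a b : R) (f : R -> R) : a < b -> abs_cont a b f ->
  exists2 rho : R -> R, mu.-integrable setT (EFin \o rho) &
  forall x, a <= x <= b -> f x - f a = \int[mu]_(t in `]a, x]) rho t.
Proof.
move=> ab /abs_cont_small fs.
have fin := small_total_variation_fin (ltW ab) fs.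
have Ts := small_total_variation fin fs.
pose T x := fine (total_variation a x f).
have aI : a \in `[a, b] by rewrite in_itv /= lexx ltW.
have TD x y : a <= x -> x <= y -> y <= b -> T y - T x = fine (total_variation x y f).
  move=> ax xy yb; rewrite /T (total_variationD _ ax xy) fineD.
  - by rewrite addrAC subrr add0r.
  - by apply: fin => //; rewrite in_itv /= ax (le_trans xy yb).
  - by apply: fin => //; rewrite in_itv /= ?ax ?yb ?(le_trans xy yb) ?(le_trans ax xy).
have Tge x y : a <= x -> x <= y -> y <= b -> `|f y - f x| <= T y - T x.
  move=> ax xy yb; rewrite TD // -lee_fin fineK ?total_variation_ge //.
  by apply: fin => //; rewrite in_itv /= ?ax ?yb ?(le_trans xy yb) ?(le_trans ax xy).
have famTD (s : seq (R * R)) I : family a b s -> I \in s ->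
    [/\ a <= I.1, I.1 <= I.2 & I.2 <= b].
  by move=> /andP[/allP A _] /A/and3P[].
have [r1 i1 e1] : exists2 rho : R -> R, mu.-integrable setT (EFin \o rho) &
    forall x, a <= x <= b -> T x - T a = \int[mu]_(t in `]a, x]) rho t.
  apply: (small_on_density ab).
    move=> x y; rewrite !in_itv /= => /andP[ax xb] /andP[ay yb] xy.
    by rewrite -subr_ge0 (le_trans _ (Tge _ _ ax xy yb)).
  move=> e e0; have [d d0 H] := Ts e e0; exists d => // s fs' ls.
  apply: le_trans (H s fs' ls); rewrite [leLHS]big_seq [leRHS]big_seq ler_sum // => I Is.
  by have [h1 h2 h3] := famTD _ _ fs' Is; rewrite TD.
have [r2 i2 e2] : exists2 rho : R -> R, mu.-integrable setT (EFin \o rho) &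
    forall x, a <= x <= b -> (T x - f x) - (T a - f a) = \int[mu]_(t in `]a, x]) rho t.
  apply: (@small_on_density _ a b (fun x => T x - f x) ab).
    move=> x y; rewrite !in_itv /= => /andP[ax xb] /andP[ay yb] xy.
    by have := Tge _ _ ax xy yb; rewrite ler_norml => /andP[]; lra.
  move=> e e0; have e20 : 0 < e / 2 by lra.
  have [d d0 H] := Ts _ e20; exists d => // s fs' ls.
  have := H s fs' ls; rewrite -(ler_pM2l (ltr0n R 2)) [leRHS]mulrCA divff // mulr1.
  apply: le_trans; rewrite mulr_sumr [leLHS]big_seq [leRHS]big_seq ler_sum // => I Is.
  have [h1 h2 h3] := famTD _ _ fs' Is; rewrite -TD //.
  by have := Tge _ _ h1 h2 h3; rewrite ler_norml => /andP[]; lra.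
exists (fun x => r1 x - r2 x).
  by have := integrableB measurableT i1 i2.
move=> x xab; rewrite RintegralB //; try by apply: integrableS; last eassumption.
by rewrite -e1 // -e2 //; ring.
Qed.

(** The fundamental theorem of calculus for absolutely continuous functions;
    Lebesgue differentiation applies to the density. *)
Lemma abs_cont_derive (a b : R) (f : R -> R) : a < b -> abs_cont a b f ->
  exists rho : R -> R, [/\ mu.-integrable setT (EFin \o rho),
    forall x, a <= x <= b -> f x - f a = \int[mu]_(t in `]a, x]) rho t &
    {ae mu, forall x, x \in `]a, b[ -> derivable f x 1 /\ derive1 f x = rho x}].
Proof.
move=> ab fac; have [rho ir fE] := abs_cont_density ab fac.
exists rho; split=> //.
have iS (A : set R) : measurable A -> mu.-integrable A (EFin \o rho).
  by move=> mA; apply: integrableS ir.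
have loc : locally_integrable [set: R] rho by apply: open_integrable_locally => //; exact: openT.
have := @FTC1 R rho (BRight a) (fun y => iS _ (measurable_itv _)) loc.
apply: filterS; first exact: (ae_filter_ringOfSetsType mu).
move=> x H xab; move: (xab); rewrite in_itv /= => /andP[ax xb].
have [dF F'] := H ax.
pose F y := \int[mu]_(t in `]a, y]) rho t.
have e : \near x, F x + f a = f x.
  near=> y; have /andP[ay yb] : a < y < b.
    by apply/andP; split; near: y; [exact: lt_nbhsr|exact: lt_nbhsl].
  by rewrite /F -fE ?subrK // (ltW ay) (ltW yb).
have d' : is_derive x 1 (fun y => F y + f a) (rho x).
  have ? : is_derive x 1 F (rho x) by apply: DeriveDef; [exact: dF|rewrite -derive1E].
  by apply: is_derive_eq; rewrite addr0.
have d'' := near_eq_is_derive e d'.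
by have [dd dv] := d''; split; [exact: dd|rewrite derive1E dv].
Unshelve. all: by end_near. Qed.

End abs_cont_FTC.

(** * Substitutions and null sets *)

Section affine_substitution.
Context {R : realType}.
Local Notation mu := (@lebesgue_measure R).
Implicit Types c d : R.

Definition affine c d : measurableTypeR R -> measurableTypeR R :=
  fun t => c * t + d.

Lemma measurable_affine c d : measurable_fun setT (affine c d).
Proof. by apply: measurable_funD => //; exact: measurable_funM. Qed.

HB.instance Definition _ c d :=
  isMeasurableFun.Build _ _ _ _ (affine c d) (measurable_affine c d).

(** The Lebesgue measure is determined by its values on these intervals. *)
Lemma affine_preimage c d a b : c != 0 -> (mu (affine c d @^-1` `]a, b]) = 
  (`|c|^-1)%:E * mu `]a, b])%E.
Proof.
move=> c0; have [cp|cn] : 0 < c \/ c < 0.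
- by move: c0; rewrite neq_lt => /orP[]; [right|left].
- rewrite (_ : _ @^-1` _ = `](a - d) / c, (b - d) / c]%classic); last first.
    apply/seteqP; split=> t; rewrite /= /affine !in_itv /=;
    by rewrite ltr_pdivrMr // ler_pdivlMr // ltrBlDr lerBrDr [t * c]mulrC.
  rewrite !lebesgue_measure_itv /= !lte_fin gtr0_norm //.
  rewrite ltr_pM2r ?invr_gt0 // ltrD2r.
  case: ltP => ab; last by rewrite mule0.
  by rewrite -!EFinB -EFinM; congr _%:E; field; rewrite gt_eqF.
- rewrite (_ : _ @^-1` _ = `[(b - d) / c, (a - d) / c[%classic); last first.
    apply/seteqP; split=> t; rewrite /= /affine !in_itv /=;
    by rewrite ltr_ndivlMr // ler_ndivrMr // ltrBlDr lerBrDr [t * c]mulrC andbC.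
  rewrite !lebesgue_measure_itv /= !lte_fin ltr0_norm //.
  rewrite ltr_nM2r ?invr_lt0 // ltrD2r.
  case: ltP => ab; last by rewrite mule0.
  by rewrite -!EFinB -EFinM; congr _%:E; field; rewrite lt_eqF.
Qed.

Lemma ge0_integral_affine c d (f : R -> \bar R) : c != 0 ->
  measurable_fun setT f -> (forall x, 0 <= f x)%E ->
  (\int[mu]_t f (c * t + d)%R = (`|c|^-1)%:E * \int[mu]_t f t)%E.
Proof.
move=> c0 mf f0.
have c1 : 0 < `|c|^-1 by rewrite invr_gt0 normr_gt0.
pose k : {nonneg R} := NngNum (ltW c1).
have -> : (\int[mu]_t f (c * t + d)%R = \int[pushforward mu (affine c d)]_t f t)%E.
  by rewrite ge0_integral_pushforward //; exact: measurable_affine.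
rewrite -(ge0_integral_mscale mu measurableT k) //.
apply: eq_measure_integral => A mA _.
have cc : 0 < `|c| by rewrite normr_gt0.
pose k' : {nonneg R} := NngNum (ltW cc).
have h : forall A, measurable A -> mu A = mscale k' (pushforward mu (affine c d)) A.
  move=> mphi; apply: lebesgue_measure_unique => _ [[a b]] _ <-.
  transitivity (`|c|%:E * mu (affine c d @^-1` `]a, b]))%E; last by [].
  rewrite affine_preimage // muleA -EFinM.
  by rewrite divff ?gt_eqF // mul1e.
transitivity (mu (affine c d @^-1` A)); first by [].
transitivity ((`|c|^-1)%:E * mu A)%E; last by [].
rewrite (h (measurable_affine c d) A mA).
transitivity ((`|c|^-1)%:E * (`|c|%:E * mu (affine c d @^-1` A)))%E; last by [].
by rewrite muleA -EFinM mulVf ?gt_eqF // mul1e.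
Qed.

End affine_substitution.

Section ae_integral.
Context d (T : measurableType d) (R : realType) (mu : {measure set T -> \bar R}).
Implicit Types (f g : T -> \bar R) (D N : set T).
Import HBNNSimple.

Let nnint f := ereal_sup [set sintegral mu h |
  h in [set h : {nnsfun T >-> R} | forall x, ((h x)%:E <= f x)%E]].

Let le_nnint N f g : measurable N -> mu N = 0%E -> (forall x, 0 <= g x)%E ->
  (forall x, ~ N x -> f x = g x) -> (nnint f <= nnint g)%E.
Proof.
move=> mN N0 g0 fg; apply: ge_ereal_sup => /= _ [h hf <-].
have mN' := measurableC mN.
pose h' : {nnsfun T >-> R} := proj_nnsfun h mN'.
have h'E x : h' x = h x * \1_(~` N) x by [].
apply: ereal_sup_ubound; exists h'.
  move=> x; rewrite [h' x]h'E indicE.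
  have [xN|xN] := pselect (N x).
    by rewrite memNset ?mulr0 //=; apply.
  by rewrite mem_set // mulr1 -fg.
rewrite -!integralT_nnsfun; apply: ge0_ae_eq_integral => //.
- by apply/measurable_EFinP.
- by apply/measurable_EFinP.
- by move=> x _; rewrite lee_fin.
- by move=> x _; rewrite lee_fin.
exists N; split => // x; apply: contra_notP => xN _.
by rewrite [h' x]h'E indicE mem_set // mulr1.
Qed.

(** The integral of a nonnegative function is a supremum over the simple functions
    below it, and a simple function can be set to 0 on a null set.  This applies to the
    m-th derivative of u, whose values on the null set where it does not exist are arbitrary. *)
Lemma ae_eq_integralW D f g : {ae mu, forall x, D x -> f x = g x} ->
  (\int[mu]_(x in D) f x = \int[mu]_(x in D) g x)%E.
Proof.
case=> N [mN N0 sN].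
have fg x : ~ N x -> (f \_ D) x = (g \_ D) x.
  move=> xN; rewrite !patchE; case: ifPn => // /set_mem xD.
  by apply: contrapT => h; apply: xN; apply: sN => /(_ xD).
rewrite /integral; congr (_ - _)%E; apply/eqP; rewrite eq_le; apply/andP; split;
  apply: (le_nnint mN N0) => x; rewrite ?funepos_ge0 ?funeneg_ge0 //;
  by move=> /fg h; rewrite ?funeposE ?funenegE h.
Qed.

End ae_integral.

(** * The Abel transform and its inversion *)

Section abel_kernel.
Context {R : realType}.
Local Notation mu := (@lebesgue_measure R).
Implicit Types (s x y z t theta : R).

(** The power a of the positive part; it vanishes for z <= 0 also when a < 0. *)
Definition ppow (a z : R) : R := Num.max z 0 `^ a.

Lemma measurable_ppow a : measurable_fun setT (ppow a).
Proof.
apply: (@measurableT_comp _ _ _ _ _ _ (fun y : R => y `^ a) _ (fun z => Num.max z 0)).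
  exact: measurable_powR.
by apply: measurable_maxr.
Qed.

Lemma ppow_ge0 a z : 0 <= ppow a z.
Proof. exact: powR_ge0. Qed.

Lemma ppow_pos a z : 0 <= z -> ppow a z = z `^ a.
Proof. by move=> z0; rewrite /ppow max_l. Qed.

Lemma ppow_neg a z : a != 0 -> z <= 0 -> ppow a z = 0.
Proof. by move=> a0 z0; rewrite /ppow max_r // powR0. Qed.

Lemma ppowZ a c z : 0 < c -> ppow a (c * z) = c `^ a * ppow a z.
Proof.
by move=> c0; rewrite /ppow -powRM ?(ltW c0) ?le_max ?lexx ?orbT // maxr_pMr ?(ltW c0) // mulr0.
Qed.

(** The Beta integral B(s, 1 - s). *)
Definition abel_cst s : \bar R :=
  (\int[mu]_t (ppow (s - 1) (1 - t) * ppow (- s) t)%:E)%E.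

Lemma measurable_abel s x y :
  measurable_fun setT (fun t => (ppow (s - 1) (x - t) * ppow (- s) (t - y))%:E).
Proof.
apply/measurable_EFinP; apply: measurable_funM.
  apply: (measurableT_comp (measurable_ppow _)).
  by apply: measurable_funB.
apply: (measurableT_comp (measurable_ppow _)).
by apply: measurable_funB.
Qed.

(** The substitution t -> (x - y) t + y; the exponents add up to - 1. *)
Lemma abel_kernelE s x y : y < x ->
  (\int[mu]_t (ppow (s - 1) (x - t) * ppow (- s) (t - y))%:E = abel_cst s)%E.
Proof.
move=> yx; pose c := x - y; have c0 : 0 < c by rewrite subr_gt0.
have h := @ge0_integral_affine _ c y _ _ (measurable_abel s x y) _.
have k0 t : (0 <= (ppow (s - 1) (x - t) * ppow (- s) (t - y))%:E)%E.
  by rewrite lee_fin mulr_ge0 // ppow_ge0.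
have := h (lt0r_neq0 c0) k0; rewrite (gtr0_norm c0) => {}h.
have -> : abel_cst s = (c%:E * \int[mu]_t (ppow (s - 1) (x - (c * t + y)) * ppow (- s) (c * t + y - y))%:E)%E.
  rewrite -ge0_integralZl //; last exact: ltW.
  - apply: eq_integral => t _; rewrite -EFinM; congr _%:E.
    have -> : x - (c * t + y) = c * (1 - t) by rewrite /c; ring.
    rewrite addrK !ppowZ // mulrACA.
    have -> : c `^ (s - 1) * c `^ (- s) = c^-1.
      rewrite -powRD; last by rewrite (gt_eqF c0) implybT.
      by rewrite (_ : s - 1 + - s = - 1) ?powR_inv1 ?ltW //; ring.
    by rewrite mulVKf // gt_eqF.
  - apply/measurable_EFinP; apply: measurable_funM.
      apply: (measurableT_comp (measurable_ppow _)).
      by apply: measurable_funB => //; apply: measurable_funD => //; apply: measurable_funM.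
    apply: (measurableT_comp (measurable_ppow _)).
    by apply: measurable_funB => //; apply: measurable_funD => //; apply: measurable_funM.
by rewrite h muleA -EFinM divff ?gt_eqF // mul1e.
Qed.

Lemma integral_ppow a : 0 < a ->
  (\int[mu]_(t in `]0%R, 1%R[) (ppow (a - 1) (1 - t))%:E = (a^-1)%:E)%E.
Proof.
move=> a0; transitivity (\int[mu]_(t in `]0%R, 1%R[) ((1 - t) `^ (a - 1))%:E)%E.
  apply: eq_integral; by move=> t; rewrite inE /= in_itv /= => /andP[_ /ltW t1]; rewrite ppow_pos // subr_ge0.
by rewrite integral_tpow // subr0 powR1 mul1r.
Qed.

Lemma integral_ppow0 a : 0 < a ->
  (\int[mu]_(t in `]0%R, 1%R[) (ppow (a - 1) t)%:E = (a^-1)%:E)%E.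
Proof.
move=> a0; rewrite -(integral_ppow a0).
rewrite integral_mkcond [RHS]integral_mkcond.
have m : measurable_fun setT ((fun t => (ppow (a - 1) (1 - t))%:E) \_ `]0%R, 1%R[).
  by apply/(measurable_restrictT _ (measurable_itv _)); apply: measurable_funTS; apply/measurable_EFinP; apply: (measurableT_comp (measurable_ppow _)); exact: measurable_funB.
have N10 : (-1 : R) != 0 by rewrite oppr_eq0 oner_eq0.
have k0 t : (0 <= ((fun t => (ppow (a - 1) (1 - t))%:E) \_ `]0%R, 1%R[) t)%E.
  by rewrite patchE; case: ifP => // _; rewrite lee_fin ppow_ge0.
have := ge0_integral_affine 1 N10 m k0.
rewrite normrN1 invr1 mul1e => <-.
apply: eq_integral => t _; rewrite !patchE !mem_setE !in_itv /=.
rewrite (_ : (0 < -1 * t + 1 < 1) = (0 < t < 1)).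
  by case: ifP => // _; congr (_ _)%:E; ring.
by apply/idP/idP => /andP[? ?]; apply/andP; split; lra.
Qed.

(** The integrand is at least 1 on ]0, 1[, and one of the two factors is at most 2
    on each half of this interval. *)
Lemma abel_cst_fin s : 0 < s < 1 -> (1 <= abel_cst s < +oo)%E.
Proof.
move=> /andP[s0 s1]; pose k a t := (ppow (a - 1) (1 - t))%:E.
have sE : - s = 1 - s - 1 by ring.
have mk a (D : set R) : measurable_fun D (k a).
  apply/measurable_EFinP; apply: measurable_funTS.
  apply: (measurableT_comp (measurable_ppow _)).
  by apply: measurable_funB.
have mk' a (D : set R) : measurable_fun D (fun t => (ppow a t)%:E).
  by apply/measurable_EFinP; apply: measurable_funTS; exact: measurable_ppow.
pose g t := ppow (s - 1) (1 - t) * ppow (- s) t.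
have gE : abel_cst s = (\int[mu]_(t in `]0%R, 1%R[) (g t)%:E)%E.
  rewrite [RHS]integral_mkcond; apply: eq_integral => t _.
  rewrite patchE mem_setE in_itv /=; case: ifP => // /negbT.
  rewrite negb_and -!leNgt /g => /orP[t0|t1].
    by rewrite (@ppow_neg (- s)) ?mulr0 // oppr_eq0 gt_eqF.
  by rewrite (@ppow_neg (s - 1)) ?mul0r // ?subr_le0 // lt_eqF // subr_lt0.
have mg : measurable_fun `](0 : R), 1[ (EFin \o g).
  apply: measurable_funTS.
  have := @measurable_abel s 1 0; apply: eq_measurable_fun => t _.
  by rewrite /= subr0.
have g0 t : 0 <= g t by rewrite mulr_ge0 // ppow_ge0.
rewrite gE; apply/andP; split.
  rewrite (_ : 1%E = \int[mu]_(t in `]0%R, 1%R[) (1%:E))%E; last first.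
    have m1 : mu `]0, 1[%classic = 1%E.
      by rewrite lebesgue_measure_itv /= lte_fin ltr01 oppr0 adde0.
    by rewrite integral_cst //= m1 mul1e.
  apply: ge0_le_integral => //.
  move=> t; rewrite /= in_itv /= => /andP[t0 t1]; rewrite lee_fin /g.
    rewrite !ppow_pos ?subr_ge0 ?(ltW t0) ?(ltW t1) //.
    have h1 z a : a <= 0 -> 0 < z -> z <= 1 -> 1 <= z `^ a.
      by move=> a0 z0 z1; have := powR_le_neg a0 z0 z1; rewrite powR1.
    by apply: mulr_ege1; apply: h1; lra.
apply: (@le_lt_trans _ _ (\int[mu]_(t in `]0%R, 1%R[)
    (2 * (ppow (s - 1) (1 - t) + ppow (- s) t))%:E)%E).
  apply: ge0_le_integral => //.
  - by move=> t _; rewrite lee_fin.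
  - apply/measurable_EFinP; apply: measurable_funM => //.
    by apply: measurable_funD; apply/measurable_EFinP; [exact: mk|exact: mk'].
  - move=> t; rewrite /= in_itv /= => /andP[t0 t1]; rewrite lee_fin /g.
    rewrite !ppow_pos ?subr_ge0 ?(ltW t0) ?(ltW t1) //.
    have hp a z : -1 < a < 0 -> 2^-1 <= z -> z `^ a <= 2.
      move=> /andP[a1 a0] z2; apply: (@le_trans _ _ ((2^-1) `^ a)).
        apply: powR_le_neg => //; exact: ltW.
      rewrite -powR_inv1 // -powRrM mulN1r -[leRHS]powRr1 // ler_powR //; lra.
    have p1 := powR_ge0 (1 - t) (s - 1); have p2 := powR_ge0 t (- s).
    have [t2|t2] := leP (2^-1) t.
      have := hp (- s) t; move=> /(_ _ t2) h2.
      rewrite (@le_trans _ _ ((1 - t) `^ (s - 1) * 2)) //.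
        by rewrite ler_wpM2l // h2 //; lra.
      by rewrite mulrC ler_pM2l // lerDl.
    have := hp (s - 1) (1 - t); move=> h2.
    rewrite (@le_trans _ _ (2 * t `^ (- s))) //.
      by rewrite ler_wpM2r // h2 //; lra.
    by rewrite ler_pM2l // lerDr.
rewrite (_ : (fun t => _) = (fun t => 2%:E * (k s t + (ppow (- s) t)%:E))%E); last first.
  by apply/funext => t; rewrite -EFinD -EFinM.
rewrite ge0_integralZl //; last 2 first.
- by apply: emeasurable_funD; [exact: mk|exact: mk'].
- by move=> t _; rewrite adde_ge0 // lee_fin ppow_ge0.
rewrite ge0_integralD //.
- by rewrite integral_ppow // sE integral_ppow0 ?subr_gt0 // -EFinD -EFinM ltry.
- by move=> t _; rewrite lee_fin ppow_ge0.
- exact: mk.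
- by move=> t _; rewrite lee_fin ppow_ge0.
- exact: mk'.
Qed.

End abel_kernel.

Section abel_inversion.
Context {R : realType}.
Local Notation mu := (@lebesgue_measure R).
Implicit Types (s x y z t theta a : R) (rho : R -> R).

(** The integrand is dominated by t^(a - 1) on ]0, 1[ and by exp (- t) beyond. *)
Lemma Gamma_gt0 a : 0 < a < 1 -> 0 < Gamma a.
Proof.
move=> /andP[a0 a1].
pose f t := t `^ (a - 1) * expR (- t).
have mf (D : set R) : measurable_fun D (EFin \o f).
  apply/measurable_EFinP; apply: measurable_funTS; apply: measurable_funM.
    exact: measurable_powR.
  by apply: (measurableT_comp (@measurable_expR R)); exact: oppr_measurable.
have f0 t : 0 <= f t by rewrite mulr_ge0 ?powR_ge0 ?expR_ge0.
rewrite /Gamma /Rintegral fine_gt0 //; apply/andP; split.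
  apply: (@lt_le_trans _ _ (\int[mu]_(t in `]0%R, 1%R[) (expR (-1))%:E)%E).
    have m1 : mu `]0, 1[%classic = 1%E.
      by rewrite lebesgue_measure_itv /= lte_fin ltr01 oppr0 adde0.
    by rewrite integral_cst //= m1 mule1 lte_fin expR_gt0.
  apply: (@le_trans _ _ (\int[mu]_(t in `]0%R, 1%R[) (f t)%:E)%E); last first.
    apply: ge0_subset_integral => //; first exact: mf.
      by move=> t _; rewrite lee_fin.
    by apply: subset_itvl; rewrite bnd_simp.
  apply: ge0_le_integral => //.
  - exact: mf.
  - move=> t; rewrite /= in_itv /= => /andP[t0 t1]; rewrite lee_fin /f.
    have h : 1 <= t `^ (a - 1).
      have a10 : a - 1 <= 0 by lra.
      by have := powR_le_neg a10 t0 (ltW t1); rewrite powR1.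
    rewrite -[leLHS]mul1r ler_pM ?expR_ge0 // ler_expR; lra.
pose k := (fun t => (ppow (a - 1) t)%:E) \_ `]0, 1[%classic.
have mk (D : set R) : measurable_fun D k.
  apply: measurable_funTS.
  apply/(measurable_restrictT _ (measurable_itv _)); apply/measurable_EFinP.
  by apply: measurable_funTS; exact: measurable_ppow.
have k0 t : (0 <= k t)%E by rewrite /k patchE; case: ifP => // _; rewrite lee_fin ppow_ge0.
pose e t := (exponential_pdf 1 t)%:E.
have me (D : set R) : measurable_fun D e.
  by apply/measurable_EFinP; apply: measurable_funTS; exact: measurable_exponential_pdf.
have e0 t : (0 <= e t)%E by rewrite lee_fin exponential_pdf_ge0.
apply: (@le_lt_trans _ _ (\int[mu]_t (k t + e t))%E).
  apply: (@le_trans _ _ (\int[mu]_(t in `]0%R, +oo[) (k t + e t))%E); last first.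
    apply: ge0_subset_integral => //.
      by apply: emeasurable_funD; [exact: mk|exact: me].
    by move=> t _; rewrite adde_ge0.
  apply: ge0_le_integral => //.
  - by move=> t _; rewrite lee_fin; exact: f0.
  - exact: mf.
  - by apply: emeasurable_funD; [exact: mk|exact: me].
  - move=> t; rewrite /= in_itv /= andbT => t0; rewrite /k patchE mem_setE in_itv /= t0 /=.
    have -> : e t = (expR (- t))%:E.
      by rewrite /e exponential_pdfE ?(ltW t0) //= mul1r mulN1r.
    rewrite -[point]/(0%E : \bar R).
    have et : 0 <= expR (- t) :> R by exact: expR_ge0.
    case: ifP => [t1|/negbT]; rewrite -?leNgt => *.
      rewrite -EFinD lee_fin ppow_pos ?(ltW t0) //.
      rewrite (@le_trans _ _ (t `^ (a - 1))) ?lerDl //.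
      by rewrite /f ler_piMr ?powR_ge0 // -expR0 ler_expR oppr_le0 ltW.
    rewrite add0e lee_fin /f ler_piMl //.
    have a10 : a - 1 <= 0 by lra.
    have t1 : 1 <= t by assumption.
    by have := powR_le_neg a10 ltr01 t1; rewrite powR1.
have eE : (\int[mu]_t e t = 1)%E by exact: integral_exponential_pdf.
rewrite ge0_integralD //; [|exact: mk|exact: me].
rewrite eE /k -integral_mkcond.
by rewrite integral_ppow0 // -EFinD ltry.
Qed.

(** The composition of the fractional integrals of orders 1 - s and s, up to their
    Gamma factors, is the ordinary one: by Fubini, the coefficient of rho y is the integral
    over ]y, x[ of (x - t)^(s - 1) (t - y)^(- s), which does not depend on x and y. *)
Lemma abel_inversion s theta x rho : 0 < s < 1 ->
  mu.-integrable setT (EFin \o rho) ->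
  \int[mu]_(t in `]theta, x[)
      ((x - t) `^ (s - 1) * \int[mu]_(y in `]theta, t[) (rho y / (t - y) `^ s))
  = fine (abel_cst s) * \int[mu]_(t in `]theta, x[) rho t.
Proof.
move=> s01 irho; have /andP[s0 s1] := s01.
have /andP[B1 Boo] := abel_cst_fin s01.
have Bfin : (fine (abel_cst s))%:E = abel_cst s.
  by rewrite fineK // ge0_fin_numE // (le_trans _ B1).
set B := fine _ in Bfin *.
have B0 : 0 <= B by rewrite -lee_fin Bfin (le_trans _ B1).
have iD : mu.-integrable `]theta, x[ (EFin \o rho).
  by apply: integrableS irho.
have mrho : measurable_fun setT rho by have /measurable_int/measurable_EFinP := irho.
pose D := `]theta, x[%classic.
pose r0 := rho \_ D.
have mr0 : measurable_fun setT r0.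
  by apply/(measurable_restrictT _ (measurable_itv _)); exact: measurable_funTS.
have ir0 : mu.-integrable setT (EFin \o r0).
  apply: le_integrable irho => //; first exact/measurable_EFinP.
  move=> t _; rewrite lee_fin /r0 patchE; case: ifP => // _.
  by rewrite normr0.
pose kap z := ppow (s - 1) (x - z).
pose lam z := ppow (- s) z.
have sn1 : s - 1 != 0 by rewrite lt_eqF // subr_lt0.
have sn2 : - s != 0 by rewrite oppr_eq0 gt_eqF.
have kap0 z : 0 <= kap z by exact: ppow_ge0.
have lam0 z : 0 <= lam z by exact: ppow_ge0.
have mkap : measurable_fun setT kap.
  by apply: (measurableT_comp (measurable_ppow _)); apply: measurable_funB.
have mlam : measurable_fun setT lam by exact: measurable_ppow.
pose f (p : R * R) := (kap p.1 * lam (p.1 - p.2) * r0 p.2)%:E.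
have mf : measurable_fun setT f.
  apply/measurable_EFinP; apply: measurable_funM; last first.
    exact: measurableT_comp.
  apply: measurable_funM; first exact: measurableT_comp.
  by apply: measurableT_comp => //; exact: measurable_funB.
have fE t y : f (t, y) = (kap t * lam (t - y) * r0 y)%:E by [].
have kint y : r0 y != 0 ->
    mu.-integrable setT (fun t => (kap t * lam (t - y))%:E) /\
    (\int[mu]_t (kap t * lam (t - y))%:E = B%:E)%E.
  rewrite /r0 patchE mem_setE in_itv /=.
  case: ifP => [/andP[_ yx] _|_]; last by rewrite eqxx.
  have h := abel_kernelE s yx; split; last by rewrite Bfin; exact: h.
  apply/integrableP; split; first exact: measurable_abel.
  have -> : (\int[mu]_t `|(kap t * lam (t - y))%:E| = abel_cst s)%E.
    rewrite -h; apply: eq_integral => t _; apply: gee0_abs; rewrite lee_fin.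
    by apply: mulr_ge0; [exact: kap0|exact: lam0].
  exact: Boo.
have iyf y : (\int[mu]_t f (t, y) = (B * r0 y)%:E)%E.
  have [r00|r00] := eqVneq (r0 y) 0.
    rewrite (eq_integral (fun=> 0%E)) ?integral0 ?r00 ?mulr0 // => t _.
    by rewrite fE r00 mulr0.
  have [ki kE] := kint y r00.
  rewrite (eq_integral (fun t : measurableTypeR R => (r0 y)%:E * (kap t * lam (t - y))%:E)%E).
    by rewrite integralZl // kE -EFinM mulrC.
  by move=> t _; rewrite -EFinM mulrC.
have iyaf y : (\int[mu]_t `|f (t, y)| = (B * `|r0 y|)%:E)%E.
  have [r00|r00] := eqVneq (r0 y) 0.
    rewrite (eq_integral (fun=> 0%E)) ?integral0 ?r00 ?normr0 ?mulr0 // => t _.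
    by rewrite fE r00 mulr0 abse0.
  have [ki kE] := kint y r00.
  rewrite (eq_integral (fun t : measurableTypeR R => (`|r0 y|)%:E * (kap t * lam (t - y))%:E)%E).
    by rewrite integralZl // kE -EFinM mulrC.
  by move=> t _; rewrite -EFinM fE /abse normrM mulrC (@ger0_norm _ (_ * _)) // mulr_ge0 ?kap0 ?lam0.
have imf : (mu \x mu)%E.-integrable setT f.
  apply/(integrable21ltyP mu mu mf).
  rewrite (eq_integral (fun y : measurableTypeR R => B%:E * (`|r0 y|)%:E)%E); last first.
    by move=> y _; rewrite iyaf EFinM.
  have := integrableZl measurableT B (integrable_norm ir0).
  by move/integrable_lty; apply.
have F1 := Fubini imf.
have F2 : (\int[mu]_y \int[mu]_t f (t, y) = (B * \int[mu]_(t in D) rho t)%:E)%E.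
  rewrite (eq_integral (fun y : measurableTypeR R => B%:E * (r0 y)%:E)%E); last first.
    by move=> y _; rewrite iyf EFinM.
  rewrite integralZl // /Rintegral EFinM; congr (_ * _)%E.
  rewrite fineK; first by rewrite [RHS]integral_mkcond; apply: eq_integral => y _; rewrite /r0 !patchE; case: ifP.
  exact: (integrable_fin_num _ iD).
rewrite -[LHS]/(fine _) -[RHS]/(fine (B * _)%:E) -F2 -F1; congr fine.
rewrite [LHS]integral_mkcond; apply: ae_eq_integralW.
have [N [mN N0 sN]] := ae_integrable1 imf; exists N; split=> //.
apply: subset_trans sN; apply: subsetC => t ift _; rewrite patchE mem_setE in_itv /=.
have f1E : (fun y => f (t, y)) = (fun y => (kap t)%:E * (lam (t - y) * r0 y)%:E)%E.
  by apply/funext => y; rewrite -EFinM mulrA.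
case: ifPn => [/andP[tht tx]|]; last first.
  rewrite negb_and -!leNgt => tD; rewrite (eq_integral (fun=> 0%E)) ?integral0 // => y _.
  move: tD => /orP[tth|xt]; last first.
    by rewrite /f /= /kap ppow_neg ?subr_le0 // !mul0r.
  rewrite /f /= /r0 patchE mem_setE in_itv /=; case: ifP => [/andP[ty _]|]; last by rewrite mulr0.
  by rewrite /lam ppow_neg ?mulr0 ?mul0r // subr_le0 (le_trans tth) // ltW.
have kt0 : 0 < kap t by rewrite /kap ppow_pos ?subr_ge0 ?(ltW tx) // powR_gt0 // subr_gt0.
have il : mu.-integrable setT (fun y => (lam (t - y) * r0 y)%:E).
  have := integrableZl measurableT (kap t)^-1 ift.
  apply: eq_integrable => // y _; rewrite /f -EFinM /=; congr _%:E.
  by rewrite -mulrA mulKf // gt_eqF.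
rewrite f1E integralZl // EFinM {1}/kap ppow_pos ?subr_ge0 ?(ltW tx) //; congr (_ * _)%E.
have lE : (\int[mu]_y (lam (t - y) * r0 y)%:E
    = \int[mu]_(y in `]theta, t[) (rho y / (t - y) `^ s)%:E)%E.
  rewrite [RHS]integral_mkcond; apply: eq_integral => y _.
  rewrite /r0 !patchE !mem_setE !in_itv /=.
  have [ty|yt] := leP t y.
    by rewrite /lam ppow_neg ?subr_le0 // mul0r andbF.
  rewrite (lt_trans yt tx) !andbT; case: ifP => _; last by rewrite mulr0.
  by rewrite /lam ppow_pos ?subr_ge0 ?(ltW yt) // powRN mulrC.
rewrite /Rintegral fineK; first by rewrite -lE.
rewrite -lE; exact: (integrable_fin_num _ il).
Qed.

End abel_inversion.

(** * Functions of bounded variation *)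

Section bounded_variation_splitting.
Context {R : realType}.
Implicit Types (theta b t : R) (g : R -> R).
Local Notation TV := total_variation.

Lemma TV_le_open theta b g a t : theta < a -> a <= t -> t < b ->
  (TV a t g <= open_total_variation theta b g)%E.
Proof. by move=> tha at_ tb; apply: ereal_sup_ubound; exists (a, t). Qed.

Lemma open_total_variation_ge0 theta b g : theta < b ->
  (0 <= open_total_variation theta b g)%E.
Proof.
move=> tb; have [h1 h2] := (midf_lt tb).
apply: le_trans (TV_le_open g h1 (lexx _) h2).
exact: total_variation_ge0.
Qed.

(** Here p is the variation of g on ]theta, t].  With l the limit of g at theta, the function
    q = p - (g - l) increases since p increases faster than g does, and |g - l| <= p. *)
Lemma BV_split theta b g : theta < b -> open_BV theta b g ->
  let V := fine (open_total_variation theta b g) in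
  exists p q : R -> R,
  [/\ {homo p : x y / x <= y} /\ {homo q : x y / x <= y},
      forall t, t <= theta -> p t = 0 /\ q t = 0,
      forall t, 0 <= p t <= V, forall t, 0 <= q t <= 2 * V &
      {in `]theta, b[, forall t, g t = lim (g x @[x --> theta^'+]) + p t - q t}].
Proof.
move=> thb gBV V.
have Vfin : open_total_variation theta b g = V%:E.
  by rewrite fineK // ge0_fin_numE ?open_total_variation_ge0.
have V0 : 0 <= V by rewrite -lee_fin -Vfin open_total_variation_ge0.
pose S t := ereal_sup [set TV a t g | a in [set a | theta < a <= t]].
have S0 t : theta < t < b -> (0 <= S t <= V%:E)%E.
  move=> /andP[tht tb]; apply/andP; split.
    apply: (@le_trans _ _ (TV t t g)); first exact: total_variation_ge0.
    by apply: ereal_sup_ubound; exists t => //=; rewrite tht lexx.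
  rewrite -Vfin; apply: ge_ereal_sup => _ [a /= /andP[tha at_] <-].
  exact: TV_le_open.
have Sfin t : theta < t < b -> (fine (S t))%:E = S t.
  move=> /S0/andP[h1 h2]; rewrite fineK // ge0_fin_numE //.
  exact: le_lt_trans h2 (ltry _).
have S1 t : theta < t < b -> 0 <= fine (S t) <= V.
  by move=> tI; rewrite -!lee_fin Sfin // S0.
have SD t t' : theta < t -> t <= t' -> t' < b ->
    fine (S t) + `|g t' - g t| <= fine (S t').
  move=> tht tt' tb.
  have tI : theta < t < b by rewrite tht (le_lt_trans tt').
  have tI' : theta < t' < b by rewrite tb (lt_le_trans tht).
  rewrite -lerBrDr -lee_fin Sfin //; apply: ge_ereal_sup => _ [a /= /andP[tha at_] <-].
  rewrite EFinB leeBrDr //; apply: (@le_trans _ _ (TV a t g + TV t t' g)%E).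
    by rewrite leeD2l // total_variation_ge.
  rewrite -(total_variationD g at_ tt') Sfin //.
  by apply: ereal_sup_ubound; exists a => //=; rewrite tha (le_trans at_).
have gS a t : theta < a -> a <= t -> t < b -> `|g t - g a| <= fine (S t).
  move=> tha at_ tb; rewrite -lee_fin Sfin ?tb ?(lt_le_trans tha) //.
  apply: (le_trans (total_variation_ge g at_)).
  by apply: ereal_sup_ubound; exists a => //=; rewrite tha.
have thb' : (BRight theta < BLeft b)%O by rewrite bnd_simp.
(* Both p and p - g are monotone and bounded near theta, so g has a limit. *)
have cS : cvg (fine (S x) @[x --> theta^'+]).
  apply/cvg_ex; eexists; apply: (@nondecreasing_at_right_cvgr _ _ _ (BLeft b)) => //.
    move=> x y; rewrite !in_itv /= => /andP[x1 x2] /andP[y1 y2] xy.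
    by apply: le_trans (SD _ _ x1 xy y2); rewrite lerDl.
  by exists 0 => _ [x /= xI <-]; move: xI; rewrite in_itv /= => /S1/andP[].
have cSg : cvg (fine (S x) - g x @[x --> theta^'+]).
  apply/cvg_ex; eexists; apply: (@nondecreasing_at_right_cvgr _ (fun x => fine (S x) - g x) _ (BLeft b)) => //.
    move=> x y; rewrite !in_itv /= => /andP[x1 x2] /andP[y1 y2] xy.
    have := SD _ _ x1 xy y2; have := ler_norm (g y - g x); lra.
  have [c1 c2] := midf_lt thb; set c := (_ / _) in c1 c2.
  exists (- (g c + V)) => _ [x /= xI <-]; move: xI; rewrite in_itv /= => /[dup] xI /andP[x1 x2].
  have /andP[Sx _] := S1 _ xI; have := S1 c; rewrite c1 c2 => /(_ isT) /andP[_ Sc].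
  have [xc|cx] := leP x c.
    have := gS _ _ x1 xc c2; have := ler_norm (g x - g c); rewrite distrC; lra.
  have := gS _ _ c1 (ltW cx) x2; have := ler_norm (g x - g c); lra.
have cg : cvg (g x @[x --> theta^'+]).
  have -> : g = (fun x => fine (S x) - (fine (S x) - g x)).
    by apply/funext => x; ring.
  exact: (cvgP _ (cvgB cS cSg)).
set l := lim _.
have gl t : theta < t < b -> `|g t - l| <= fine (S t).
  move=> /andP[tht tb].
  have : `|g t - g x| @[x --> theta^'+] --> `|g t - l|.
    by apply: cvg_norm; apply: cvgB => //; exact: cvg_cst.
  move=> h; rewrite -(cvg_lim _ h) //; apply: limr_le; first by apply/cvg_ex; eexists; exact: h.
  near=> x; apply: gS => //.
  by near: x; apply: nbhs_right_le.
pose p t := if t <= theta then 0 else if t < b then fine (S t) else V.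
pose q t := if t <= theta then 0 else if t < b then fine (S t) - (g t - l) else 2 * V.
have q1 t : theta < t < b -> 0 <= fine (S t) - (g t - l) <= 2 * V.
  move=> tI; have := gl _ tI; have /andP[_] := S1 _ tI.
  rewrite ler_norml => ? /andP[? ?]; apply/andP; split; lra.
exists p, q; split.
- split=> x y xy; rewrite /p /q; have [xth|thx] := leP x theta.
  + have [yth//|thy] := leP y theta; have [yb|by_] := ltP y b => //.
    by have := S1 y; rewrite thy yb => /(_ isT) /andP[].
  + rewrite (lt_geF (lt_le_trans thx xy)); have [yb|by_] := ltP y b.
      rewrite (le_lt_trans xy yb); apply: le_trans (SD _ _ thx xy yb).
      by rewrite lerDl.
    case: ifP => // xb; have := S1 x; rewrite thx xb => /(_ isT) /andP[]//.
  + have [yth//|thy] := leP y theta; have [yb|by_] := ltP y b.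
      by have := q1 y; rewrite thy yb => /(_ isT) /andP[].
    by rewrite mulr_ge0.
  + rewrite (lt_geF (lt_le_trans thx xy)); have [yb|by_] := ltP y b.
      rewrite (le_lt_trans xy yb).
      have := SD _ _ thx xy yb; have := ler_norm (g y - g x); lra.
    by case: ifP => // xb; have := q1 x; rewrite thx xb => /(_ isT) /andP[].
- by move=> t tth; rewrite /p /q tth.
- move=> t; rewrite /p; have [h1|h1] := leP t theta; first by rewrite lexx.
  by have [h2|h2] := ltP t b; [apply: S1; rewrite h1|rewrite V0 lexx].
- move=> t; rewrite /q; have [h1|h1] := leP t theta; first by rewrite lexx mulr_ge0.
  by have [h2|h2] := ltP t b; [apply: q1; rewrite h1|rewrite lexx mulr_ge0].
- move=> t; rewrite in_itv /= => /andP[h1 h2]; rewrite /p /q leNgt h1 h2 /=; ring.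
Unshelve. all: by end_near. Qed.

End bounded_variation_splitting.

(** * Functions with a fractional integral of bounded variation *)

Section fractional_primitive.
Context {R : realType}.
Local Notation mu := (@lebesgue_measure R).
Implicit Types (s x y z t theta : R) (rho g : R -> R) (n : nat).

Definition frac_cst s : R :=
  Gamma (1 - s) / fine (abel_cst s) * (6 / s * tpow_cst).

Lemma frac_cst_ge0 s : 0 < s < 1 -> 0 <= frac_cst s.
Proof.
move=> s01; have /andP[s0 s1] := s01; have /andP[B1 Boo] := abel_cst_fin s01.
have G0 : 0 < Gamma (1 - s) by apply: Gamma_gt0; lra.
rewrite mulr_ge0 ?divr_ge0 ?(ltW G0) ?mulr_ge0 ?tpow_cst_ge0 ?invr_ge0 ?(ltW s0) //.
by rewrite fine_ge0 // (le_trans _ B1).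
Qed.

(** By Abel inversion the primitive of rho is, up to a constant factor, the convolution of
    (x - t)^(s - 1) with the fractional integral g, itself the sum of a step of height l
    at theta and of the difference of two monotone functions. *)
Lemma fractional_primitive_sandwiched s theta n rho g : 0 < s < 1 ->
  -1 < theta < 1 -> (1 < n)%N ->
  mu.-integrable setT (EFin \o rho) ->
  {in `]theta, 1[, g =1 RL_int_right theta s rho} ->
  open_BV theta 1 g ->
  sandwiched n.+1 (frac_cst s * (fine (open_total_variation theta 1 g)
      + `|lim (g x @[x --> theta^'+])|) * (n%:R^-1 * n%:R^-1 `^ s))
    (fun x => \int[mu]_(t in `]theta, x[) rho t).
Proof.
move=> s01 th1 n1 irho gE gBV; have /andP[s0 s1] := s01.
have G0 : 0 < Gamma (1 - s) by apply: Gamma_gt0; lra.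
have /andP[B1 Boo] := abel_cst_fin s01.
have Bfin : (fine (abel_cst s))%:E = abel_cst s.
  by rewrite fineK // ge0_fin_numE // (le_trans _ B1).
rewrite /frac_cst; set B := fine _ in Bfin *.
have B0 : 0 < B by rewrite -lte_fin Bfin (lt_le_trans _ B1) // lte_fin.
have [thm thp] := andP th1.
have [p [q []]] := BV_split thp gBV.
set V := fine _; set l := lim _ => -[pnd qnd] pq0 pV qV gpq.
have V0 : 0 <= V by have /andP[a b] := pV 0; exact: le_trans a b.
pose e t : R := (theta < t)%R%:R.
have end_ : {homo e : x y / x <= y}.
  by move=> x y xy; rewrite ler_nat; case: (ltP theta x) => // h; rewrite (lt_le_trans h xy).
have e0 t : t <= theta -> e t = 0 by move=> h; rewrite /e ltNge h.
have e1 t : 0 <= e t <= 1 by rewrite ler0n lern1 leq_b1.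
pose conv h x := \int[mu]_(t in `]theta, x[) ((x - t) `^ (s - 1) * h t).
set d : R := n%:R^-1 * _.
have d0 : 0 <= d by rewrite mulr_ge0 ?powR_ge0 ?invr_ge0.
have Se := Abel_sandwiched s01 th1 n1 end_ e0 e1.
have Sp := Abel_sandwiched s01 th1 n1 pnd (fun t h => (pq0 t h).1) pV.
have Sq := Abel_sandwiched s01 th1 n1 qnd (fun t h => (pq0 t h).2) qV.
pose T := 2 / s * tpow_cst : R.
have T0 : 0 <= T by rewrite mulr_ge0 ?divr_ge0 ?tpow_cst_ge0 // ltW.
have Sl : sandwiched n.+1 (`|l| * (T * d)) (fun x => l * conv e x).
  rewrite mulr1 -/T -/d in Se.
  have [l0|l0] := leP 0 l; first by rewrite ger0_norm //; exact: sandwichedZ.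
  rewrite -{2}[l]opprK ltr0_norm //.
  apply: eq_sandwiched (sandwichedN (sandwichedZ _ Se)); last by rewrite oppr_ge0 ltW.
  by move=> x _; rewrite !mulNr opprK.
have S := sandwichedZ (ltW (divr_gt0 G0 B0)) (sandwichedD Sl (sandwichedD Sp (sandwichedN Sq))).
apply: sandwichedW (leqnn _) _ (eq_sandwiched _ S).
  have c0 : 0 <= Gamma (1 - s) / B by rewrite divr_ge0 // ltW.
  apply: (@le_trans _ _ (Gamma (1 - s) / B * ((`|l| + 3 * V) * (T * d)))).
    rewrite le_eqVlt; apply/orP; left; apply/eqP; rewrite /T /d; ring.
  rewrite [leRHS](_ : _ = Gamma (1 - s) / B * (3 * (`|l| + V) * (T * d))); last first.
    by rewrite /T; ring.
  apply: ler_wpM2l => //; apply: ler_wpM2r; first exact: mulr_ge0.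
  by have := normr_ge0 l; lra.
move=> x; rewrite in_itv /= => /andP[_ x1].
have ik h W : {homo h : x y / x <= y} -> (forall t, 0 <= h t <= W) ->
    mu.-integrable `]theta, x[ (EFin \o (fun t => (x - t) `^ (s - 1) * h t)).
  move=> hnd hW; apply: (@integrable_kernel _ _ _ _ _ W) => //.
    exact: nondecreasing_measurable.
  by move=> t _; have /andP[a b] := hW t; rewrite ger0_norm.
have inv := abel_inversion theta x s01 irho; rewrite -/B in inv.
rewrite -[RHS](mulKf (lt0r_neq0 B0)) -inv [_ / B]mulrC -mulrA; congr (_ * _).
apply/esym.
pose k h t := (x - t) `^ (s - 1) * h t.
transitivity (\int[mu]_(t in `]theta, x[)
    (Gamma (1 - s) * (l * k e t + (k p t - k q t)))).
  apply: eq_Rintegral => t; rewrite inE /= in_itv /= => /andP[tht tx].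
  have tI : t \in `]theta, 1[ by rewrite in_itv /= tht (lt_trans tx).
  have -> : \int[mu]_(y in `]theta, t[) (rho y / (t - y) `^ s) = Gamma (1 - s) * g t.
    by rewrite gE // /RL_int_right mulVKf // gt_eqF.
  have alg (a b c u v : R) : a * (b * (c + u - v)) = b * (c * (a * 1) + (a * u - a * v)) by ring.
  by rewrite (gpq _ tI) /k /e tht; exact: alg.
have i1 := ik _ _ end_ e1; have i2 := ik _ _ pnd pV; have i3 := ik _ _ qnd qV.
have mD : measurable (`]theta, x[%classic : set (measurableTypeR R)) by exact: measurable_itv.
have j1 : mu.-integrable `]theta, x[ (EFin \o (fun t => l * k e t)) := integrableZl mD l i1.
have j2 : mu.-integrable `]theta, x[ (EFin \o (fun t => k p t - k q t)) := integrableB mD i2 i3.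
have j3 : mu.-integrable `]theta, x[ (EFin \o (fun t => l * k e t + (k p t - k q t))) := integrableD mD j1 j2.
rewrite (RintegralZl _ mD j3) (RintegralD mD j1 j2) (RintegralZl _ mD i1) (RintegralB mD i2 i3).
by [].
Qed.

End fractional_primitive.

(** * The left side of theta *)

Section reflection.
Context {R : realType}.
Local Notation mu := (@lebesgue_measure R).
Implicit Types (a b s x y t theta : R) (f g rho : R -> R) (n : nat).
Local Notation w := (@chebyshev_weight R).

Lemma ge0_integralN (f : R -> \bar R) : measurable_fun setT f ->
  (forall x, 0 <= f x)%E -> (\int[mu]_t f (- t)%R = \int[mu]_t f t)%E.
Proof.
move=> mf f0; have N10 : (-1 : R) != 0 by rewrite oppr_eq0 oner_eq0.
have := ge0_integral_affine 0 N10 mf f0; rewrite normrN1 invr1 mul1e => <-.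
by apply: eq_integral => t _; rewrite mulN1r addr0.
Qed.

Lemma integralN_reflect (f : R -> \bar R) : measurable_fun setT f ->
  (\int[mu]_t f (- t)%R = \int[mu]_t f t)%E.
Proof.
move=> mf; rewrite integralE [RHS]integralE; congr (_ - _)%E.
  rewrite -[RHS]ge0_integralN //; last exact: measurable_funepos.
  by apply: eq_integral => t _; rewrite !funeposE.
rewrite -[RHS]ge0_integralN //; last exact: measurable_funeneg.
by apply: eq_integral => t _; rewrite !funenegE.
Qed.

Lemma Rintegral_reflect a b f : measurable_fun `](- b), (- a)[ f ->
  \int[mu]_(t in `]a, b[) f (- t) = \int[mu]_(t in `](- b), (- a)[) f t.
Proof.
move=> mf; congr fine; rewrite integral_mkcond [RHS]integral_mkcond.
rewrite -[RHS]integralN_reflect; last first.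
  by apply/(measurable_restrictT _ (measurable_itv _)); exact/measurable_EFinP.
apply: eq_integral => t _; rewrite !patchE !mem_setE !in_itv /=.
by rewrite !ltrN2 andbC.
Qed.

Lemma chebyshev_weightN x : w (- x) = w x.
Proof. by rewrite /chebyshev_weight sqrrN. Qed.

Lemma cint_reflect (p : {poly R}) : cint (p \Po - 'X) = cint p.
Proof.
have mp : measurable_fun `](-1 : R), (- - 1)[ (fun t => p.[t] * w t).
  rewrite opprK; apply: measurable_funM; first exact: horner_measurable.
  exact: chebyshev_weight_measurable.
have := Rintegral_reflect mp; rewrite opprK => h; rewrite /cint -[RHS]h.
by apply: eq_Rintegral => t _; rewrite horner_comp !hornerE chebyshev_weightN.
Qed.

Lemma sandwiched_reflect n G f :
  sandwiched n G f -> sandwiched n G (fun x => f (- x)).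
Proof.
have sX (p : {poly R}) : size (p \Po - 'X) = size p.
  by rewrite size_comp_poly2 // size_polyN size_polyX.
move=> [p [q [sp sq pq GG]]]; exists (p \Po - 'X), (q \Po - 'X); split.
- by rewrite sX.
- by rewrite sX.
- move=> x; rewrite in_itv /= => xI; rewrite !horner_comp !hornerE.
  by apply: pq; rewrite in_itv /= ltrNl opprK ltrNl andbC.
- by rewrite -comp_polyB cint_reflect.
Qed.

Lemma open_total_variation_reflect a b f :
  open_total_variation a b f = open_total_variation (- b) (- a) (f \o -%R).
Proof.
have h a' b' f' : (open_total_variation a' b' f' <=
    open_total_variation (- b') (- a') (f' \o -%R))%E.
  apply: ge_ereal_sup => _ [[c d] /= [h1 h2 h3] <-].
  rewrite total_variation_opp; apply: ereal_sup_ubound; exists (- d, - c) => //=.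
  by rewrite !ltrN2 lerN2.
apply/eqP; rewrite eq_le h /=; apply: le_trans (h _ _ _) _.
by rewrite !opprK; have -> : (f \o -%R) \o -%R = f by apply/funext => x /=; rewrite opprK.
Qed.

Lemma lim_at_right_reflect theta f :
  lim (f (- x) @[x --> (- theta)^'+]) = lim (f x @[x --> theta^'-]).
Proof.
congr lim; rewrite at_rightN -fmap_comp.
by have -> : (fun x => f (- x)) \o -%R = f by apply/funext => x /=; rewrite opprK.
Qed.

Lemma integrable_reflect rho : mu.-integrable setT (EFin \o rho) ->
  mu.-integrable setT (EFin \o (fun x => rho (- x))).
Proof.
move=> /integrableP[mr ir]; apply/integrableP; split.
  have /measurable_EFinP m := mr; apply/measurable_EFinP.
  by apply: measurableT_comp => //; exact: oppr_measurable.
rewrite (@ge0_integralN (abse \o (EFin \o rho))) //; last first.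
  by move=> x; exact: abse_ge0.
exact: measurableT_comp.
Qed.

End reflection.

(** * One-sided approximation of absolutely continuous functions *)

Section absolutely_continuous.
Context {R : realType}.
Local Notation mu := (@lebesgue_measure R).
Implicit Types (s x y t theta : R) (v D rho : R -> R) (n m : nat).

Lemma Rintegral_itv_empty (a b : R) (f : R -> R) : b <= a ->
  \int[mu]_(t in `]a, b[) f t = 0.
Proof. by move=> ba; rewrite set_itv_ge ?Rintegral_set0 // bnd_simp -leNgt. Qed.

Lemma increment_integral v rho a b x y :
  mu.-integrable setT (EFin \o rho) ->
  (forall x, a <= x <= b -> v x - v a = \int[mu]_(t in `]a, x]) rho t) ->
  a <= x -> x <= y -> y <= b -> v y - v x = \int[mu]_(t in `]x, y[) rho t.
Proof.
move=> ir vE ax xy yb.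
have iS (A : set (measurableTypeR R)) : measurable A -> mu.-integrable A (EFin \o rho).
  by move=> mA; apply: integrableS ir.
rewrite Rintegral_itv_bndo_bndc; last exact: iS.
rewrite -(@Rintegral_itvB _ rho (BRight a) (BRight y) x) //; last exact: iS.
by rewrite -!vE ?(le_trans ax) ?(le_trans _ yb) ?ax //; ring.
Qed.

(** The finite value of the seminorm of a function whose m-th derivative is D. *)
Definition RL_sum theta s D : R :=
  fine (open_total_variation (-1) theta (RL_int_left theta s D))
  + fine (open_total_variation theta 1 (RL_int_right theta s D))
  + `|lim (RL_int_left theta s D x @[x --> theta^'-])|
  + `|lim (RL_int_right theta s D x @[x --> theta^'+])|.

(** The function v is the constant v (theta), plus the primitive of its density to the
    right of theta, minus that to the left; the latter is treated on the reflected interval.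
    The density equals D almost everywhere. *)
Lemma abs_cont_sandwiched s theta n v D : 0 < s < 1 -> -1 < theta < 1 ->
  (1 < n)%N -> abs_cont (-1) 1 v ->
  {in `]-1, 1[, forall x, derivable v x 1 -> D x = derive1 v x} ->
  open_BV (-1) theta (RL_int_left theta s D) ->
  open_BV theta 1 (RL_int_right theta s D) ->
  sandwiched n.+1 (frac_cst s * RL_sum theta s D * (n%:R^-1 * n%:R^-1 `^ s)) v.
Proof.
move=> s01 th1 n1 vac vD BVl BVr; have [thm thp] := andP th1.
have lt11 : (-1 : R) < 1 by rewrite (lt_trans (ltrN10 R)).
have [rho [ir vE [N [mN N0 sN]]]] := abs_cont_derive lt11 vac.
have aeD : {ae mu, forall x, x \in `]-1, 1[ -> D x = rho x}.
  exists N; split=> //; apply: subset_trans sN; apply: subsetC => x H xI.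
  by have [dv <-] := H xI; exact: vD.
have aeS (a b : R) (k : R -> R) : -1 <= a -> b <= 1 ->
    \int[mu]_(y in `]a, b[) (D y / k y) = \int[mu]_(y in `]a, b[) (rho y / k y).
  move=> a1 b1; congr fine; apply: ae_eq_integralW.
  have [M [mM M0 sM]] := aeD; exists M; split=> //.
  apply: subset_trans sM; apply: subsetC => x H; rewrite /= in_itv /= => /andP[ax xb].
  by rewrite H // in_itv /= (le_lt_trans a1 ax) (lt_le_trans xb b1).
have mrho : measurable_fun setT rho by have /measurable_int/measurable_EFinP := ir.
have Er : {in `]theta, 1[, RL_int_right theta s D =1 RL_int_right theta s rho}.
  move=> t; rewrite in_itv /= => /andP[_ /ltW t1]; rewrite /RL_int_right.
  by rewrite (aeS _ _ (fun y => (t - y) `^ s) (ltW thm) t1).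
pose rho' t := rho (- t).
pose gl t := RL_int_left theta s D (- t).
have El : {in `](- theta), 1[, gl =1 RL_int_right (- theta) s rho'}.
  move=> t; rewrite in_itv /= => /andP[_ /ltW t1].
  rewrite /gl /RL_int_left /RL_int_right.
  have t1' : -1 <= - t by rewrite lerN2.
  rewrite (aeS _ _ (fun y => (y - - t) `^ s) t1' (ltW thp)).
  have mf : measurable_fun `](- t), (- - theta)[ (fun y => rho y / (y - - t) `^ s).
    apply: measurable_funTS; apply: measurable_funM => //.
    under eq_fun do rewrite -powRN.
    apply: (@measurableT_comp _ _ _ _ _ _ (fun y : R => y `^ (- s)) _ (fun y => y - - t)).
      exact: measurable_powR.
    exact: measurable_funB.
  have := Rintegral_reflect mf; rewrite (opprK theta) => <-.
  have -> // : \int[mu]_(y in `](- theta), t[) (rho (- y) / (- y - - t) `^ s)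
      = \int[mu]_(y in `](- theta), t[) (rho' y / (t - y) `^ s).
  by apply: eq_Rintegral => y _; rewrite opprK /rho' [- y + t]addrC.
have th1' : -1 < - theta < 1 by lra.
have e1 : open_total_variation (- theta) 1 gl
    = open_total_variation (-1) theta (RL_int_left theta s D).
  by rewrite [RHS]open_total_variation_reflect opprK.
have BVl' : open_BV (- theta) 1 gl by rewrite /open_BV e1; exact: BVl.
have Sr := fractional_primitive_sandwiched s01 th1 n1 ir Er BVr.
have Sl := fractional_primitive_sandwiched s01 th1' n1 (integrable_reflect ir) El BVl'.
have sc : (size (v theta)%:P <= n.+1)%N by rewrite (leq_trans (size_polyC_leq1 _)).
apply: sandwichedW (leqnn _) _ (eq_sandwiched _ (sandwichedD (sandwiched_poly sc)
  (sandwichedD Sr (sandwichedN (sandwiched_reflect Sl))))).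
  rewrite e1 /gl lim_at_right_reflect /RL_sum.
  have alg (c a b l1 l2 e : R) :
      0 + (c * (b + l2) * e + c * (a + l1) * e) <= c * (a + b + l1 + l2) * e.
    by rewrite le_eqVlt; apply/orP; left; apply/eqP; ring.
  exact: alg.
move=> x; rewrite in_itv /= => /andP[/ltW x1 /ltW x2]; rewrite hornerC.
clear e1 Er El BVl BVr BVl' Sr Sl.
have [xth|thx] := leP x theta.
  rewrite (Rintegral_itv_empty _ xth) sub0r.
  have mr : measurable_fun `](- - x), (- - theta)[ rho by exact: measurable_funTS.
  rewrite (Rintegral_reflect mr) !opprK.
  by rewrite -(increment_integral ir vE x1 xth (ltW thp)); ring.
have thx' : - x <= - theta by rewrite lerN2 ltW.
rewrite [X in _ + (_ - X)](Rintegral_itv_empty _ thx') subr0.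
by rewrite -(increment_integral ir vE (ltW thm) (ltW thx) x2); ring.
Qed.

End absolutely_continuous.

(** * The error bounds *)

Section error_bounds.
Context {R : realType}.
Local Notation mu := (@lebesgue_measure R).
Implicit Types (s theta : R) (u : R -> R) (k m n N : nat).

(** Each integration gains a factor 10 pi / n. *)
Lemma sandwiched_derive1n k n G u : (0 < n)%N -> 0 <= G ->
  (forall i, (i < k)%N -> {in `]-1, 1[, forall x, derivable (derive1n i u) x 1}) ->
  sandwiched n G (derive1n k u) ->
  sandwiched (n + k) (G * (10 * pi / n%:R) ^+ k) u.
Proof.
have p0 := @pi_gt0 R.
elim: k n G => [|k ih] n G n0 G0 du S; first by rewrite addn0 expr0 mulr1.
have n0R : 0 < n%:R :> R by rewrite ltr0n.
have Sk : sandwiched n.+1 (10 * pi * G / n.+1%:R) (derive1n k u).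
  apply: sandwiched_derive S => // x xI.
  have := DeriveDef (du k (ltnSn k) x xI) (erefl _).
  by rewrite derive1nS derive1E.
rewrite addnS -addSn.
apply: sandwichedW (leqnn _) _ (ih _ _ _ _ _ Sk) => //.
- have a0 : 0 <= 10 * pi / n.+1%:R :> R by rewrite divr_ge0 // mulr_ge0 // ltW.
  have an : 10 * pi / n.+1%:R <= 10 * pi / n%:R :> R.
    by rewrite ler_wpM2l ?mulr_ge0 ?(ltW p0) // lef_pV2 ?posrE // ler_nat.
  rewrite exprS mulrA; apply: ler_pM => //.
  + by rewrite mulr_ge0 ?invr_ge0 // mulr_ge0 // mulr_ge0 // ltW.
  + exact: exprn_ge0.
  + rewrite [leLHS](_ : _ = G * (10 * pi / n.+1%:R)); last by ring.
    exact: ler_wpM2l.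
  + by rewrite lerXn2r ?nnegrE // (le_trans a0).
- by rewrite mulr_ge0 ?invr_ge0 // mulr_ge0 // mulr_ge0 // ltW.
- by move=> i ik; apply: du; exact: ltnW.
Qed.

Lemma in_W_finite theta m s u : -1 < theta < 1 -> in_W theta m s u ->
  U_seminorm theta m s u = (RL_sum theta s (derive1n m u))%:E.
Proof.
move=> /andP[th1 th2] [_ _ _ BVl BVr].
have f (a b : R) (g : R -> R) : a < b -> open_BV a b g ->
    open_total_variation a b g = (fine (open_total_variation a b g))%:E.
  by move=> ab h; rewrite fineK // ge0_fin_numE ?open_total_variation_ge0.
by rewrite /U_seminorm /RL_sum (f _ _ _ th1 BVl) (f _ _ _ th2 BVr) !EFinD.
Qed.

Lemma RL_sum_ge0 theta s D : -1 < theta < 1 -> 0 <= RL_sum theta s D.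
Proof.
by move=> /andP[th1 th2]; rewrite !addr_ge0 // fine_ge0 // open_total_variation_ge0.
Qed.

(** The factors 2 account for the degree N - k, at least N / 2, which is
    left for the derivative of order k. *)
Definition rate_cst s k : R :=
  frac_cst s * (2 * 2 `^ s * (20 * pi) ^+ k).

Lemma rate_cst_ge0 s k : 0 < s < 1 -> 0 <= rate_cst s k.
Proof.
move=> s01; rewrite mulr_ge0 ?frac_cst_ge0 // mulr_ge0 ?mulr_ge0 ?powR_ge0 //.
by rewrite exprn_ge0 // mulr_ge0 // pi_ge0.
Qed.

(** The derivative of order k = m - 1 is absolutely continuous, with gap of
    order N^(- 1 - s); k integrations give the other factors. *)
Lemma in_W_sandwiched theta s k u N : 0 < s < 1 -> -1 < theta < 1 ->
  in_W theta k.+1 s u -> (k.*2.+2 <= N)%N ->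
  sandwiched N.+1 (rate_cst s k * N%:R `^ (- (k.+1%:R + s))
                   * RL_sum theta s (derive1n k.+1 u)) u.
Proof.
move=> s01 th1 uW kN; have /andP[s0 s1] := s01; have [_ du dv BVl BVr] := uW.
have p0 := @pi_gt0 R.
have [v vac uv] := dv k (ltnSn k).
pose n := (N - k)%N.
have n1 : (1 < n)%N by rewrite /n; lia.
have nkN : (n.+1 + k = N.+1)%N by rewrite /n; lia.
have nN : (N <= n.*2)%N by rewrite /n; lia.
have N0 : 0 < N%:R :> R by rewrite ltr0n; lia.
have n0 : 0 < n%:R :> R by rewrite ltr0n; lia.
set U := RL_sum _ _ _.
have U0 : 0 <= U by exact: RL_sum_ge0.
have S : sandwiched n.+1 (frac_cst s * U * (n%:R^-1 * n%:R^-1 `^ s)) (derive1n k u).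
  apply: (eq_sandwiched _ (abs_cont_sandwiched s01 th1 n1 vac _ BVl BVr)).
    by move=> x xI; rewrite uv.
  move=> x; rewrite in_itv /= => /andP[x1 x2] _.
  rewrite !derive1E; apply: near_eq_derive.
  near=> y; apply: uv; rewrite in_itv /=.
  by apply/andP; split; near: y; [exact: lt_nbhsr|exact: lt_nbhsl].
have F0 := frac_cst_ge0 s01.
have d0 : 0 <= n%:R^-1 * n%:R^-1 `^ s :> R by rewrite mulr_ge0 ?powR_ge0 ?invr_ge0.
have g0 : 0 <= frac_cst s * U * (n%:R^-1 * n%:R^-1 `^ s) by exact: mulr_ge0 (mulr_ge0 F0 U0) d0.
have := sandwiched_derive1n (ltn0Sn n) g0 (fun i ik => du i ik) S.
rewrite nkN.
apply: sandwichedW (leqnn _) _.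
have nV : n%:R^-1 <= 2 * N%:R^-1 :> R.
  rewrite -[2]invrK -invfM lef_pV2 ?posrE ?mulr_gt0 ?invr_gt0 //.
  by rewrite mulrC ler_pdivrMr // -natrM ler_nat muln2.
have nV' : n.+1%:R^-1 <= 2 * N%:R^-1 :> R.
  by apply: le_trans _ nV; rewrite lef_pV2 ?posrE // ler_nat.
have NV : N%:R `^ (- (k.+1%:R + s)) = N%:R^-1 * (N%:R^-1 `^ s) * N%:R^-1 ^+ k :> R.
  have -> : N%:R^-1 `^ s = (N%:R `^ s)^-1 :> R.
    by rewrite -powR_inv1 ?(ltW N0) // -powRrM mulN1r powRN.
  rewrite powRN powRD; last by rewrite (gt_eqF N0) implybT.
  by rewrite powR_mulrn ?(ltW N0) // exprS !invfM exprVn; ring.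
rewrite NV /rate_cst.
rewrite [leRHS](_ : _ = frac_cst s * U * (2 * N%:R^-1 * (2 `^ s * N%:R^-1 `^ s)) * ((20 * pi) ^+ k * N%:R^-1 ^+ k)); last by ring.
rewrite -powRM ?invr_ge0 ?(ltW N0) // -exprMn.
have k0 : 0 <= 10 * pi / n.+1%:R :> R by rewrite divr_ge0 // mulr_ge0 // ltW.
apply: ler_pM => //.
- exact: exprn_ge0.
- apply: ler_wpM2l; first exact: mulr_ge0.
  apply: ler_pM => //; rewrite ?invr_ge0 ?powR_ge0 ?(ltW n0) //.
  by rewrite ge0_ler_powR ?nnegrE ?(ltW s0) ?mulr_ge0 ?invr_ge0 // ltW.
- rewrite lerXn2r ?nnegrE //.
    by rewrite mulr_ge0 ?invr_ge0 // mulr_ge0 // ltW.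
  rewrite [leRHS](_ : _ = 10 * pi * (2 * N%:R^-1)); last by ring.
  by rewrite ler_wpM2l // mulr_ge0 // ltW.
Unshelve. all: by end_near. Qed.

End error_bounds.

Theorem theorem1 (R : realType) (m : nat) (s : R)
    (s01 : 0 < s < 1) (ms1 : 1 < m%:R + s) :
  exists N0 : nat, forall theta : R, -1 < theta < 1 ->
  exists2 C : R, 0 < C &
  forall u : R -> R, in_W theta m s u ->
  forall N : nat, (N0 <= N)%N ->
    (forall x : 'I_N.+1 -> R, chebyshev_nodes x ->
      [/\ (Linf_norm (fun t => (u t - (interpolant x u).[t])%R)
             <= (C * N%:R `^ (1 - m%:R - s))%:E * U_seminorm theta m s u)%E,
          (L2w_norm (fun t => (u t - (interpolant x u).[t])%R)
             <= (C * N%:R `^ (2^-1 - m%:R - s))%:E * U_seminorm theta m s u)%E &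
          (`|chebyshev_remainder x u|%:E
             <= (C * N%:R `^ (- (m%:R + s)))%:E * U_seminorm theta m s u)%E]) /\
    (forall y : 'I_N.+1 -> R, legendre_nodes y ->
      (`|legendre_remainder y u|%:E
         <= (C * N%:R `^ (- (m%:R + s)))%:E * U_seminorm theta m s u)%E).
Proof.
case: m ms1 => [|k] ms1; first by move: s01 ms1; rewrite add0r => /andP[_ s1]; lra.
exists k.*2.+2 => theta th1; have K0 := rate_cst_ge0 k s01.
exists (4 * rate_cst s k + 1) => [|u uW N kN]; first by rewrite ltr_wpDl // mulr_ge0.
rewrite (in_W_finite th1 uW).
have S := in_W_sandwiched s01 th1 uW kN.
have U0 := RL_sum_ge0 s (derive1n k.+1 u) th1.
set U := RL_sum _ _ _ in S U0 *; set K := rate_cst s k in S K0 *.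
have N0 : (0 < N)%N by lia.
have N0R : 0 < N%:R :> R by rewrite ltr0n.
have mu_u : measurable_fun `](-1 : R), 1[ u.
  by have [/measurable_int/measurable_EFinP] := uW.
set a := - (k.+1%:R + s) in S *.
have bound (c b : R) : 0 <= c <= 4 ->
    c * N%:R `^ b * (K * N%:R `^ a * U) <= (4 * K + 1) * N%:R `^ (b + a) * U.
  move=> /andP[c0 c4]; rewrite powRD; last by rewrite (gt_eqF N0R) implybT.
  have Nb := powR_ge0 (N%:R : R) b; have Na := powR_ge0 (N%:R : R) a.
  rewrite [leLHS](_ : _ = c * K * (N%:R `^ b * N%:R `^ a * U)); last by ring.
  rewrite -[leRHS]mulrA ler_wpM2r ?mulr_ge0 //.
  by rewrite (@le_trans _ _ (4 * K)) ?lerDl // ler_wpM2r.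
have bound0 : K * N%:R `^ a * U <= (4 * K + 1) * N%:R `^ a * U.
  have := bound 1 0; rewrite powRr0 !mul1r add0r; apply.
  by rewrite ler01 ler1n.
split=> [x xT|y yL]; last first.
  rewrite -EFinM lee_fin (le_trans _ bound0) //.
  exact: (legendre_remainder_le N0 mu_u S yL).
split.
- rewrite -EFinM (le_trans (Linf_interpolant_le N0 S xT)) // lee_fin.
  rewrite (_ : 1 - _ - s = 1 + a); last by rewrite /a; ring.
  by have := bound 4 1; rewrite powRr1 ?ler0n //; apply; rewrite lexx andbT.
- rewrite -EFinM (le_trans (L2w_interpolant_le N0 mu_u S xT)) // lee_fin.
  rewrite (_ : 2^-1 - _ - s = 2^-1 + a); last by rewrite /a; ring.
  by apply: bound; rewrite ler0n ler_nat.
- rewrite -EFinM lee_fin (le_trans _ bound0) //.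
  exact: (chebyshev_remainder_le N0 mu_u S xT).
Qed.
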